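(* For every function $f\in\mathcal{K}$, with logarithmic coefficients $\gamma_1,\gamma_2$, one has $$-\frac{1}{\sqrt{10}}\le |\gamma_2|-|\gamma_1|\le \frac16 .$$ The second (right) inequality is sharp: there is a function in $\mathcal{K}$ for which equality holds in it.
   Context: Let $\mathbb{D}=\{z\in\mathbb{C}:|z|<1\}$ be the open unit disk. Let $\mathcal{A}$ be the class of functions $f$ analytic in $\mathbb{D}$ and normalized so that $f(z)=z+a_2z^2+a_3z^3+\cdots$ (that is, $f(0)=0$, $f'(0)=1$). Let $\mathcal{K}\subset\mathcal{A}$ be the class of convex (univalent) functions, i.e. those $f\in\mathcal{A}$ that are injective on $\mathbb{D}$ and map $\mathbb{D}$ onto a convex domain $f(\mathbb{D})$. For $f\in\mathcal{K}$, the logarithmic coefficients $\gamma_n$, $n=1,2,\ldots$, are defined by $$\log\frac{f(z)}{z}=2\sum_{n=1}^\infty\gamma_n z^n,\qquad z\in\mathbb{D},$$ where $f(z)/z$ is taken to be $1$ at $z=0$ and the branch of the logarithm is the one vanishing at $z=0$. Equating coefficients gives $\gamma_1=\frac{a_2}{2}$ and $\gamma_2=\frac12\left(a_3-\frac{a_2^2}{2}\right)$. *)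

(* Defs.v *)
(* Stdlib reals with Coquelicot's complex numbers. Functions on the unit disk
   are total functions [C -> C] of which only the values on the disk matter. *)
From Stdlib Require Import Reals.
From Coquelicot Require Import Coquelicot.

Open Scope R_scope.

Definition in_disk (z : C) : Prop := Cmod z < 1.

Definition Cexp (z : C) : C :=
  (exp (Re z) * cos (Im z), exp (Re z) * sin (Im z)).

Definition holomorphic_on_disk (f : C -> C) : Prop :=
  forall z : C, in_disk z ->
    @ex_derive C_AbsRing C_NormedModule f z.

(* f is analytic in the disk and f(z) = z + a_2 z^2 + a_3 z^3 + ... there. *)
Definition class_A (f : C -> C) : Prop :=
  holomorphic_on_disk f /\
  exists a : nat -> C,
    a 0%nat = RtoC 0 /\ a 1%nat = RtoC 1 /\
    forall z : C, in_disk z ->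
      @is_pseries C_AbsRing C_NormedModule a z (f z).

Definition univalent_on_disk (f : C -> C) : Prop :=
  forall z w : C, in_disk z -> in_disk w -> f z = f w -> z = w.

Definition disk_image (f : C -> C) (w : C) : Prop :=
  exists z : C, in_disk z /\ f z = w.

Definition convex_set (S : C -> Prop) : Prop :=
  forall (p q : C) (t : R), S p -> S q -> 0 <= t <= 1 ->
    S (RtoC (1 - t) * p + RtoC t * q)%C.

(* Connectedness of the domain is implied by convexity. *)
Definition convex_domain (S : C -> Prop) : Prop :=
  (exists w : C, S w) /\ @open C_UniformSpace S /\ convex_set S.

Definition class_K (f : C -> C) : Prop :=
  class_A f /\ univalent_on_disk f /\ convex_domain (disk_image f).

(* L is the branch on the disk of log (f(z)/z) vanishing at 0; the quotient is
   read as 1 at z = 0, so that Cexp (L 0) = 1 is contained in L 0 = 0. *)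
Definition is_log_quotient (f L : C -> C) : Prop :=
  L (RtoC 0) = RtoC 0 /\
  (forall z : C, in_disk z -> @continuous C_UniformSpace C_UniformSpace L z) /\
  (forall z : C, in_disk z -> z <> RtoC 0 -> Cexp (L z) = (f z / z)%C).

(* log (f(z)/z) = 2 * (sum over n >= 1 of gamma_n z^n) on the disk. The sum is
   indexed by k = n - 1; the value [gamma 0] is irrelevant. *)
Definition log_coefficients (f : C -> C) (gamma : nat -> C) : Prop :=
  exists L : C -> C,
    is_log_quotient f L /\
    forall z : C, in_disk z ->
      exists s : C,
        @is_series C_AbsRing C_NormedModule
          (fun k : nat => (gamma (S k) * Cpow z (S k))%C) s /\
        L z = (RtoC 2 * s)%C.

(* Main.v *)
Require Import Defs.
From Stdlib Require Import Reals Lra Lia Psatz Classical ClassicalEpsilon Ranalysis5.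
From Coquelicot Require Import Coquelicot.

(** Write [f z = z + a2 z^2 + a3 z^3 + ...]. Comparing coefficients in
    [z exp (L z) = f z] gives [a2 = 2 gamma 1] and [a3 = 2 gamma 2 + 2 gamma 1 ^ 2], and
    the bounds follow by calculus from one inequality for convex functions,
    [3 |a3 - a2^2| <= 1 - |a2|^2] ([convex_third_coefficient]).

    For this inequality let [g z] be the midpoint of [f (e^{it} z)] and [f (e^{-it} z)].
    It lies in the convex image of [f], so [g = f o omega] with a holomorphic map [omega]
    of the disk into itself, fixing 0, whose Taylor coefficients up to order three are
    polynomials in [cos t], [a2] and [a3] ([rotmean_subordinate]). On circles around 0,
    [Re (omega z conj z) <= |z|] holds pointwise; multiplying by the squared modulus of a
    quadratic polynomial and taking means gives a positive quadratic form in the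
    coefficients of the polynomial ([bounded_coefficients]). Its leading term as [t -> 0]
    is again positive ([convex_form_nonneg]), and the right polynomial gives the
    inequality.

    Two facts of complex analysis carry the argument, and both are proved here directly.
    First, [omega = f^-1 o g] is holomorphic: the derivative of an injective power series
    has no zero ([injective_derivative_nonzero]), since near a multiple zero the equation
    [f z = f w] has solutions with [z <> w] that Newton iteration finds, and zeros have
    finite order because dividing by [z - w] hardly increases the coefficient bounds.
    Secondly, the mean of a holomorphic function over a circle is independent of the
    radius ([circle_int_const]), by the Cauchy-Riemann equations in polar coordinates and
    differentiation under the integral.

    Equality in the upper bound holds for [artanh], which maps the disk onto the strip
    [|Im w| < pi/4]. The logarithm of [artanh z / z] is given by a power series in [z^2]
    that converges in the whole disk, as its coefficients are positive and bounded by a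
    recursion ([log_quot_dcoef_bounds]). *)

Open Scope R_scope.

(** * Series and power series *)

Notation Cser := (@is_series C_AbsRing C_NormedModule).

Lemma Cmod_minus_comm (x y : C) : Cmod (x - y) = Cmod (y - x).
Proof. replace (x - y)%C with (- (y - x))%C by ring. apply Cmod_opp. Qed.

Lemma Cmod_sub_ge (x y : C) : Cmod x - Cmod y <= Cmod (x - y).
Proof.
  generalize (Cmod_triangle (x - y) y).
  replace (x - y + y)%C with x by ring. lra.
Qed.

Lemma Cmod_sub_le (x y : C) : Cmod (x - y) <= Cmod x + Cmod y.
Proof.
  unfold Cminus. generalize (Cmod_triangle x (- y)). rewrite Cmod_opp. lra.
Qed.

Lemma Cser_ext (u v : nat -> C) (l : C) :
  (forall n, u n = v n) -> Cser u l -> Cser v l.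
Proof. apply is_series_ext. Qed.

Lemma Cser_unique (u : nat -> C) (l l' : C) : Cser u l -> Cser u l' -> l = l'.
Proof.
  intros H H'.
  apply (filterlim_locally_unique (F := eventually) (sum_n u) l l' H H').
Qed.

Lemma Cser_le (u : nat -> C) (v : nat -> R) (l : C) (s : R) :
  Cser u l -> is_series v s -> (forall n, Cmod (u n) <= v n) -> Cmod l <= s.
Proof.
  intros Hu Hv H.
  assert (L1 : filterlim (fun n => norm (sum_n u n)) eventually (locally (norm l))).
  { eapply filterlim_comp; [exact Hu|apply filterlim_norm]. }
  change (Cmod l) with (@norm C_AbsRing C_NormedModule l).
  refine (is_lim_seq_le (fun n => norm (sum_n u n)) (sum_n v) (norm l) s _ L1 Hv).
  intros n.
  eapply Rle_trans. apply (norm_sum_n_m u).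
  apply sum_n_m_le. intros k. apply H.
Qed.

Lemma series_nonneg (v : nat -> R) (s : R) :
  is_series v s -> (forall n, 0 <= v n) -> 0 <= s.
Proof.
  intros Hv H.
  refine (is_lim_seq_le (fun _ => 0) (sum_n v) 0 s _ (is_lim_seq_const 0) Hv).
  intros n. rewrite <- (Rmult_0_r (INR (S n))), <- sum_n_const.
  apply sum_n_m_le. exact H.
Qed.

Lemma Cser_ex_le (u : nat -> C) (v : nat -> R) :
  (forall n, Cmod (u n) <= v n) -> ex_series v -> exists l, Cser u l.
Proof.
  intros H Hv.
  apply (@ex_series_le C_AbsRing C_CompleteNormedModule u v).
  - intros n. change (@norm _ C_CompleteNormedModule (u n)) with (@norm C_AbsRing C_NormedModule (u n)).
    apply H.
  - exact Hv.
Qed.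

Lemma Cser_plus u v (a b : C) :
  Cser u a -> Cser v b -> Cser (fun n => (u n + v n)%C) (a + b)%C.
Proof. intros H1 H2. exact (is_series_plus u v a b H1 H2). Qed.

Lemma Cser_minus u v (a b : C) :
  Cser u a -> Cser v b -> Cser (fun n => (u n - v n)%C) (a - b)%C.
Proof. intros H1 H2. exact (is_series_minus u v a b H1 H2). Qed.

Lemma Cser_scal (c : C) u (a : C) :
  Cser u a -> Cser (fun n => (c * u n)%C) (c * a)%C.
Proof. intros H1. exact (is_series_scal (V := C_NormedModule) c u a H1). Qed.

Lemma Cser_shift u (a : C) :
  Cser u a -> Cser (fun n => u (S n)) (a - u 0%nat)%C.
Proof.
  intros H. apply is_series_incr_1.
  change (Cser u (a - u 0%nat + u 0%nat)%C).
  replace (a - u 0%nat + u 0%nat)%C with a by ring. exact H.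
Qed.

Lemma Cser_unshift u (a : C) :
  Cser (fun n => u (S n)) a -> Cser u (u 0%nat + a)%C.
Proof.
  intros H. apply is_series_decr_1.
  change (Cser (fun n => u (S n)) (u 0%nat + a - u 0%nat)%C).
  replace (u 0%nat + a - u 0%nat)%C with a by ring. exact H.
Qed.

Definition csum (u : nat -> C) (n : nat) : C := @sum_n C_AbelianGroup u n.

Lemma Cser_bounded u (a : C) : Cser u a -> exists M, forall n, Cmod (u n) <= M.
Proof.
  intros H.
  destruct (@filterlim_bounded C_AbsRing C_NormedModule (sum_n u)) as [M HM].
  exists a; exact H.
  exists (2 * M); intros n.
  assert (HM' : forall n, Cmod (csum u n) <= M) by exact HM.
  assert (M0 := Rle_trans _ _ _ (Cmod_ge_0 _) (HM' 0%nat)).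
  destruct n as [|n].
  - replace (u 0%nat) with (csum u 0). specialize (HM' 0%nat). lra.
    apply sum_O.
  - replace (u (S n)) with (csum u (S n) - csum u n)%C.
    eapply Rle_trans. apply Cmod_sub_le.
    generalize (HM' (S n)) (HM' n). lra.
    unfold csum. rewrite sum_Sn. change plus with Cplus. ring.
Qed.

(** Cauchy's estimates at every radius below 1. They are equivalent to convergence in
    the unit disk, and multiplication by [n], shifts and divisions are easily followed
    on them. *)
Definition disk_coeffs (a : nat -> C) : Prop :=
  forall r, 0 < r < 1 -> exists M, forall n, Cmod (a n) * r ^ n <= M.

Definition pser (a : nat -> C) (z l : C) : Prop := Cser (fun n => (a n * z ^ n)%C) l.

Lemma is_pseries_pser a z l :
  @is_pseries C_AbsRing C_NormedModule a z l <-> pser a z l.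
Proof.
  assert (E : forall n, scal (@pow_n C_Ring z n) (a n) = (a n * z ^ n)%C).
  { intros n. change ((@pow_n C_Ring z n * a n)%C = (a n * z ^ n)%C). rewrite Cmult_comm. reflexivity. }
  split; apply Cser_ext; intros n; rewrite E; reflexivity.
Qed.

Lemma disk_coeffs_of_pser a :
  (forall r, 0 < r < 1 -> exists l, pser a (RtoC r) l) -> disk_coeffs a.
Proof.
  intros H r Hr. destruct (H r Hr) as [l Hl].
  destruct (Cser_bounded _ _ Hl) as [M HM]. exists M; intros n.
  specialize (HM n). rewrite Cmod_mult, Cmod_pow, Cmod_R, Rabs_pos_eq in HM; lra.
Qed.

Lemma disk_coeffs_abs a rho : disk_coeffs a -> 0 <= rho < 1 ->
  ex_series (fun n => Cmod (a n) * rho ^ n).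
Proof.
  intros Ha Hr. set (r := (1 + rho) / 2).
  destruct (Ha r) as [M HM]. unfold r; lra.
  assert (Hrp : 0 < r < 1) by (unfold r; lra).
  assert (Hq : 0 <= rho / r < 1).
  { split. apply Rdiv_le_0_compat; lra.
    apply Rmult_lt_reg_r with r. lra. unfold Rdiv; rewrite Rmult_assoc, Rinv_l; unfold r; lra. }
  apply (@ex_series_le R_AbsRing R_CompleteNormedModule _ (fun n => M * (rho / r) ^ n)).
  - intros n. change (Rabs (Cmod (a n) * rho ^ n) <= M * (rho / r) ^ n).
    rewrite Rabs_pos_eq.
    2: apply Rmult_le_pos; [apply Cmod_ge_0|apply pow_le; lra].
    replace (rho ^ n) with (r ^ n * (rho / r) ^ n).
    2:{ rewrite <- Rpow_mult_distr. f_equal. field. lra. }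
    rewrite <- Rmult_assoc. apply Rmult_le_compat_r. apply pow_le; lra. apply HM.
  - apply (ex_series_scal_l M (fun n => (rho / r) ^ n)). apply ex_series_geom. rewrite Rabs_pos_eq; lra.
Qed.

Lemma disk_coeffs_ex a z : disk_coeffs a -> Cmod z < 1 -> exists l, pser a z l.
Proof.
  intros Ha Hz. apply Cser_ex_le with (fun n => Cmod (a n) * Cmod z ^ n).
  - intros n. rewrite Cmod_mult, Cmod_pow. lra.
  - apply disk_coeffs_abs; auto. split; [apply Cmod_ge_0|exact Hz].
Qed.

(** [n s^n] is at most the geometric sum [1 + s + ... + s^n], its last term being the
    smallest. *)
Lemma n_pow_le s n : 0 <= s < 1 -> INR n * s ^ n <= / (1 - s).
Proof.
  intros Hs.
  assert (H : INR n * s ^ n <= sum_f_R0 (fun k => s ^ k) n).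
  { induction n as [|n IH]. simpl; lra.
    rewrite tech5. rewrite S_INR. simpl pow.
    assert (0 <= s ^ n) by (apply pow_le; lra).
    assert (0 <= INR n * s ^ n) by (apply Rmult_le_pos; [apply pos_INR|auto]).
    nra. }
  eapply Rle_trans; [exact H|].
  rewrite tech3; [|lra]. unfold Rdiv. rewrite <- (Rmult_1_l (/ (1 - s))) at 2.
  apply Rmult_le_compat_r. left; apply Rinv_0_lt_compat; lra.
  assert (0 <= s ^ S n) by (apply pow_le; lra). lra.
Qed.

Lemma disk_coeffs_mul_n a : disk_coeffs a -> disk_coeffs (fun n => (RtoC (INR n) * a n)%C).
Proof.
  intros Ha r Hr. set (r' := (1 + r) / 2).
  assert (Hrp : 0 < r' < 1) by (unfold r'; lra).
  destruct (Ha r' Hrp) as [M HM].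
  assert (Hq : 0 <= r / r' < 1).
  { split. apply Rdiv_le_0_compat; lra.
    apply Rmult_lt_reg_r with r'. lra. unfold Rdiv; rewrite Rmult_assoc, Rinv_l; unfold r'; lra. }
  exists (M * / (1 - r / r')). intros n.
  rewrite Cmod_mult, Cmod_R, Rabs_pos_eq by apply pos_INR.
  replace (r ^ n) with (r' ^ n * (r / r') ^ n).
  2:{ rewrite <- Rpow_mult_distr. f_equal. field. lra. }
  replace (INR n * Cmod (a n) * (r' ^ n * (r / r') ^ n)) with
    ((Cmod (a n) * r' ^ n) * (INR n * (r / r') ^ n)) by ring.
  apply Rmult_le_compat; auto using n_pow_le.
  apply Rmult_le_pos; [apply Cmod_ge_0|apply pow_le; lra].
  apply Rmult_le_pos; [apply pos_INR|apply pow_le; lra].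
Qed.

Lemma disk_coeffs_shift a : disk_coeffs a -> disk_coeffs (fun n => a (S n)).
Proof.
  intros Ha r Hr. destruct (Ha r Hr) as [M HM]. exists (M / r). intros n.
  specialize (HM (S n)). simpl in HM.
  apply Rmult_le_reg_r with r. lra. unfold Rdiv. rewrite (Rmult_assoc M), Rinv_l by lra. lra.
Qed.

(** The value is arbitrary where the series diverges. *)
Definition Psum (a : nat -> C) (z : C) : C :=
  epsilon (inhabits (RtoC 0)) (pser a z).

Lemma Psum_pser a z : disk_coeffs a -> Cmod z < 1 -> pser a z (Psum a z).
Proof. intros Ha Hz. exact (epsilon_spec _ _ (disk_coeffs_ex a z Ha Hz)). Qed.

Lemma Psum_unique a z l : pser a z l -> Psum a z = l.
Proof.
  intros H. apply (Cser_unique (fun n => (a n * z ^ n)%C)); [|exact H].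
  apply (epsilon_spec (inhabits (RtoC 0)) (pser a z)). exists l; exact H.
Qed.

Lemma disk_coeffs_of_pser_disk a f :
  (forall z, Cmod z < 1 -> pser a z (f z)) ->
  disk_coeffs a /\ forall z, Cmod z < 1 -> f z = Psum a z.
Proof.
  intros H. split.
  - apply disk_coeffs_of_pser. intros r Hr. eexists; apply H. rewrite Cmod_R, Rabs_pos_eq; lra.
  - intros z Hz. symmetry. apply Psum_unique, H, Hz.
Qed.

Definition dcoef (a : nat -> C) (n : nat) : C := (RtoC (INR (S n)) * a (S n))%C.

Lemma disk_coeffs_dcoef a : disk_coeffs a -> disk_coeffs (dcoef a).
Proof. intros H. apply (disk_coeffs_shift (fun n => (RtoC (INR n) * a n)%C)), disk_coeffs_mul_n, H. Qed.

(** By induction on [n]: the remainder [D n = x^n - y^n - n y^(n-1) (x - y)] satisfies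
    [D (n+1) = x D n + n y^(n-1) (x - y)^2]. *)
Lemma pow_taylor (x y : C) (rho : R) (n : nat) :
  0 < rho -> Cmod x <= rho -> Cmod y <= rho ->
  rho ^ 2 * Cmod (x ^ n - y ^ n - RtoC (INR n) * y ^ (pred n) * (x - y)) <=
  INR n ^ 2 * rho ^ n * Cmod (x - y) ^ 2.
Proof.
  intros Hr Hx Hy.
  assert (Hxy := Cmod_ge_0 (x - y)).
  assert (S2 : 0 <= Cmod (x - y) ^ 2) by apply pow2_ge_0.
  induction n as [|n IH].
  - simpl. replace (1 - 1 - 0 * 1 * (x - y))%C with (RtoC 0) by ring. rewrite Cmod_0. lra.
  - destruct n as [|n].
    { simpl pred. simpl Cpow. simpl INR.
      replace (x * 1 - y * 1 - 1 * 1 * (x - y))%C with (RtoC 0) by ring. rewrite Cmod_0.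
      rewrite Rmult_0_r. apply Rmult_le_pos; auto. rewrite pow1, pow_1. lra. }
    replace (x ^ S (S n) - y ^ S (S n) - RtoC (INR (S (S n))) * y ^ pred (S (S n)) * (x - y))%C
     with (x * (x ^ S n - y ^ S n - RtoC (INR (S n)) * y ^ pred (S n) * (x - y))
          + RtoC (INR (S n)) * y ^ n * ((x - y) * (x - y)))%C.
    2:{ rewrite (S_INR (S n)), RtoC_plus. simpl pred. rewrite !Cpow_S. ring. }
    set (D := (x ^ S n - y ^ S n - RtoC (INR (S n)) * y ^ pred (S n) * (x - y))%C) in *.
    eapply Rle_trans.
    { apply Rmult_le_compat_l. apply pow2_ge_0. apply Cmod_triangle. }
    rewrite !Cmod_mult, Cmod_R, Cmod_pow, (Rabs_pos_eq (INR (S n))) by apply pos_INR.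
    assert (HyN : Cmod y ^ n <= rho ^ n) by (apply pow_incr; split; [apply Cmod_ge_0|auto]).
    assert (H1 : rho ^ 2 * (Cmod x * Cmod D) <= rho * (INR (S n) ^ 2 * rho ^ S n * Cmod (x - y) ^ 2)).
    { replace (rho ^ 2 * (Cmod x * Cmod D)) with (Cmod x * (rho ^ 2 * Cmod D)) by ring.
      apply Rmult_le_compat; auto using Cmod_ge_0.
      apply Rmult_le_pos; [apply pow2_ge_0|apply Cmod_ge_0]. }
    assert (Hn := pos_INR (S n)).
    assert (H2 : rho ^ 2 * (INR (S n) * Cmod y ^ n * (Cmod (x - y) * Cmod (x - y)))
             <= rho ^ 2 * (INR (S n) * rho ^ n * (Cmod (x - y) * Cmod (x - y)))).
    { apply Rmult_le_compat_l. apply pow2_ge_0. apply Rmult_le_compat_r. nra.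
      apply Rmult_le_compat_l; auto. }
    rewrite (S_INR (S n)).
    assert (0 <= rho ^ n) by (apply pow_le; lra).
    assert (0 <= rho ^ S (S n) * Cmod (x-y)^2) by (apply Rmult_le_pos; auto; apply pow_le; lra).
    rewrite Rmult_plus_distr_l.
    eapply Rle_trans; [apply Rplus_le_compat; [exact H1|exact H2]|].
    assert (0 <= (INR (S n) + 1) * (rho ^ S (S n) * Cmod (x - y) ^ 2)) by (apply Rmult_le_pos; lra).
    replace ((INR (S n) + 1) ^ 2 * rho ^ S (S n) * Cmod (x - y) ^ 2) with
      (rho * (INR (S n) ^ 2 * rho ^ S n * Cmod (x - y) ^ 2) +
       rho ^ 2 * (INR (S n) * rho ^ n * (Cmod (x - y) * Cmod (x - y))) +
       (INR (S n) + 1) * (rho ^ S (S n) * Cmod (x - y) ^ 2)).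
    2:{ rewrite <- !tech_pow_Rmult. set (N := INR (S n)). set (d := Cmod (x - y)). ring. }
    lra.
Qed.

(** The remainders of the monomials are summed against [Cmod (a n)]; their quadratic
    bounds grow like [n^2 rho^n], which [disk_coeffs_mul_n] controls. *)
Lemma Psum_taylor a rho : disk_coeffs a -> 0 < rho < 1 ->
  exists K, 0 <= K /\ forall x y, Cmod x <= rho -> Cmod y <= rho ->
    Cmod (Psum a x - Psum a y - Psum (dcoef a) y * (x - y)) <= K * Cmod (x - y) ^ 2.
Proof.
  intros Ha Hr.
  assert (Ha2 := disk_coeffs_mul_n _ (disk_coeffs_mul_n _ Ha)).
  destruct (disk_coeffs_abs _ rho Ha2) as [S HS]. lra.
  assert (S0 : 0 <= S).
  { apply (series_nonneg _ _ HS). intros n.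
    apply Rmult_le_pos; [apply Cmod_ge_0|apply pow_le; lra]. }
  exists (S / rho ^ 2). split.
  apply Rdiv_le_0_compat; auto. apply pow_lt; lra.
  intros x y Hx Hy.
  assert (Px := Psum_pser a x Ha ltac:(lra)).
  assert (Py := Psum_pser a y Ha ltac:(lra)).
  assert (Pd := Psum_pser _ y (disk_coeffs_dcoef a Ha) ltac:(lra)).
  assert (Pd' : Cser (fun n => ((x - y) * (RtoC (INR n) * a n * y ^ pred n)))%C ((x - y) * Psum (dcoef a) y)%C).
  { apply Cser_scal.
    replace (Psum (dcoef a) y) with (RtoC (INR 0) * a 0%nat * y ^ pred 0 + Psum (dcoef a) y)%C.
    apply (Cser_unshift (fun n => (RtoC (INR n) * a n * y ^ pred n)%C)). exact Pd. simpl; ring. }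
  assert (HT := Cser_minus _ _ _ _ (Cser_minus _ _ _ _ Px Py) Pd').
  replace (Psum a x - Psum a y - Psum (dcoef a) y * (x - y))%C with
    (Psum a x - Psum a y - (x - y) * Psum (dcoef a) y)%C by ring.
  apply (Cser_le _ (fun n => / rho ^ 2 * Cmod (x-y)^2 * (Cmod (RtoC (INR n) * (RtoC (INR n) * a n)) * rho ^ n)) _ _ HT).
  - replace (S / rho ^ 2 * Cmod (x - y) ^ 2) with (/ rho ^ 2 * Cmod (x - y) ^ 2 * S) by (unfold Rdiv; ring).
    apply (is_series_scal_l (/ rho ^ 2 * Cmod (x-y)^2) (fun n => (Cmod (RtoC (INR n) * (RtoC (INR n) * a n)) * rho ^ n)) S). exact HS.
  - intros n.
    replace (a n * x ^ n - a n * y ^ n - (x - y) * (RtoC (INR n) * a n * y ^ pred n))%C with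
     (a n * (x ^ n - y ^ n - RtoC (INR n) * y ^ (pred n) * (x - y)))%C by ring.
    rewrite !Cmod_mult, Cmod_R, (Rabs_pos_eq (INR n)) by apply pos_INR.
    assert (H := pow_taylor x y rho n (proj1 Hr) Hx Hy).
    assert (0 < rho ^ 2) by (apply pow_lt; lra).
    apply Rmult_le_reg_l with (rho ^ 2); auto.
    replace (rho ^ 2 * (/ rho ^ 2 * Cmod (x - y) ^ 2 * (INR n * (INR n * Cmod (a n)) * rho ^ n)))
      with (Cmod (a n) * (INR n ^ 2 * rho ^ n * Cmod (x - y) ^ 2)) by (field; lra).
    replace (rho ^ 2 * (Cmod (a n) * Cmod (x ^ n - y ^ n - RtoC (INR n) * y ^ pred n * (x - y))))
     with (Cmod (a n) * (rho ^ 2 * Cmod (x ^ n - y ^ n - RtoC (INR n) * y ^ pred n * (x - y)))) by ring.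
    apply Rmult_le_compat_l; auto. apply Cmod_ge_0.
Qed.

(** * Quantitative differentiability *)

(** Differentiability with a quadratic error bound. Power series and the exponential
    satisfy it, it passes to sums, products, composites and inverses, and all the
    estimates below can then be done with explicit constants. *)
Definition qdiff (h : C -> C) (z d : C) : Prop :=
  exists K delta, 0 <= K /\ 0 < delta /\
    forall w, Cmod (w - z) < delta ->
      Cmod (h w - h z - d * (w - z)) <= K * Cmod (w - z) ^ 2.

Lemma qdiff_lipschitz h z d : qdiff h z d ->
  exists L delta, 0 <= L /\ 0 < delta /\
    forall w, Cmod (w - z) < delta -> Cmod (h w - h z) <= L * Cmod (w - z).
Proof.
  intros (K & del & HK & Hd & H).
  exists (K + Cmod d), (Rmin del 1). assert (Hdp := Cmod_ge_0 d).
  split; [lra|]. split. apply Rmin_pos; lra.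
  intros w Hw.
  assert (W1 : Cmod (w - z) < del) by (eapply Rlt_le_trans; [exact Hw|apply Rmin_l]).
  assert (W2 : Cmod (w - z) < 1) by (eapply Rlt_le_trans; [exact Hw|apply Rmin_r]).
  specialize (H w W1).
  replace (h w - h z)%C with ((h w - h z - d * (w - z)) + d * (w - z))%C by ring.
  eapply Rle_trans; [apply Cmod_triangle|]. rewrite Cmod_mult.
  assert (Hw0 := Cmod_ge_0 (w - z)).
  assert (K * Cmod (w - z) ^ 2 <= K * Cmod (w - z)) by (apply Rmult_le_compat_l; nra).
  lra.
Qed.

Lemma qdiff_ext_loc h1 h2 z d :
  (exists delta, 0 < delta /\ forall w, Cmod (w - z) < delta -> h1 w = h2 w) ->
  qdiff h1 z d -> qdiff h2 z d.
Proof.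
  intros (e & He & E) (K & del & HK & Hd & H).
  exists K, (Rmin e del). split; auto. split. apply Rmin_pos; auto.
  assert (Ez : h1 z = h2 z).
  { apply E. replace (z - z)%C with (RtoC 0) by ring. rewrite Cmod_0; auto. }
  intros w Hw. rewrite <- Ez, <- E.
  apply H. eapply Rlt_le_trans; [exact Hw|apply Rmin_r].
  eapply Rlt_le_trans; [exact Hw|apply Rmin_l].
Qed.

Lemma qdiff_const c z : qdiff (fun _ => c) z 0.
Proof.
  exists 0, 1. split; [lra|]. split; [lra|]. intros w _.
  replace (c - c - 0 * (w - z))%C with (RtoC 0) by ring. rewrite Cmod_0; lra.
Qed.

Lemma qdiff_id z : qdiff (fun w => w) z 1.
Proof.
  exists 0, 1. split; [lra|]. split; [lra|]. intros w _.
  replace (w - z - 1 * (w - z))%C with (RtoC 0) by ring. rewrite Cmod_0; lra.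
Qed.

Lemma qdiff_plus h1 h2 z d1 d2 : qdiff h1 z d1 -> qdiff h2 z d2 ->
  qdiff (fun w => h1 w + h2 w)%C z (d1 + d2).
Proof.
  intros (K1 & e1 & HK1 & He1 & H1) (K2 & e2 & HK2 & He2 & H2).
  exists (K1 + K2), (Rmin e1 e2). split; [lra|]. split. apply Rmin_pos; auto.
  intros w Hw.
  assert (W1 : Cmod (w - z) < e1) by (eapply Rlt_le_trans; [exact Hw|apply Rmin_l]).
  assert (W2 : Cmod (w - z) < e2) by (eapply Rlt_le_trans; [exact Hw|apply Rmin_r]).
  specialize (H1 w W1). specialize (H2 w W2).
  replace (h1 w + h2 w - (h1 z + h2 z) - (d1 + d2) * (w - z))%C with
    ((h1 w - h1 z - d1 * (w - z)) + (h2 w - h2 z - d2 * (w - z)))%C by ring.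
  eapply Rle_trans; [apply Cmod_triangle|]. lra.
Qed.

Lemma qdiff_mult h1 h2 z d1 d2 : qdiff h1 z d1 -> qdiff h2 z d2 ->
  qdiff (fun w => h1 w * h2 w)%C z (d1 * h2 z + h1 z * d2).
Proof.
  intros Q1 Q2.
  destruct (qdiff_lipschitz _ _ _ Q1) as (L1 & f1 & HL1 & Hf1 & G1).
  destruct (qdiff_lipschitz _ _ _ Q2) as (L2 & f2 & HL2 & Hf2 & G2).
  destruct Q1 as (K1 & e1 & HK1 & He1 & H1). destruct Q2 as (K2 & e2 & HK2 & He2 & H2).
  exists (K1 * Cmod (h2 z) + Cmod (h1 z) * K2 + L1 * L2), (Rmin (Rmin e1 e2) (Rmin f1 f2)).
  assert (P1 := Cmod_ge_0 (h1 z)). assert (P2 := Cmod_ge_0 (h2 z)).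
  split. assert (0 <= K1 * Cmod (h2 z)) by (apply Rmult_le_pos; auto).
  assert (0 <= Cmod (h1 z) * K2) by (apply Rmult_le_pos; auto).
  assert (0 <= L1 * L2) by (apply Rmult_le_pos; auto). lra.
  split. repeat apply Rmin_pos; auto.
  intros w Hw.
  assert (W : Cmod (w - z) < e1 /\ Cmod (w - z) < e2 /\ Cmod (w - z) < f1 /\ Cmod (w - z) < f2).
  { generalize (Rmin_l (Rmin e1 e2) (Rmin f1 f2)) (Rmin_r (Rmin e1 e2) (Rmin f1 f2))
     (Rmin_l e1 e2) (Rmin_r e1 e2) (Rmin_l f1 f2) (Rmin_r f1 f2). lra. }
  destruct W as (W1 & W2 & W3 & W4).
  specialize (H1 w W1). specialize (H2 w W2). specialize (G1 w W3). specialize (G2 w W4).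
  replace (h1 w * h2 w - h1 z * h2 z - (d1 * h2 z + h1 z * d2) * (w - z))%C with
    ((h1 w - h1 z - d1 * (w - z)) * h2 z + h1 z * (h2 w - h2 z - d2 * (w - z))
     + (h1 w - h1 z) * (h2 w - h2 z))%C by ring.
  eapply Rle_trans; [apply Cmod_triangle|].
  eapply Rle_trans; [apply Rplus_le_compat_r, Cmod_triangle|].
  rewrite !Cmod_mult.
  assert (A1 : Cmod (h1 w - h1 z - d1 * (w - z)) * Cmod (h2 z) <= K1 * Cmod (w - z) ^ 2 * Cmod (h2 z))
    by (apply Rmult_le_compat_r; auto).
  assert (A2 : Cmod (h1 z) * Cmod (h2 w - h2 z - d2 * (w - z)) <= Cmod (h1 z) * (K2 * Cmod (w - z) ^ 2))
    by (apply Rmult_le_compat_l; auto).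
  assert (A3 : Cmod (h1 w - h1 z) * Cmod (h2 w - h2 z) <= (L1 * Cmod (w - z)) * (L2 * Cmod (w - z)))
    by (apply Rmult_le_compat; auto using Cmod_ge_0).
  eapply Rle_trans. apply Rplus_le_compat; [apply Rplus_le_compat; eassumption|eassumption].
  right; ring.
Qed.

Lemma qdiff_comp h g z d e : qdiff g z e -> qdiff h (g z) d ->
  qdiff (fun w => h (g w)) z (d * e).
Proof.
  intros Q1 Q2.
  destruct (qdiff_lipschitz _ _ _ Q1) as (L1 & f1 & HL1 & Hf1 & G1).
  destruct Q1 as (K1 & e1 & HK1 & He1 & H1). destruct Q2 as (K2 & e2 & HK2 & He2 & H2).
  exists (K2 * L1 ^ 2 + Cmod d * K1), (Rmin (Rmin e1 f1) (e2 / (L1 + 1))).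
  assert (P1 := Cmod_ge_0 d).
  split. assert (0 <= K2 * L1 ^ 2) by (apply Rmult_le_pos; auto; apply pow2_ge_0).
  assert (0 <= Cmod d * K1) by (apply Rmult_le_pos; auto). lra.
  split. repeat apply Rmin_pos; auto. apply Rdiv_lt_0_compat; lra.
  intros w Hw.
  assert (W : Cmod (w - z) < e1 /\ Cmod (w - z) < f1 /\ Cmod (w - z) < e2 / (L1 + 1)).
  { generalize (Rmin_l (Rmin e1 f1) (e2 / (L1 + 1))) (Rmin_r (Rmin e1 f1) (e2 / (L1 + 1)))
     (Rmin_l e1 f1) (Rmin_r e1 f1). lra. }
  destruct W as (W1 & W2 & W3).
  specialize (H1 w W1). specialize (G1 w W2).
  assert (Hw0 := Cmod_ge_0 (w - z)).
  assert (Hg : Cmod (g w - g z) < e2).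
  { eapply Rle_lt_trans; [exact G1|].
    apply Rle_lt_trans with ((L1 + 1) * Cmod (w - z)). nra.
    apply Rlt_le_trans with ((L1 + 1) * (e2 / (L1 + 1))).
    apply Rmult_lt_compat_l; lra. right; field; lra. }
  specialize (H2 (g w) Hg).
  replace (h (g w) - h (g z) - d * e * (w - z))%C with
    ((h (g w) - h (g z) - d * (g w - g z)) + d * (g w - g z - e * (w - z)))%C by ring.
  eapply Rle_trans; [apply Cmod_triangle|]. rewrite Cmod_mult.
  assert (Hg0 := Cmod_ge_0 (g w - g z)).
  assert (A1 : K2 * Cmod (g w - g z) ^ 2 <= K2 * (L1 * Cmod (w - z)) ^ 2).
  { apply Rmult_le_compat_l; auto. apply pow_incr; auto. }
  assert (A2 : Cmod d * Cmod (g w - g z - e * (w - z)) <= Cmod d * (K1 * Cmod (w - z) ^ 2)).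
  { apply Rmult_le_compat_l; auto. }
  eapply Rle_trans; [apply Rplus_le_compat; [eapply Rle_trans; [exact H2|exact A1]|exact A2]|].
  right; ring.
Qed.

Lemma qdiff_inv (z : C) : z <> 0 -> qdiff (fun w => / w)%C z (- / (z * z)).
Proof.
  intros Hz. assert (Hp := proj1 (Cmod_gt_0 z) Hz).
  exists (2 / Cmod z ^ 3), (Cmod z / 2).
  split. apply Rdiv_le_0_compat. lra. apply pow_lt; lra.
  split. lra. intros w Hw.
  assert (Hwz : Cmod z / 2 < Cmod w).
  { generalize (Cmod_sub_ge z w). rewrite Cmod_minus_comm. lra. }
  assert (Hw0 : w <> 0). { intros E. rewrite E, Cmod_0 in Hwz. lra. }
  replace (/ w - / z - - / (z * z) * (w - z))%C with ((w - z) * (w - z) * / (w * z * z))%C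
    by (field; auto).
  assert (Hn : (w * z * z)%C <> 0) by (repeat apply Cmult_neq_0; auto).
  rewrite !Cmod_mult, Cmod_inv, !Cmod_mult by auto.
  replace (Cmod (w - z) * Cmod (w - z) * / (Cmod w * Cmod z * Cmod z)) with
    (/ (Cmod w * Cmod z * Cmod z) * Cmod (w - z) ^ 2) by ring.
  apply Rmult_le_compat_r. apply pow2_ge_0.
  replace (2 / Cmod z ^ 3) with (/ (Cmod z / 2 * Cmod z * Cmod z)) by (field; lra).
  apply Rinv_le_contravar.
  repeat apply Rmult_lt_0_compat; lra.
  apply Rmult_le_compat_r. lra. apply Rmult_le_compat_r; lra.
Qed.

Lemma qdiff_unique h z d d' : qdiff h z d -> qdiff h z d' -> d = d'.
Proof.
  intros (K1 & e1 & HK1 & He1 & H1) (K2 & e2 & HK2 & He2 & H2).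
  destruct (Ceq_dec d d') as [E|E]; auto. exfalso.
  assert (P : 0 < Cmod (d - d')).
  { apply Cmod_gt_0. intros X. apply E. apply Ceq_minus. exact X. }
  set (s := Rmin (Rmin e1 e2) (Cmod (d - d') / (K1 + K2 + 1)) / 2).
  assert (Hs : 0 < s /\ s < e1 /\ s < e2 /\ s < Cmod (d - d') / (K1 + K2 + 1)).
  { assert (0 < Cmod (d - d') / (K1 + K2 + 1)) by (apply Rdiv_lt_0_compat; lra).
    assert (0 < Rmin (Rmin e1 e2) (Cmod (d - d') / (K1 + K2 + 1))) by (repeat apply Rmin_pos; auto).
    generalize (Rmin_l (Rmin e1 e2) (Cmod (d - d') / (K1 + K2 + 1)))
     (Rmin_r (Rmin e1 e2) (Cmod (d - d') / (K1 + K2 + 1))) (Rmin_l e1 e2) (Rmin_r e1 e2).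
    unfold s. lra. }
  destruct Hs as (S0 & S1 & S2 & S3).
  assert (Es : Cmod (z + s - z) = s).
  { replace (z + s - z)%C with (RtoC s) by ring. rewrite Cmod_R, Rabs_pos_eq; lra. }
  specialize (H1 (z + s)%C). specialize (H2 (z + s)%C). rewrite Es in H1, H2.
  specialize (H1 S1). specialize (H2 S2).
  assert (HH : Cmod (d - d') * s <= (K1 + K2) * s ^ 2).
  { rewrite <- Es at 1. rewrite <- Cmod_mult.
    replace ((d - d') * (z + s - z))%C with
     ((h (z + s) - h z - d' * (z + s - z)) - (h (z + s) - h z - d * (z + s - z)))%C by ring.
    eapply Rle_trans; [apply Cmod_sub_le|]. lra. }
  assert (s * (K1 + K2 + 1) < Cmod (d - d')).
  { apply Rmult_lt_compat_r with (r := K1 + K2 + 1) in S3; [|lra].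
    unfold Rdiv in S3. rewrite Rmult_assoc, Rinv_l in S3; lra. }
  nra.
Qed.

Lemma qdiff_Psum a z : disk_coeffs a -> Cmod z < 1 -> qdiff (Psum a) z (Psum (dcoef a) z).
Proof.
  intros Ha Hz. assert (H0 := Cmod_ge_0 z).
  destruct (Psum_taylor a ((1 + Cmod z) / 2) Ha) as (K & HK & H). lra.
  exists K, ((1 - Cmod z) / 2). split; auto. split. lra.
  intros w Hw. apply H; [|lra].
  generalize (Cmod_sub_ge w z). lra.
Qed.

(** * Solving equations by Newton iteration *)

Lemma Cser_eps u l : Cser u l <->
  forall eps, 0 < eps -> exists N, forall n, (N <= n)%nat -> Cmod (csum u n - l) < eps.
Proof.
  split.
  - intros H eps He.
    destruct (proj1 (filterlim_locally_ball_norm (sum_n u) (l : C_NormedModule)) H (mkposreal eps He))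
      as [N HN].
    exists N. intros n Hn. exact (HN n Hn).
  - intros H. apply (proj2 (filterlim_locally_ball_norm (sum_n u) (l : C_NormedModule))).
    intros eps. destruct (H eps (cond_pos eps)) as [N HN]. exists N. exact HN.
Qed.

Lemma csum_S u n : csum u (S n) = (csum u n + u (S n))%C.
Proof. unfold csum. rewrite sum_Sn. reflexivity. Qed.

Lemma csum_0 u : csum u 0 = u 0%nat.
Proof. apply sum_O. Qed.

Lemma Cmod_eq_of_small (x : C) : (forall eps, 0 < eps -> Cmod x <= eps) -> x = 0.
Proof.
  intros H. apply Cmod_eq_0. apply Rle_antisym; [|apply Cmod_ge_0].
  apply le_epsilon. intros e He. rewrite Rplus_0_l. auto.
Qed.

Lemma contraction_fixpoint (T : C -> C) (x0 : C) (rho : R) :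
  0 < rho ->
  (forall x y, Cmod (x - x0) <= rho -> Cmod (y - x0) <= rho ->
     Cmod (T x - T y) <= / 2 * Cmod (x - y)) ->
  Cmod (T x0 - x0) <= rho / 2 ->
  exists x, Cmod (x - x0) <= rho /\ T x = x.
Proof.
  intros Hr HT H0.
  set (X := fix X n := match n with O => x0 | S k => T (X k) end).
  assert (HX : forall n, Cmod (X n - x0) <= rho * (1 - (/2) ^ n) /\
                 Cmod (X (S n) - X n) <= rho / 2 * (/ 2) ^ n).
  { induction n as [|n [I1 I2]].
    - simpl. replace (x0 - x0)%C with (RtoC 0) by ring. rewrite Cmod_0. split; lra.
    - assert (J : Cmod (X (S n) - x0) <= rho * (1 - (/ 2) ^ S n)).
      { replace (X (S n) - x0)%C with ((X (S n) - X n) + (X n - x0))%C by ring.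
        eapply Rle_trans; [apply Cmod_triangle|]. simpl pow. lra. }
      split. exact J.
      assert (Q : forall k, 0 < (/2) ^ k) by (intros; apply pow_lt; lra).
      eapply Rle_trans. apply (HT (X (S n)) (X n)).
      assert (0 < rho * (/2) ^ (S n)) by (apply Rmult_lt_0_compat; auto). lra.
      assert (0 < rho * (/2) ^ n) by (apply Rmult_lt_0_compat; auto). lra.
      simpl pow. lra. }
  assert (HB : forall n, Cmod (X n - x0) <= rho).
  { intros n. destruct (HX n) as [I _]. assert (0 < rho * (/2) ^ n) by (apply Rmult_lt_0_compat; auto; apply pow_lt; lra). lra. }
  destruct (Cser_ex_le (fun n => X (S n) - X n)%C (fun n => rho / 2 * (/ 2) ^ n)) as [l Hl].
  { intros n. apply HX. }
  { apply (ex_series_scal_l (rho / 2) (fun n => (/2) ^ n)). apply ex_series_geom.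
    rewrite Rabs_pos_eq; lra. }
  assert (Hs : forall n, csum (fun n => X (S n) - X n)%C n = (X (S n) - x0)%C).
  { induction n as [|n IH]. rewrite csum_0. simpl. ring.
    rewrite csum_S, IH. ring. }
  assert (Hc : forall eps, 0 < eps -> exists N, forall n, (N <= n)%nat -> Cmod (X (S n) - (x0 + l)) < eps).
  { intros eps He. destruct (proj1 (Cser_eps _ _) Hl eps He) as [N HN]. exists N. intros n Hn.
    specialize (HN n Hn). rewrite Hs in HN.
    replace (X (S n) - (x0 + l))%C with (X (S n) - x0 - l)%C by ring. exact HN. }
  assert (Hx : Cmod (x0 + l - x0) <= rho).
  { apply le_epsilon. intros e He. destruct (Hc e He) as [N HN]. specialize (HN N (le_n N)).
    rewrite Cmod_minus_comm in HN.
    replace (x0 + l - x0)%C with ((x0 + l - X (S N)) + (X (S N) - x0))%C by ring.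
    eapply Rle_trans; [apply Cmod_triangle|]. generalize (HB (S N)). lra. }
  exists (x0 + l)%C. split. exact Hx.
  apply Ceq_minus. apply Cmod_eq_of_small. intros e He.
  destruct (Hc (e / 2)) as [N HN]. lra.
  assert (A1 := HN N (le_n N)). assert (A2 := HN (S N) ltac:(lia)).
  replace (T (x0 + l) - (x0 + l))%C with
    ((T (x0 + l) - T (X (S N))) + (X (S (S N)) - (x0 + l)))%C by (simpl; ring).
  eapply Rle_trans; [apply Cmod_triangle|].
  assert (A3 := HT (x0 + l)%C (X (S N)) Hx (HB (S N))).
  rewrite (Cmod_minus_comm (x0 + l) (X (S N))) in A3. lra.
Qed.

(** The map [x - (G x - v) / a] contracts by the factor 1/2. *)
Lemma newton_solve (G : C -> C) (x0 a v : C) (rho : R) :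
  0 < rho -> a <> 0 ->
  (forall x y, Cmod (x - x0) <= rho -> Cmod (y - x0) <= rho ->
     Cmod (G x - G y - a * (x - y)) <= Cmod a / 2 * Cmod (x - y)) ->
  Cmod (G x0 - v) <= Cmod a * rho / 2 ->
  exists x, Cmod (x - x0) <= rho /\ G x = v.
Proof.
  intros Hr Ha HG H0. assert (Hp := proj1 (Cmod_gt_0 a) Ha).
  destruct (contraction_fixpoint (fun x => x - (G x - v) / a)%C x0 rho Hr) as [x [Hx E]].
  - intros x y Hx Hy.
    replace (x - (G x - v) / a - (y - (G y - v) / a))%C with
      (- ((G x - G y - a * (x - y)) / a))%C by (field; auto).
    rewrite Cmod_opp, Cmod_div by auto.
    apply Rmult_le_reg_r with (Cmod a); auto.
    unfold Rdiv. rewrite Rmult_assoc, Rinv_l by lra.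
    generalize (HG x y Hx Hy). lra.
  - replace (x0 - (G x0 - v) / a - x0)%C with (- ((G x0 - v) / a))%C by (field; auto).
    rewrite Cmod_opp, Cmod_div by auto.
    apply Rmult_le_reg_r with (Cmod a); auto.
    unfold Rdiv. rewrite Rmult_assoc, Rinv_l by lra. lra.
  - exists x. split; auto.
    apply Ceq_minus. apply Ceq_minus in E.
    replace (G x - v)%C with (- a * (x - (G x - v) / a - x))%C by (field; auto).
    rewrite E. ring.
Qed.

(** * The derivative of an injective power series has no zero *)

Definition cis (t : R) : C := (cos t, sin t).

Lemma cis_plus s t : cis (s + t) = (cis s * cis t)%C.
Proof.
  unfold cis, Cmult; simpl. rewrite cos_plus, sin_plus. f_equal; ring.
Qed.

Lemma cis_pow t n : (cis t ^ n)%C = cis (INR n * t).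
Proof.
  induction n as [|n IH].
  - simpl. rewrite Rmult_0_l. unfold cis. rewrite cos_0, sin_0. reflexivity.
  - rewrite Cpow_S, IH, <- cis_plus. f_equal. rewrite S_INR. ring.
Qed.

Lemma Cmod_cis t : Cmod (cis t) = 1.
Proof.
  unfold Cmod, cis; simpl. generalize (sin2_cos2 t). unfold Rsqr. intros H.
  transitivity (sqrt 1); [apply f_equal; lra|apply sqrt_1].
Qed.

Lemma nontrivial_root_of_unity m : (2 <= m)%nat ->
  exists zeta, (zeta ^ m)%C = 1 /\ zeta <> 1 /\ Cmod zeta = 1.
Proof.
  intros Hm. assert (Hm2 : 2 <= INR m) by (apply (le_INR 2); auto).
  exists (cis (2 * PI / INR m)). split; [|split].
  - rewrite cis_pow. replace (INR m * (2 * PI / INR m)) with (2 * PI) by (field; lra).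
    unfold cis. rewrite cos_2PI, sin_2PI. reflexivity.
  - intros E. apply (f_equal Re) in E. unfold cis in E. simpl in E.
    assert (HPI := PI_RGT_0).
    assert (cos (2 * PI / INR m) < cos 0).
    { assert (0 < 2 * PI / INR m) by (apply Rdiv_lt_0_compat; lra).
      assert (2 * PI / INR m <= PI).
      { apply Rmult_le_reg_r with (INR m). lra. unfold Rdiv. rewrite Rmult_assoc, Rinv_l by lra. nra. }
      apply cos_decreasing_1; lra. }
    rewrite cos_0 in H. lra.
  - apply Cmod_cis.
Qed.

Lemma small3 a b c : 0 < a -> 0 < b -> 0 < c ->
  exists r, 0 < r /\ r <= a /\ r <= b /\ r <= c.
Proof.
  intros. exists (Rmin a (Rmin b c)). repeat split.
  repeat apply Rmin_pos; auto.
  apply Rmin_l.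
  eapply Rle_trans; [apply Rmin_r|apply Rmin_l].
  eapply Rle_trans; [apply Rmin_r|apply Rmin_r].
Qed.

Lemma small_factor a b : 0 < a -> 0 <= b -> exists r, 0 < r /\ b * r <= a.
Proof.
  intros Ha Hb. exists (a / (b + 1)). split. apply Rdiv_lt_0_compat; lra.
  apply Rle_trans with ((b + 1) * (a / (b + 1))).
  apply Rmult_le_compat_r. left; apply Rdiv_lt_0_compat; lra. lra.
  right; field; lra.
Qed.

Lemma pow_lipschitz (x y : C) (r : R) n : 1 <= r -> Cmod x <= r -> Cmod y <= r ->
  Cmod (x ^ n - y ^ n) <= INR n * r ^ n * Cmod (x - y).
Proof.
  intros Hr Hx Hy. induction n as [|n IH].
  - simpl. replace (1 - 1)%C with (RtoC 0) by ring. rewrite Cmod_0. lra.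
  - replace (x ^ S n - y ^ S n)%C with (x * (x ^ n - y ^ n) + (x - y) * y ^ n)%C
      by (rewrite !Cpow_S; ring).
    eapply Rle_trans; [apply Cmod_triangle|]. rewrite !Cmod_mult, Cmod_pow.
    assert (Hp : Cmod y ^ n <= r ^ n) by (apply pow_incr; split; [apply Cmod_ge_0|auto]).
    assert (Hn : 0 <= r ^ n) by (apply pow_le; lra).
    assert (Hd := Cmod_ge_0 (x - y)).
    assert (A1 : Cmod x * Cmod (x ^ n - y ^ n) <= r * (INR n * r ^ n * Cmod (x - y)))
      by (apply Rmult_le_compat; auto using Cmod_ge_0).
    assert (A2 : Cmod (x - y) * Cmod y ^ n <= Cmod (x - y) * (r * r ^ n)).
    { apply Rmult_le_compat_l; auto. apply Rle_trans with (1 := Hp). nra. }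
    rewrite S_INR. simpl pow. lra.
Qed.

(** [(1 + x)^m] is close to the linear map of slope [m], uniformly on small disks. *)
Lemma power_near_one m : exists A, 0 <= A /\ forall rho x y, rho <= 1 ->
  Cmod x <= rho -> Cmod y <= rho ->
  Cmod ((1 + x) ^ m - (1 + y) ^ m - RtoC (INR m) * (x - y)) <= A * rho * Cmod (x - y).
Proof.
  set (A0 := INR m ^ 2 * 2 ^ m).
  assert (HA0 : 0 <= A0) by (apply Rmult_le_pos; [apply pow2_ge_0|apply pow_le; lra]).
  exists (2 * A0). split. lra. intros rho x y Hr Hx Hy.
  assert (Hm := pos_INR m).
  assert (Bd : forall w, Cmod w <= rho -> Cmod (1 + w) <= 2).
  { intros w Hw. eapply Rle_trans; [apply Cmod_triangle|]. rewrite Cmod_1; lra. }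
  assert (T := pow_taylor (1 + x)%C (1 + y)%C 2 m ltac:(lra) (Bd x Hx) (Bd y Hy)).
  replace (1 + x - (1 + y))%C with (x - y)%C in T by ring.
  assert (Lp := pow_lipschitz (1 + y)%C 1 2 (pred m) ltac:(lra) (Bd y Hy) ltac:(rewrite Cmod_1; lra)).
  rewrite Cpow_1_l in Lp. replace (1 + y - 1)%C with y in Lp by ring.
  assert (Hd := Cmod_ge_0 (x - y)). assert (Hy0 := Cmod_ge_0 y).
  assert (Hxy : Cmod (x - y) <= 2 * rho) by (eapply Rle_trans; [apply Cmod_sub_le|lra]).
  replace ((1 + x) ^ m - (1 + y) ^ m - RtoC (INR m) * (x - y))%C with
   (((1 + x) ^ m - (1 + y) ^ m - RtoC (INR m) * (1 + y) ^ pred m * (x - y))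
     + RtoC (INR m) * ((1 + y) ^ pred m - 1) * (x - y))%C by ring.
  eapply Rle_trans; [apply Cmod_triangle|]. rewrite !Cmod_mult, Cmod_R, Rabs_pos_eq by auto.
  assert (Hpm : INR (pred m) * 2 ^ pred m <= INR m * 2 ^ m).
  { apply Rmult_le_compat. apply pos_INR. apply pow_le; lra. apply le_INR; lia.
    apply Rle_pow. lra. lia. }
  assert (S1 : Cmod ((1 + y) ^ pred m - 1) <= INR m * 2 ^ m * rho).
  { eapply Rle_trans; [exact Lp|]. apply Rmult_le_compat; auto.
    apply Rmult_le_pos; [apply pos_INR|apply pow_le; lra]. }
  assert (S2 : INR m * Cmod ((1 + y) ^ pred m - 1) * Cmod (x - y) <= A0 * rho * Cmod (x - y)).
  { apply Rmult_le_compat_r; auto.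
    replace (A0 * rho) with (INR m * (INR m * 2 ^ m * rho)) by (unfold A0; ring).
    apply Rmult_le_compat_l; auto. }
  assert (S3 : A0 * Cmod (x - y) ^ 2 <= A0 * (2 * rho * Cmod (x - y))).
  { apply Rmult_le_compat_l; auto. simpl. rewrite Rmult_1_r. apply Rmult_le_compat_r; auto. }
  fold A0 in T.
  assert (0 <= A0 * (rho * Cmod (x - y))).
  { apply Rmult_le_pos; auto. apply Rmult_le_pos; auto. lra. }
  lra.
Qed.

(** Near a zero of order at least two a function takes nonzero values twice: with
    [zeta] a root of unity, a solution [k] of the equation is sought near [zeta * h],
    in the form [k = zeta * h * (1 + x)]; after division by [h ^ m] the equation for
    [x] is a small perturbation of [(1 + x) ^ m = 1]. *)
Lemma multiple_zero_not_injective m (g : C -> C) (z0 : C) (L delta : R) :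
  (2 <= m)%nat -> g z0 <> 0 -> 0 < delta -> 0 <= L ->
  (forall x y, Cmod (x - z0) < delta -> Cmod (y - z0) < delta ->
     Cmod (g x - g y) <= L * Cmod (x - y)) ->
  exists h k : C, Cmod h < delta /\ Cmod k < delta /\ h <> k /\
    (h ^ m * g (z0 + h) = k ^ m * g (z0 + k))%C.
Proof.
  intros Hm Hg Hdel HL Lip.
  destruct (nontrivial_root_of_unity m Hm) as (zeta & Z1 & Z2 & Z3).
  destruct (power_near_one m) as (A & HA & HP).
  set (M := INR m). assert (HM : 2 <= M) by (apply (le_INR 2); auto).
  assert (Hgp := proj1 (Cmod_gt_0 _) Hg). set (c := Cmod (g z0)) in *.
  assert (Hz : 0 < Cmod (zeta - 1)).
  { apply Cmod_gt_0. intros E. apply Z2. apply Ceq_minus; exact E. }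
  (* rho bounds the correction x, eta bounds the relative variation of g *)
  destruct (small_factor (/ 8) A ltac:(lra) HA) as (r1 & R1 & R1').
  destruct (small3 r1 1 (Cmod (zeta - 1) / 2)) as (rho & Rp & Ra & Rb & Rc); try lra.
  assert (H2m : 0 < 2 ^ m) by (apply pow_lt; lra).
  destruct (small_factor (/ 4) (2 * M + 2 ^ m)) as (e1 & E1 & E1'); try lra.
  destruct (small3 e1 (/ 2) (rho / 2)) as (eta & Ep & Ea & Eb & Ec); try lra.
  destruct (small_factor (c * eta) L) as (s1 & S1 & S1'); auto.
  apply Rmult_lt_0_compat; auto.
  destruct (small3 s1 (delta / 4) 1) as (s & Sp & Sa & Sb & _); try lra.
  assert (HLs : L * s <= c * eta) by (apply Rle_trans with (2 := S1'); apply Rmult_le_compat_l; auto).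
  assert (HAr : A * rho <= / 8) by (apply Rle_trans with (2 := R1'); apply Rmult_le_compat_l; auto).
  assert (HEt : (2 * M + 2 ^ m) * eta <= / 4)
    by (apply Rle_trans with (2 := E1'); apply Rmult_le_compat_l; lra).
  set (h := RtoC s). assert (Hh : Cmod h = s) by (unfold h; rewrite Cmod_R, Rabs_pos_eq; lra).
  assert (Bd : forall w, Cmod w <= rho -> Cmod (1 + w) <= 2).
  { intros w Hw. eapply Rle_trans; [apply Cmod_triangle|]. rewrite Cmod_1; lra. }
  assert (Bk : forall w, Cmod w <= rho -> Cmod (zeta * h * (1 + w)) <= 2 * s).
  { intros w Hw. rewrite !Cmod_mult, Z3, Hh. generalize (Bd w Hw). nra. }
  set (G := fun x => g (z0 + zeta * h * (1 + x))%C).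
  assert (InD : forall w, Cmod w <= rho -> Cmod (z0 + zeta * h * (1 + w) - z0) < delta).
  { intros w Hw. replace (z0 + zeta * h * (1 + w) - z0)%C with (zeta * h * (1 + w))%C by ring.
    generalize (Bk w Hw). lra. }
  assert (In0 : Cmod (z0 - z0) < delta).
  { replace (z0 - z0)%C with (RtoC 0) by ring. rewrite Cmod_0; auto. }
  assert (Inh : Cmod (z0 + h - z0) < delta).
  { replace (z0 + h - z0)%C with h by ring. rewrite Hh. lra. }
  assert (GL : forall x y, Cmod x <= rho -> Cmod y <= rho -> Cmod (G x - G y) <= c * eta * Cmod (x - y)).
  { intros x y Hx Hy. eapply Rle_trans. apply Lip; apply InD; auto.
    replace (z0 + zeta * h * (1 + x) - (z0 + zeta * h * (1 + y)))%C with (zeta * h * (x - y))%C by ring.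
    rewrite !Cmod_mult, Z3, Hh, Rmult_1_l, <- Rmult_assoc. apply Rmult_le_compat_r; auto. apply Cmod_ge_0. }
  assert (G0 : forall x, Cmod x <= rho -> Cmod (G x - g z0) <= 2 * (c * eta)).
  { intros x Hx. eapply Rle_trans. apply Lip; auto.
    replace (z0 + zeta * h * (1 + x) - z0)%C with (zeta * h * (1 + x))%C by ring.
    apply Rle_trans with (L * (2 * s)). apply Rmult_le_compat_l; auto. lra. }
  assert (HMg : (RtoC M * g z0)%C <> 0).
  { apply Cmult_neq_0; auto. intros E. apply RtoC_inj in E. lra. }
  assert (CMg : Cmod (RtoC M * g z0) = M * c).
  { rewrite Cmod_mult, Cmod_R, Rabs_pos_eq by lra. reflexivity. }
  assert (Hce : 0 <= c * eta) by (apply Rmult_le_pos; lra).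
  destruct (newton_solve (fun x => (1 + x) ^ m * G x)%C 0 (RtoC M * g z0)%C (g (z0 + h))%C rho Rp HMg)
    as (x & Hx & Ex).
  - intros x y Hx Hy.
    replace (x - 0)%C with x in Hx by ring. replace (y - 0)%C with y in Hy by ring.
    replace ((1 + x) ^ m * G x - (1 + y) ^ m * G y - RtoC M * g z0 * (x - y))%C with
      (((1 + x) ^ m - (1 + y) ^ m - RtoC M * (x - y)) * G x
       + (RtoC M * (x - y) * (G x - g z0) + (1 + y) ^ m * (G x - G y)))%C by ring.
    eapply Rle_trans; [apply Cmod_triangle|].
    eapply Rle_trans; [apply Rplus_le_compat_l, Cmod_triangle|].
    rewrite !Cmod_mult, Cmod_pow, Cmod_R, (Rabs_pos_eq M) by lra.
    set (d := Cmod (x - y)). assert (Hd : 0 <= d) by apply Cmod_ge_0.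
    assert (P1 := HP rho x y Rb Hx Hy). fold M d in P1.
    assert (P2 := G0 x Hx). assert (P3 := GL x y Hx Hy). fold d in P3.
    assert (P4 : Cmod (G x) <= 2 * c).
    { replace (G x) with ((G x - g z0) + g z0)%C by ring.
      eapply Rle_trans; [apply Cmod_triangle|]. fold c.
      assert (c * eta <= c * / 2) by (apply Rmult_le_compat_l; lra). lra. }
    assert (P5 : Cmod (1 + y) ^ m <= 2 ^ m) by (apply pow_incr; split; [apply Cmod_ge_0|apply Bd; auto]).
    assert (Q1 : Cmod ((1 + x) ^ m - (1 + y) ^ m - RtoC M * (x - y)) * Cmod (G x) <= (/ 8 * d) * (2 * c)).
    { apply Rmult_le_compat; auto using Cmod_ge_0. eapply Rle_trans; [exact P1|].
      apply Rmult_le_compat_r; auto. }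
    assert (Q2 : M * d * Cmod (G x - g z0) <= M * d * (2 * (c * eta))).
    { apply Rmult_le_compat_l; auto. apply Rmult_le_pos; lra. }
    assert (Q3 : Cmod (1 + y) ^ m * Cmod (G x - G y) <= 2 ^ m * (c * eta * d)).
    { apply Rmult_le_compat; auto using Cmod_ge_0. apply pow_le, Cmod_ge_0. }
    assert (Q4 : ((2 * M + 2 ^ m) * eta) * (c * d) <= / 4 * (c * d)).
    { apply Rmult_le_compat_r; auto. apply Rmult_le_pos; lra. }
    assert (Q5 : 2 * (c * d) <= M * (c * d)).
    { apply Rmult_le_compat_r; auto. apply Rmult_le_pos; lra. }
    assert (0 <= c * d) by (apply Rmult_le_pos; lra). fold c. lra.
  - rewrite CMg.
    replace ((1 + 0) ^ m * G 0 - g (z0 + h))%C with (G 0 - g (z0 + h))%C.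
    2:{ replace (1 + 0)%C with (RtoC 1) by ring. rewrite Cpow_1_l. ring. }
    assert (Hr0 : Cmod 0 <= rho) by (rewrite Cmod_0; lra).
    eapply Rle_trans. apply Lip; auto.
    replace (z0 + zeta * h * (1 + 0) - (z0 + h))%C with ((zeta - 1) * h)%C by ring.
    rewrite Cmod_mult, Hh.
    assert (Cmod (zeta - 1) <= 2).
    { eapply Rle_trans; [apply Cmod_sub_le|]. rewrite Z3, Cmod_1; lra. }
    apply Rle_trans with (2 * (L * s)).
    { replace (2 * (L * s)) with (L * (2 * s)) by ring. apply Rmult_le_compat_l; auto.
      apply Rmult_le_compat_r; lra. }
    assert (c * eta <= c * (rho / 2)) by (apply Rmult_le_compat_l; lra).
    assert (2 * (c * rho) <= M * (c * rho)).
    { apply Rmult_le_compat_r; auto. apply Rmult_le_pos; lra. }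
    lra.
  - replace (x - 0)%C with x in Hx by ring.
    exists h, (zeta * h * (1 + x))%C. split; [rewrite Hh; lra|].
    split. generalize (Bk x Hx); lra.
    split.
    + intros E.
      assert (E2 : (zeta * (1 + x))%C = 1).
      { replace (zeta * (1 + x))%C with ((zeta * h * (1 + x)) / h)%C.
        rewrite <- E. field. unfold h. intros X; apply RtoC_inj in X; lra.
        field. unfold h. intros X; apply RtoC_inj in X; lra. }
      assert (E3 : Cmod (zeta - 1) = Cmod x).
      { replace (zeta - 1)%C with (- (zeta * x))%C. rewrite Cmod_opp, Cmod_mult, Z3; ring.
        rewrite <- E2. ring. }
      lra.
    + rewrite <- Ex. unfold G. rewrite !Cpow_mult_l, Z1. ring.
Qed.

Lemma geom_tail_bound q M n m : 0 <= q < 1 -> 0 <= M -> (n <= m)%nat ->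
  forall u : nat -> C, (forall k, Cmod (u k) <= M * q ^ k) ->
  Cmod (csum u m - csum u n) <= M * q ^ S n / (1 - q).
Proof.
  intros Hq HM Hnm u Hu.
  assert (H : Cmod (csum u m - csum u n) <= M * (q ^ S n - q ^ S m) / (1 - q)).
  { induction Hnm as [|m Hnm IH].
    - replace (csum u n - csum u n)%C with (RtoC 0) by ring. rewrite Cmod_0.
      unfold Rdiv. lra.
    - rewrite csum_S.
      replace (csum u m + u (S m) - csum u n)%C with ((csum u m - csum u n) + u (S m))%C by ring.
      eapply Rle_trans; [apply Cmod_triangle|].
      eapply Rle_trans; [apply Rplus_le_compat; [exact IH|apply Hu]|].
      right. rewrite <- (tech_pow_Rmult q (S m)). field. lra. }
  eapply Rle_trans; [exact H|].
  apply Rmult_le_compat_r. left; apply Rinv_0_lt_compat; lra.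
  apply Rmult_le_compat_l; auto. assert (0 <= q ^ S m) by (apply pow_le; lra). lra.
Qed.

(** The coefficients of [f z / (z - w)] for a power series [f] that vanishes at [w].
    Long division gives the tail [a (n+1) + a (n+2) w + ...] as coefficient; since
    [f w = 0], it is minus a partial sum divided by [w^(n+1)]. *)
Definition divcoef (a : nat -> C) (w : C) (n : nat) : C :=
  (- csum (fun k => a k * w ^ k)%C n / w ^ S n)%C.

(** The tail of [a k w^k] after [n] is bounded by a geometric series of ratio
    [Cmod w / r], and the bound is sharp enough to be iterated: a division only costs
    the factor [1 / (r - Cmod w)]. *)
Lemma divcoef_bound a (w : C) r M n :
  w <> 0 -> Cmod w < r -> (forall n, Cmod (a n) * r ^ n <= M) -> pser a w 0 ->
  Cmod (divcoef a w n) * r ^ n <= M / (r - Cmod w).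
Proof.
  intros Hw Hr HM H0. assert (Hwp := proj1 (Cmod_gt_0 w) Hw).
  set (q := Cmod w / r).
  assert (Hq : 0 <= q < 1).
  { unfold q. split. apply Rdiv_le_0_compat; lra.
    apply Rmult_lt_reg_r with r. lra. unfold Rdiv; rewrite Rmult_assoc, Rinv_l; lra. }
  assert (M0 : 0 <= M).
  { eapply Rle_trans; [|apply (HM 0%nat)]. simpl. rewrite Rmult_1_r. apply Cmod_ge_0. }
  assert (Hqr : q * r = Cmod w) by (unfold q; field; lra).
  assert (Hu : forall k, Cmod (a k * w ^ k) <= M * q ^ k).
  { intros k. rewrite Cmod_mult, Cmod_pow, <- Hqr, Rpow_mult_distr.
    replace (Cmod (a k) * (q ^ k * r ^ k)) with (Cmod (a k) * r ^ k * q ^ k) by ring.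
    apply Rmult_le_compat_r; auto. apply pow_le; lra. }
  assert (HS : Cmod (csum (fun k => a k * w ^ k)%C n) <= M * q ^ S n / (1 - q)).
  { apply le_epsilon. intros e He.
    destruct (proj1 (Cser_eps _ _) H0 e He) as [N HN].
    specialize (HN (Nat.max N n) ltac:(lia)).
    assert (T := geom_tail_bound q M n (Nat.max N n) Hq M0 ltac:(lia) _ Hu).
    set (s := csum (fun k => a k * w ^ k)%C) in *.
    replace (s n) with ((s (Nat.max N n) - 0) - (s (Nat.max N n) - s n))%C by ring.
    eapply Rle_trans; [apply Cmod_sub_le|]. lra. }
  unfold divcoef. rewrite Cmod_div by (apply Cpow_nz; auto). rewrite Cmod_opp, Cmod_pow.
  assert (Hpw : 0 < Cmod w ^ S n) by (apply pow_lt; auto).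
  assert (Hpr : 0 < r ^ n) by (apply pow_lt; lra).
  apply Rle_trans with ((M * q ^ S n / (1 - q)) / Cmod w ^ S n * r ^ n).
  - apply Rmult_le_compat_r. lra. apply Rmult_le_compat_r; auto.
    left; apply Rinv_0_lt_compat; auto.
  - right. rewrite <- Hqr, Rpow_mult_distr.
    assert (q <> 0). { intros E. rewrite E in Hqr. lra. }
    simpl pow. assert (q ^ n <> 0) by (apply pow_nonzero; auto).
    assert (r - q * r <> 0).
    { assert (r - q * r = r * (1 - q)) by ring.
      assert (0 < r * (1 - q)) by (apply Rmult_lt_0_compat; lra). lra. }
    field. repeat split; try lra; auto.
Qed.

Lemma divcoef_correct a (w z l : C) : w <> 0 ->
  pser (divcoef a w) z l -> pser a z ((z - w) * l)%C.
Proof.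
  intros Hw Hl.
  set (e := fun n => match n with O => RtoC 0 | S k => (z * (divcoef a w k * z ^ k))%C end).
  assert (He : Cser e (z * l)%C).
  { replace (z * l)%C with (e 0%nat + z * l)%C by (simpl; ring).
    apply Cser_unshift. apply (Cser_scal z). exact Hl. }
  assert (H := Cser_minus _ _ _ _ He (Cser_scal w _ _ Hl)).
  replace ((z - w) * l)%C with (z * l - w * l)%C by ring.
  revert H. apply Cser_ext. intros n. destruct n as [|n]; unfold e, divcoef.
  - rewrite csum_0. simpl. field. auto.
  - rewrite csum_S. set (s := csum (fun k => a k * w ^ k)%C n). rewrite !Cpow_S.
    field. repeat split; auto. apply Cpow_nz; auto.
Qed.

Lemma divcoef_disk a (w : C) : w <> 0 -> disk_coeffs a -> Cmod w < 1 -> pser a w 0 ->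
  disk_coeffs (divcoef a w).
Proof.
  intros Hw Ha Hw1 H0 r Hr. assert (Hwp := Cmod_ge_0 w).
  set (r' := (Rmax r (Cmod w) + 1) / 2).
  assert (Hmax := Rmax_l r (Cmod w)). assert (Hmax' := Rmax_r r (Cmod w)).
  assert (Hm1 : Rmax r (Cmod w) < 1) by (apply Rmax_lub_lt; lra).
  destruct (Ha r') as [M HM]. unfold r'; lra.
  exists (M / (r' - Cmod w)). intros n.
  apply Rle_trans with (2 := divcoef_bound a w r' M n Hw ltac:(unfold r'; lra) HM H0).
  apply Rmult_le_compat_l. apply Cmod_ge_0. apply pow_incr. unfold r'; lra.
Qed.

Lemma Psum_geom_bound a r M z : (forall n, Cmod (a n) * r ^ n <= M) -> disk_coeffs a ->
  Cmod z < r -> Cmod z < 1 -> Cmod (Psum a z) <= M * / (1 - Cmod z / r).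
Proof.
  intros HM Ha Hz Hz1. assert (H0 := Cmod_ge_0 z).
  assert (Hq : 0 <= Cmod z / r < 1).
  { split. apply Rdiv_le_0_compat; lra.
    apply Rmult_lt_reg_r with r. lra. unfold Rdiv; rewrite Rmult_assoc, Rinv_l; lra. }
  apply (Cser_le _ (fun n => M * (Cmod z / r) ^ n) _ _ (Psum_pser a z Ha Hz1)).
  - apply (is_series_scal_l M (fun n => (Cmod z / r) ^ n)). apply is_series_geom.
    rewrite Rabs_pos_eq; lra.
  - intros n. rewrite Cmod_mult, Cmod_pow.
    replace (Cmod z ^ n) with (r ^ n * (Cmod z / r) ^ n).
    2:{ rewrite <- Rpow_mult_distr. f_equal. field. lra. }
    rewrite <- Rmult_assoc. apply Rmult_le_compat_r. apply pow_le; lra. apply HM.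
Qed.

Definition injective_in_disk (f : C -> C) : Prop :=
  forall z w, Cmod z < 1 -> Cmod w < 1 -> f z = f w -> z = w.

(** The order at [w] of [f - f w] is finite for an injective power series: each division
    by [z - w] multiplies the coefficient bound at radius [r] by [1 / (r - |w|)] only,
    so infinitely many divisions would make [f] constant near [w]. *)
Lemma finite_order a (w : C) : disk_coeffs a -> injective_in_disk (Psum a) ->
  w <> 0 -> Cmod w < 1 ->
  exists m g, disk_coeffs g /\ Psum g w <> 0 /\
    forall z, Cmod z < 1 -> (Psum a z - Psum a w = (z - w) ^ m * Psum g z)%C.
Proof.
  intros Ha Hinj Hw Hw1. apply NNPP. intros Hno.
  set (a0 := fun n => match n with O => (a 0%nat - Psum a w)%C | S k => a (S k) end).
  assert (Ha0 : forall z, Cmod z < 1 -> pser a0 z (Psum a z - Psum a w)).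
  { intros z Hz. assert (H := Psum_pser a z Ha Hz).
    replace (Psum a z - Psum a w)%C with ((a0 0%nat * z ^ 0) + (Psum a z - a 0%nat * z ^ 0))%C
      by (simpl; ring).
    apply (Cser_unshift (fun n => a0 n * z ^ n)%C). exact (Cser_shift _ _ H). }
  assert (Da0 : disk_coeffs a0).
  { apply (disk_coeffs_of_pser_disk a0 (fun z => Psum a z - Psum a w)%C Ha0). }
  set (r := (1 + Cmod w) / 2). assert (Hwp := Cmod_ge_0 w).
  assert (Hr : 0 < r < 1 /\ Cmod w < r) by (unfold r; lra).
  destruct (Da0 r) as [M HM]. tauto.
  assert (D : 0 < r - Cmod w) by lra.
  assert (P : forall m, exists g, disk_coeffs g /\
     (forall z, Cmod z < 1 -> (Psum a z - Psum a w = (z - w) ^ m * Psum g z)%C) /\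
     (forall n, Cmod (g n) * r ^ n <= M / (r - Cmod w) ^ m)).
  { induction m as [|m (g & Dg & Eg & Bg)].
    - exists a0. split; auto. split.
      + intros z Hz. rewrite (Psum_unique a0 z _ (Ha0 z Hz)). simpl. ring.
      + intros n. simpl. unfold Rdiv. rewrite Rinv_1, Rmult_1_r. apply HM.
    - assert (G0 : Psum g w = 0).
      { apply NNPP. intros Hg. apply Hno. exists m, g. auto. }
      assert (P0 : pser g w 0) by (rewrite <- G0; apply Psum_pser; auto).
      exists (divcoef g w).
      assert (Dd := divcoef_disk g w Hw Dg Hw1 P0).
      split; auto. split.
      + intros z Hz. rewrite (Eg z Hz).
        rewrite (Psum_unique g z _ (divcoef_correct g w z _ Hw (Psum_pser _ z Dd Hz))).
        rewrite Cpow_S. ring.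
      + intros n. eapply Rle_trans. apply (divcoef_bound g w r _ n Hw (proj2 Hr) Bg P0).
        right. simpl. field. split; [apply pow_nonzero; lra|lra]. }
  set (s := (r - Cmod w) / 2). assert (Hs : 0 < s) by (unfold s; lra).
  set (z := (w + s)%C).
  assert (Ez : Cmod (z - w) = s).
  { unfold z. replace (w + s - w)%C with (RtoC s) by ring. rewrite Cmod_R, Rabs_pos_eq; lra. }
  assert (Hz : Cmod z < r).
  { generalize (Cmod_sub_ge z w). unfold s in *. lra. }
  assert (Hzw : z = w).
  { apply Hinj. lra. auto. apply Ceq_minus. apply Cmod_eq_of_small. intros e He.
    set (B := M * / (1 - Cmod z / r)).
    assert (BB : forall m, Cmod (Psum a z - Psum a w) <= B * (/ 2) ^ m).
    { intros m. destruct (P m) as (g & Dg & Eg & Bg). rewrite (Eg z) by lra.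
      rewrite Cmod_mult, Cmod_pow, Ez.
      eapply Rle_trans. apply Rmult_le_compat_l. apply pow_le; lra.
      apply (Psum_geom_bound g r _ z Bg Dg); lra.
      right. unfold B. replace ((/ 2) ^ m) with (s ^ m * / (r - Cmod w) ^ m).
      unfold Rdiv; ring.
      rewrite <- pow_inv, <- Rpow_mult_distr. f_equal. unfold s. field. lra. }
    assert (HB : 0 <= B).
    { eapply Rle_trans; [apply Cmod_ge_0|]. generalize (BB 0%nat). simpl. rewrite Rmult_1_r. intros X; exact X. }
    destruct (small_factor e B He HB) as (q & Q1 & Q2).
    destruct (pow_lt_1_zero (/ 2)) with (y := q) as [N HN]. rewrite Rabs_pos_eq; lra. auto.
    specialize (HN N (le_n N)). rewrite Rabs_pos_eq in HN by (apply pow_le; lra).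
    eapply Rle_trans; [apply (BB N)|]. eapply Rle_trans; [|exact Q2].
    apply Rmult_le_compat_l; auto. lra. }
  rewrite Hzw in Ez. replace (w - w)%C with (RtoC 0) in Ez by ring. rewrite Cmod_0 in Ez. lra.
Qed.

Lemma Psum_locally_lipschitz a w : disk_coeffs a -> Cmod w < 1 ->
  exists L delta, 0 <= L /\ 0 < delta /\
   forall x y, Cmod (x - w) < delta -> Cmod (y - w) < delta ->
     Cmod x < 1 /\ Cmod y < 1 /\ Cmod (Psum a x - Psum a y) <= L * Cmod (x - y).
Proof.
  intros Ha Hw. assert (Hw0 := Cmod_ge_0 w).
  set (rho := (1 + Cmod w) / 2). set (r := (1 + rho) / 2).
  assert (Hr : 0 < r < 1) by (unfold r, rho; lra).
  destruct (Psum_taylor a rho Ha) as (K & HK & HT). unfold rho; lra.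
  assert (Dd := disk_coeffs_dcoef a Ha).
  destruct (Dd r Hr) as [M HM].
  assert (M0 : 0 <= M).
  { eapply Rle_trans; [|apply (HM 0%nat)]. simpl pow. rewrite Rmult_1_r. apply Cmod_ge_0. }
  assert (Hq : 0 < 1 - rho / r).
  { apply Rmult_lt_reg_r with r. lra. rewrite Rmult_minus_distr_r. unfold Rdiv.
    rewrite Rmult_assoc, Rinv_l by lra. unfold r, rho. lra. }
  set (L1 := M * / (1 - rho / r)).
  assert (HL1 : 0 <= L1).
  { apply Rmult_le_pos; auto. left; apply Rinv_0_lt_compat; auto. }
  exists (2 * K + L1), ((1 - Cmod w) / 2). split. lra. split. lra.
  intros x y Hx Hy.
  assert (Hx' : Cmod x <= rho) by (generalize (Cmod_sub_ge x w); unfold rho; lra).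
  assert (Hy' : Cmod y <= rho) by (generalize (Cmod_sub_ge y w); unfold rho; lra).
  assert (rho < 1) by (unfold rho; lra).
  split. lra. split. lra.
  replace (Psum a x - Psum a y)%C with
   ((Psum a x - Psum a y - Psum (dcoef a) y * (x - y)) + Psum (dcoef a) y * (x - y))%C by ring.
  eapply Rle_trans; [apply Cmod_triangle|]. rewrite Cmod_mult.
  assert (T := HT x y Hx' Hy').
  assert (D : Cmod (Psum (dcoef a) y) <= L1).
  { eapply Rle_trans. apply (Psum_geom_bound _ r M y HM Dd). unfold r; lra. lra.
    apply Rmult_le_compat_l; auto. apply Rinv_le_contravar; auto.
    apply Rplus_le_compat_l, Ropp_le_contravar, Rmult_le_compat_r; auto.
    left; apply Rinv_0_lt_compat; lra. }
  assert (Hd := Cmod_ge_0 (x - y)).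
  assert (Hd2 : Cmod (x - y) <= 2) by (eapply Rle_trans; [apply Cmod_sub_le|lra]).
  assert (K * Cmod (x - y) ^ 2 <= K * (2 * Cmod (x - y))).
  { apply Rmult_le_compat_l; auto. simpl. rewrite Rmult_1_r. apply Rmult_le_compat_r; auto. }
  assert (Cmod (Psum (dcoef a) y) * Cmod (x - y) <= L1 * Cmod (x - y)) by (apply Rmult_le_compat_r; auto).
  lra.
Qed.

(** At a point [w <> 0], [f - f w] is [(z - w)^m g] with [g w <> 0]. The order [m] is
    not 0, it is not 2 or more by [multiple_zero_not_injective], and for [m = 1] the
    derivative is [g w]. At 0 the derivative is [a 1]. *)
Lemma injective_derivative_nonzero a (w : C) : disk_coeffs a -> injective_in_disk (Psum a) ->
  a 1%nat <> 0 -> Cmod w < 1 -> Psum (dcoef a) w <> 0.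
Proof.
  intros Ha Hinj Ha1 Hw1.
  destruct (Ceq_dec w 0) as [E|Hw].
  - subst w. replace (Psum (dcoef a) 0) with (a 1%nat); auto.
    symmetry. apply Psum_unique. unfold pser.
    replace (a 1%nat) with (dcoef a 0%nat * 0 ^ 0 + 0)%C by (unfold dcoef; simpl; ring).
    apply (Cser_unshift (fun n => dcoef a n * 0 ^ n)%C).
    apply Cser_eps. intros e He. exists 0%nat. intros n _.
    assert (Z : csum (fun n => dcoef a (S n) * 0 ^ S n)%C n = 0).
    { induction n as [|n IH]. rewrite csum_0. simpl; ring. rewrite csum_S, IH. simpl; ring. }
    rewrite Z. replace (0 - 0)%C with (RtoC 0) by ring. rewrite Cmod_0; auto.
  - destruct (finite_order a w Ha Hinj Hw Hw1) as (m & g & Dg & Hg & Eg).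
    assert (Qf := qdiff_Psum a w Ha Hw1).
    destruct m as [|[|m]].
    + exfalso. apply Hg. specialize (Eg w Hw1). simpl in Eg.
      replace (Psum g w) with (1 * Psum g w)%C by ring. rewrite <- Eg. ring.
    + assert (Qg := qdiff_Psum g w Dg Hw1).
      assert (Qm := qdiff_mult _ _ _ _ _
        (qdiff_plus _ _ _ _ _ (qdiff_id w) (qdiff_const (- w) w)) Qg).
      assert (Q2 := qdiff_plus _ _ _ _ _ Qm (qdiff_const (Psum a w) w)).
      assert (Q3 : qdiff (Psum a) w ((1 + 0) * Psum g w + (w + - w) * Psum (dcoef g) w + 0)%C).
      { refine (qdiff_ext_loc _ _ _ _ _ Q2). exists (1 - Cmod w). split. lra.
        intros z Hz. assert (Hz1 : Cmod z < 1) by (generalize (Cmod_sub_ge z w); lra).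
        specialize (Eg z Hz1). simpl in Eg.
        replace (Psum a z) with ((Psum a z - Psum a w) + Psum a w)%C by ring. rewrite Eg. ring. }
      rewrite (qdiff_unique _ _ _ _ Qf Q3).
      replace ((1 + 0) * Psum g w + (w + - w) * Psum (dcoef g) w + 0)%C with (Psum g w) by ring.
      exact Hg.
    + exfalso.
      destruct (Psum_locally_lipschitz g w Dg Hw1) as (L & del & HL & Hdel & HLip).
      destruct (multiple_zero_not_injective (S (S m)) (Psum g) w L del) as (h & k & Hh & Hk & Hhk & E);
        auto. lia. intros x y Hx Hy. apply HLip; auto.
      assert (Sub : forall v, (w + v - w)%C = v) by (intros; ring).
      destruct (HLip (w + h)%C (w + k)%C) as (D1 & D2 & _); try (rewrite Sub; auto).
      apply Hhk. rewrite <- (Sub h), <- (Sub k). f_equal.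
      apply Hinj; auto.
      assert (E1 := Eg _ D1). assert (E2 := Eg _ D2). rewrite Sub in E1, E2.
      rewrite E in E1. rewrite <- E2 in E1.
      replace (Psum a (w + h)) with (Psum a (w + h) - Psum a w + Psum a w)%C by ring.
      rewrite E1. ring.
Qed.

(** * Local inverses *)

(** Newton's method finds every value near [f (omega z)] close to [omega z], and
    injectivity says that it is taken nowhere else. So [omega = f^-1 o g] is Lipschitz
    at [z], and the Taylor estimate of [f] can be solved for [omega]. *)
Lemma qdiff_inverse_comp a g omega z d : disk_coeffs a -> injective_in_disk (Psum a) ->
  (forall w, Cmod w < 1 -> Psum (dcoef a) w <> 0) ->
  Cmod z < 1 -> qdiff g z d ->
  (forall w, Cmod w < 1 -> Cmod (omega w) < 1 /\ Psum a (omega w) = g w) ->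
  qdiff omega z (d / Psum (dcoef a) (omega z))%C.
Proof.
  intros Ha Hinj Hd Hz Qg Hom.
  set (w0 := omega z). destruct (Hom z Hz) as [Hw0 Ew0]. fold w0 in Hw0, Ew0.
  set (b := Psum (dcoef a) w0). assert (Hb : b <> 0) by (apply Hd; auto).
  assert (Hbp := proj1 (Cmod_gt_0 b) Hb).
  assert (P0 := Cmod_ge_0 w0).
  set (rho := (1 + Cmod w0) / 2).
  destruct (Psum_taylor a rho Ha) as (K & HK & HT). unfold rho; lra.
  destruct (qdiff_lipschitz _ _ _ (qdiff_Psum _ w0 (disk_coeffs_dcoef a Ha) Hw0))
    as (L1 & e1 & HL1 & He1 & HLip). fold b in HLip.
  destruct (qdiff_lipschitz _ _ _ Qg) as (Lg & eg & HLg & Heg & HLipg).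
  destruct Qg as (Kg & dg & HKg & Hdg & HTg).
  (* s is so small that f' varies by at most half of b on the ball of radius s *)
  destruct (small_factor (Cmod b / 2) (2 * K + L1)) as (s1 & S1 & S1'); try lra.
  destruct (small3 s1 (e1 / 2) ((1 - Cmod w0) / 2)) as (s & Sp & Sa & Sb & Sc); try lra.
  assert (HKs : (2 * K + L1) * s <= Cmod b / 2).
  { apply Rle_trans with (2 := S1'). apply Rmult_le_compat_l; lra. }
  assert (InR : forall x, Cmod (x - w0) <= s -> Cmod x <= rho).
  { intros x Hx. generalize (Cmod_sub_ge x w0). unfold rho. lra. }
  assert (N : forall x y, Cmod (x - w0) <= s -> Cmod (y - w0) <= s ->
    Cmod (Psum a x - Psum a y - b * (x - y)) <= Cmod b / 2 * Cmod (x - y)).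
  { intros x y Hx Hy. assert (T := HT x y (InR x Hx) (InR y Hy)).
    replace (Psum a x - Psum a y - b * (x - y))%C with
     ((Psum a x - Psum a y - Psum (dcoef a) y * (x - y)) + (Psum (dcoef a) y - b) * (x - y))%C by ring.
    eapply Rle_trans; [apply Cmod_triangle|]. rewrite Cmod_mult.
    assert (Hdd := Cmod_ge_0 (x - y)).
    assert (Hxy : Cmod (x - y) <= 2 * s).
    { replace (x - y)%C with ((x - w0) - (y - w0))%C by ring.
      eapply Rle_trans; [apply Cmod_sub_le|]. lra. }
    assert (A1 : K * Cmod (x - y) ^ 2 <= K * (2 * s * Cmod (x - y))).
    { apply Rmult_le_compat_l; auto. simpl. rewrite Rmult_1_r. apply Rmult_le_compat_r; auto. }
    assert (A2 : Cmod (Psum (dcoef a) y - b) * Cmod (x - y) <= (L1 * s) * Cmod (x - y)).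
    { apply Rmult_le_compat_r; auto. eapply Rle_trans; [apply HLip; lra|].
      apply Rmult_le_compat_l; auto. }
    assert (A3 : ((2 * K + L1) * s) * Cmod (x - y) <= Cmod b / 2 * Cmod (x - y))
      by (apply Rmult_le_compat_r; auto).
    lra. }
  assert (I0 : Cmod (w0 - w0) <= s).
  { replace (w0 - w0)%C with (RtoC 0) by ring. rewrite Cmod_0; lra. }
  destruct (small_factor (Cmod b * s / 2) Lg) as (t1 & T1 & T1'); auto.
  { apply Rdiv_lt_0_compat; [apply Rmult_lt_0_compat|]; lra. }
  destruct (small3 eg dg (Rmin t1 (1 - Cmod z))) as (del & Dp & Da & Db & Dc); auto.
  { apply Rmin_pos; lra. }
  assert (Dt := Rle_trans _ _ _ Dc (Rmin_l _ _)). assert (Dz := Rle_trans _ _ _ Dc (Rmin_r _ _)).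
  (* the solution that Newton's method finds is omega w, by injectivity *)
  assert (Near : forall w, Cmod (w - z) < del -> Cmod w < 1 /\ Cmod (omega w - w0) <= s).
  { intros w Hw. assert (Hw1 : Cmod w < 1) by (generalize (Cmod_sub_ge w z); lra).
    split; auto. destruct (Hom w Hw1) as [Hw2 Ew].
    destruct (newton_solve (Psum a) w0 b (g w) s Sp Hb N) as (x & Hx & Ex).
    { rewrite Ew0, Cmod_minus_comm. eapply Rle_trans; [apply HLipg; lra|].
      apply Rle_trans with (2 := T1'). apply Rmult_le_compat_l; auto. lra. }
    replace (omega w) with x; auto. apply Hinj; auto.
    generalize (InR x Hx). unfold rho. lra. rewrite Ex, Ew. reflexivity. }
  exists ((Kg + K * (2 * Lg / Cmod b) ^ 2) / Cmod b), del.
  split. { apply Rdiv_le_0_compat; auto.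
    assert (0 <= K * (2 * Lg / Cmod b) ^ 2) by (apply Rmult_le_pos; auto; apply pow2_ge_0). lra. }
  split; auto. intros w Hw. destruct (Near w Hw) as [Hw1 Hs]. destruct (Hom w Hw1) as [Hw2 Ew].
  fold w0. fold b.
  assert (G1 := HLipg w ltac:(lra)). assert (G2 := HTg w ltac:(lra)).
  assert (N1 := N (omega w) w0 Hs I0). rewrite Ew, Ew0 in N1.
  set (u := (omega w - w0)%C) in *.
  (* the Newton estimate makes omega Lipschitz *)
  assert (Lu : Cmod u <= 2 * Lg / Cmod b * Cmod (w - z)).
  { apply Rmult_le_reg_l with (Cmod b / 2). lra.
    replace (Cmod b / 2 * (2 * Lg / Cmod b * Cmod (w - z))) with (Lg * Cmod (w - z)) by (field; lra).
    assert (Cmod b * Cmod u <= Cmod (g w - g z) + Cmod (g w - g z - b * u)).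
    { rewrite <- Cmod_mult. replace (b * u)%C with ((g w - g z) - (g w - g z - b * u))%C at 1 by ring.
      apply Cmod_sub_le. }
    lra. }
  assert (T2 := HT (omega w) w0 (InR _ Hs) (InR _ I0)). rewrite Ew, Ew0 in T2. fold b in T2. fold u in T2.
  assert (Hwz := Cmod_ge_0 (w - z)).
  assert (U2 : K * Cmod u ^ 2 <= K * (2 * Lg / Cmod b * Cmod (w - z)) ^ 2).
  { apply Rmult_le_compat_l; auto. apply pow_incr. split; auto. apply Cmod_ge_0. }
  replace (u - d / b * (w - z))%C with
    (((g w - g z - d * (w - z)) - (g w - g z - b * u)) / b)%C by (field; auto).
  rewrite Cmod_div by auto. unfold Rdiv at 1 2.
  rewrite (Rmult_comm _ (/ Cmod b)), (Rmult_comm _ (/ Cmod b)), Rmult_assoc.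
  apply Rmult_le_compat_l. left; apply Rinv_0_lt_compat; auto.
  eapply Rle_trans; [apply Cmod_sub_le|].
  eapply Rle_trans; [apply Rplus_le_compat; [exact G2|eapply Rle_trans; [exact T2|exact U2]]|].
  right; ring.
Qed.

(** * Orders of smallness at the origin *)

Definition bigO (k : nat) (F : C -> C) : Prop :=
  exists K delta, 0 <= K /\ 0 < delta /\
    forall z, Cmod z < delta -> Cmod (F z) <= K * Cmod z ^ k.

Lemma bigO_ext_loc k F G delta : 0 < delta -> (forall z, Cmod z < delta -> F z = G z) ->
  bigO k F -> bigO k G.
Proof.
  intros Hd E (K & e & HK & He & H). exists K, (Rmin delta e).
  split; auto. split. apply Rmin_pos; auto.
  intros z Hz. rewrite <- E. apply H.
  eapply Rlt_le_trans; [exact Hz|apply Rmin_r]. eapply Rlt_le_trans; [exact Hz|apply Rmin_l].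
Qed.

Lemma bigO_ext k F G : (forall z, F z = G z) -> bigO k F -> bigO k G.
Proof. intros E. apply (bigO_ext_loc k F G 1). lra. auto. Qed.

Lemma bigO_plus k F G : bigO k F -> bigO k G -> bigO k (fun z => F z + G z)%C.
Proof.
  intros (K1 & e1 & HK1 & He1 & H1) (K2 & e2 & HK2 & He2 & H2).
  exists (K1 + K2), (Rmin e1 e2). split. lra. split. apply Rmin_pos; auto.
  intros z Hz. eapply Rle_trans; [apply Cmod_triangle|].
  generalize (H1 z (Rlt_le_trans _ _ _ Hz (Rmin_l _ _))) (H2 z (Rlt_le_trans _ _ _ Hz (Rmin_r _ _))).
  lra.
Qed.

Lemma bigO_mult k l F G : bigO k F -> bigO l G -> bigO (k + l) (fun z => F z * G z)%C.
Proof.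
  intros (K1 & e1 & HK1 & He1 & H1) (K2 & e2 & HK2 & He2 & H2).
  exists (K1 * K2), (Rmin e1 e2). split. apply Rmult_le_pos; auto. split. apply Rmin_pos; auto.
  intros z Hz. rewrite Cmod_mult, pow_add.
  replace (K1 * K2 * (Cmod z ^ k * Cmod z ^ l)) with ((K1 * Cmod z ^ k) * (K2 * Cmod z ^ l)) by ring.
  apply Rmult_le_compat; auto using Cmod_ge_0.
  apply H1, (Rlt_le_trans _ _ _ Hz (Rmin_l _ _)). apply H2, (Rlt_le_trans _ _ _ Hz (Rmin_r _ _)).
Qed.

Lemma bigO_const c : bigO 0 (fun _ => c).
Proof.
  exists (Cmod c), 1. split. apply Cmod_ge_0. split. lra. intros z _. simpl. lra.
Qed.

Lemma bigO_scal k c F : bigO k F -> bigO k (fun z => c * F z)%C.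
Proof. intros H. exact (bigO_mult 0 k _ _ (bigO_const c) H). Qed.

Lemma bigO_minus k F G : bigO k F -> bigO k G -> bigO k (fun z => F z - G z)%C.
Proof.
  intros H1 H2. apply (bigO_ext _ (fun z => F z + (- (1)) * G z)%C).
  intros; ring. apply bigO_plus; auto. apply bigO_scal; auto.
Qed.

Lemma bigO_weaken k l F : (k <= l)%nat -> bigO l F -> bigO k F.
Proof.
  intros Hkl (K & e & HK & He & H). exists K, (Rmin e 1).
  split; auto. split. apply Rmin_pos; lra. intros z Hz.
  assert (Z1 := Rlt_le_trans _ _ _ Hz (Rmin_l _ _)). assert (Z2 := Rlt_le_trans _ _ _ Hz (Rmin_r _ _)).
  eapply Rle_trans; [apply H; auto|]. apply Rmult_le_compat_l; auto.
  replace l with (k + (l - k))%nat by lia. rewrite pow_add.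
  rewrite <- (Rmult_1_r (Cmod z ^ k)) at 2. apply Rmult_le_compat_l. apply pow_le, Cmod_ge_0.
  rewrite <- (pow1 (l - k)). apply pow_incr. split; [apply Cmod_ge_0|lra].
Qed.

Lemma bigO_monomial c k : bigO k (fun z => c * z ^ k)%C.
Proof.
  exists (Cmod c), 1. split. apply Cmod_ge_0. split. lra.
  intros z _. rewrite Cmod_mult, Cmod_pow. lra.
Qed.

Lemma bigO_comp k F G : bigO k F -> bigO 1 G -> bigO k (fun z => F (G z)).
Proof.
  intros (K1 & e1 & HK1 & He1 & H1) (K2 & e2 & HK2 & He2 & H2).
  destruct (small_factor (e1 / 2) K2) as (s & Hs & Hs'); try lra.
  exists (K1 * K2 ^ k), (Rmin e2 s). split. apply Rmult_le_pos; auto. apply pow_le; auto.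
  split. apply Rmin_pos; auto. intros z Hz.
  assert (Z1 := Rlt_le_trans _ _ _ Hz (Rmin_l _ _)). assert (Z2 := Rlt_le_trans _ _ _ Hz (Rmin_r _ _)).
  specialize (H2 z Z1). rewrite pow_1 in H2.
  assert (K2 * Cmod z <= K2 * s) by (apply Rmult_le_compat_l; lra).
  eapply Rle_trans; [apply H1; lra|]. rewrite Rmult_assoc. apply Rmult_le_compat_l; auto.
  rewrite <- Rpow_mult_distr. apply pow_incr. split; [apply Cmod_ge_0|auto].
Qed.

(** Uniqueness of expansions at the origin. *)
Lemma bigO_coef_0 (c : C) k : bigO (S k) (fun z => c * z ^ k)%C -> c = 0.
Proof.
  intros (K & e & HK & He & H). apply Cmod_eq_of_small. intros eps Heps.
  destruct (small_factor eps K) as (s & Hs & Hs'); auto.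
  destruct (small3 s (e / 2) 1) as (r & Rp & Ra & Rb & _); try lra.
  specialize (H (RtoC r)). rewrite Cmod_R, Rabs_pos_eq in H by lra. specialize (H ltac:(lra)).
  rewrite Cmod_mult, Cmod_pow, Cmod_R, Rabs_pos_eq in H by lra.
  assert (0 < r ^ k) by (apply pow_lt; auto).
  apply Rmult_le_reg_r with (r ^ k); auto. eapply Rle_trans; [exact H|].
  simpl. rewrite <- Rmult_assoc. apply Rmult_le_compat_r. lra.
  apply Rle_trans with (2 := Hs'). apply Rmult_le_compat_l; auto.
Qed.

Lemma Psum_shift a z : disk_coeffs a -> Cmod z < 1 ->
  Psum a z = (a 0%nat + z * Psum (fun n => a (S n)) z)%C.
Proof.
  intros Ha Hz. apply Psum_unique.
  replace (a 0%nat + z * Psum (fun n => a (S n)) z)%C with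
    (a 0%nat * z ^ 0 + z * Psum (fun n => a (S n)) z)%C by (simpl; ring).
  apply (Cser_unshift (fun n => a n * z ^ n)%C).
  apply Cser_ext with (fun n => z * (a (S n) * z ^ n))%C. intros; simpl; ring.
  apply Cser_scal. apply Psum_pser; auto. apply disk_coeffs_shift; auto.
Qed.

Lemma bigO_Psum a : disk_coeffs a -> bigO 0 (Psum a).
Proof.
  intros Ha. destruct (Ha (/ 2)) as [M HM]. lra.
  assert (M0 : 0 <= M).
  { eapply Rle_trans; [|apply (HM 0%nat)]. simpl pow. rewrite Rmult_1_r. apply Cmod_ge_0. }
  exists (M * 2), (/ 4). split. lra. split. lra. intros z Hz. rewrite pow_O, Rmult_1_r.
  eapply Rle_trans. apply (Psum_geom_bound a (/2) M z HM Ha); lra.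
  apply Rmult_le_compat_l; auto. replace 2 with (/ (/ 2)) at 2 by lra.
  apply Rinv_le_contravar; lra.
Qed.

Lemma Psum_cubic a : disk_coeffs a ->
  bigO 4 (fun z => Psum a z - (a 0%nat + a 1%nat * z + a 2%nat * z ^ 2 + a 3%nat * z ^ 3))%C.
Proof.
  intros Ha.
  assert (D1 := disk_coeffs_shift _ Ha). assert (D2 := disk_coeffs_shift _ D1).
  assert (D3 := disk_coeffs_shift _ D2). assert (D4 := disk_coeffs_shift _ D3).
  apply (bigO_ext_loc 4 (fun z => 1 * z ^ 4 * Psum (fun n => a (S (S (S (S n))))) z)%C _ 1). lra.
  - intros z Hz. rewrite (Psum_shift a z Ha Hz), (Psum_shift _ z D1 Hz), (Psum_shift _ z D2 Hz),
      (Psum_shift _ z D3 Hz). ring.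
  - apply (bigO_mult 4 0). apply bigO_monomial. apply bigO_Psum; auto.
Qed.

Lemma bigO_of_qdiff (h : C -> C) (d : C) : h 0 = 0 -> qdiff h 0 d -> bigO 1 h.
Proof.
  intros H0 Q. destruct (qdiff_lipschitz _ _ _ Q) as (L & e & HL & He & H).
  exists L, e. split; auto. split; auto. intros z Hz. rewrite pow_1.
  specialize (H z). rewrite H0 in H. replace (z - 0)%C with z in H by ring.
  replace (h z - 0)%C with (h z) in H by ring. auto.
Qed.

(** * The complex exponential *)

(** By the mean value theorem; the constant [M] is not divided by [n + 1], which keeps
    the repeated use for [exp], [cos] and [sin] simple. *)
Lemma bound_from_derivative (phi dphi : R -> R) (M : R) n :
  (forall x, is_derive phi x (dphi x)) -> phi 0 = 0 ->
  (forall x, Rabs x <= 1 -> Rabs (dphi x) <= M * Rabs x ^ n) ->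
  0 <= M ->
  forall x, Rabs x <= 1 -> Rabs (phi x) <= M * Rabs x ^ S n.
Proof.
  intros Hd H0 Hb HM x Hx.
  destruct (MVT_gen phi 0 x dphi) as (c & Hc & E).
  - intros y _. apply Hd.
  - intros y _. apply continuity_pt_filterlim. apply (ex_derive_continuous phi). eexists; apply Hd.
  - rewrite H0, !Rminus_0_r in E. rewrite E, Rabs_mult.
    assert (Hc' : Rabs c <= Rabs x).
    { unfold Rmin, Rmax in Hc. destruct (Rle_dec 0 x).
      rewrite !Rabs_pos_eq; lra. rewrite !Rabs_left1; lra. }
    rewrite <- tech_pow_Rmult, (Rmult_comm (Rabs x)), <- Rmult_assoc.
    apply Rmult_le_compat_r. apply Rabs_pos.
    eapply Rle_trans; [apply Hb; lra|]. apply Rmult_le_compat_l; auto.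
    apply pow_incr. split; [apply Rabs_pos|auto].
Qed.

Lemma exp_taylor2 x : Rabs x <= 1 -> Rabs (exp x - 1 - x - x ^ 2 / 2) <= 3 * Rabs x ^ 3.
Proof.
  revert x. apply (bound_from_derivative (fun x => exp x - 1 - x - x ^ 2 / 2) (fun x => exp x - 1 - x)).
  - intros x. auto_derive; auto. field.
  - rewrite exp_0. lra.
  - apply (bound_from_derivative (fun x => exp x - 1 - x) (fun x => exp x - 1)).
    + intros x. auto_derive; auto. ring.
    + rewrite exp_0. lra.
    + apply (bound_from_derivative (fun x => exp x - 1) exp).
      * intros x. auto_derive; auto. ring.
      * rewrite exp_0. lra.
      * intros x Hx. simpl. rewrite Rabs_pos_eq by (left; apply exp_pos).
        generalize exp_le_3. assert (x <= 1) by (apply Rabs_le_between in Hx; lra).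
        destruct (Rle_lt_or_eq_dec _ _ H) as [H1|H1].
        apply exp_increasing in H1. lra. rewrite H1. lra.
      * lra.
    + lra.
  - lra.
Qed.

Lemma cos_sin_taylor y : Rabs y <= 1 ->
  Rabs (sin y - y) <= Rabs y ^ 3 /\ Rabs (cos y - 1 + y ^ 2 / 2) <= Rabs y ^ 4.
Proof.
  assert (S1 : forall y, Rabs y <= 1 -> Rabs (sin y) <= 1 * Rabs y ^ 1).
  { apply (bound_from_derivative sin cos).
    - intros x. auto_derive; auto. ring.
    - apply sin_0.
    - intros x _. simpl. generalize (COS_bound x). intros B. rewrite Rmult_1_r. apply Rabs_le. lra.
    - lra. }
  assert (C2 : forall y, Rabs y <= 1 -> Rabs (cos y - 1) <= 1 * Rabs y ^ 2).
  { apply (bound_from_derivative (fun y => cos y - 1) (fun y => - sin y)).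
    - intros x. auto_derive; auto. ring.
    - rewrite cos_0. lra.
    - intros x Hx. rewrite Rabs_Ropp. auto.
    - lra. }
  assert (S3 : forall y, Rabs y <= 1 -> Rabs (sin y - y) <= 1 * Rabs y ^ 3).
  { apply (bound_from_derivative (fun y => sin y - y) (fun y => cos y - 1)).
    - intros x. auto_derive; auto. ring.
    - rewrite sin_0. lra.
    - exact C2.
    - lra. }
  assert (C4 : forall y, Rabs y <= 1 -> Rabs (cos y - 1 + y ^ 2 / 2) <= 1 * Rabs y ^ 4).
  { apply (bound_from_derivative (fun y => cos y - 1 + y ^ 2 / 2) (fun y => - (sin y - y))).
    - intros x. auto_derive; auto. field.
    - rewrite cos_0. lra.
    - intros x Hx. rewrite Rabs_Ropp. auto.
    - lra. }
  intros H. generalize (S3 y H) (C4 y H). lra.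
Qed.

Lemma Cexp_plus u v : Cexp (u + v) = (Cexp u * Cexp v)%C.
Proof.
  unfold Cexp. rewrite re_plus, im_plus, exp_plus, cos_plus, sin_plus.
  unfold Cmult; simpl. f_equal; ring.
Qed.

Lemma Cexp_0 : Cexp 0 = 1.
Proof.
  unfold Cexp. simpl. rewrite exp_0, cos_0, sin_0. unfold RtoC. f_equal; ring.
Qed.

Lemma im_le_Cmod (c : C) : Rabs (Im c) <= Cmod c.
Proof. apply Rle_trans with (2 := Rmax_Cmod c). apply Rmax_r. Qed.

Lemma Cmod_le_re_im (c : C) : Cmod c <= Rabs (Re c) + Rabs (Im c).
Proof.
  replace c with (RtoC (Re c) + Ci * RtoC (Im c))%C at 1.
  eapply Rle_trans; [apply Cmod_triangle|]. rewrite Cmod_mult, Cmod_Ci, !Cmod_R. lra.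
  destruct c as [x y]. unfold Cplus, Cmult, RtoC; simpl. f_equal; ring.
Qed.

Lemma Cexp_taylor2 : bigO 3 (fun w => Cexp w - 1 - w - w ^ 2 / 2)%C.
Proof.
  exists 20, 1. split. lra. split. lra. intros w Hw.
  assert (Hx := re_le_Cmod w). assert (Hy := im_le_Cmod w).
  assert (T1 := exp_taylor2 (Re w) ltac:(lra)).
  destruct (cos_sin_taylor (Im w) ltac:(lra)) as [T3 T2].
  set (m := Cmod w) in *. assert (Hm : 0 <= m) by apply Cmod_ge_0.
  destruct w as [x y]. simpl Re in *. simpl Im in *.
  set (r1 := exp x - 1 - x - x ^ 2 / 2) in *. set (r2 := cos y - 1 + y ^ 2 / 2) in *.
  set (r3 := sin y - y) in *.
  assert (P2 : 0 <= m ^ 2) by (apply pow_le; auto).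
  assert (P3 : 0 <= m ^ 3) by (apply pow_le; auto).
  assert (P4 : m ^ 4 <= m ^ 3).
  { replace (m ^ 4) with (m * m ^ 3) by ring. rewrite <- (Rmult_1_l (m ^ 3)) at 2.
    apply Rmult_le_compat_r; lra. }
  assert (X3 : Rabs x ^ 3 <= m ^ 3) by (apply pow_incr; split; [apply Rabs_pos|auto]).
  assert (Y3 : Rabs y ^ 3 <= m ^ 3) by (apply pow_incr; split; [apply Rabs_pos|auto]).
  assert (Y4 : Rabs y ^ 4 <= m ^ 4) by (apply pow_incr; split; [apply Rabs_pos|auto]).
  assert (Mx : forall a b A B, Rabs a <= A -> Rabs b <= B -> Rabs (a * b) <= A * B).
  { intros a b A B HA HB. rewrite Rabs_mult. apply Rmult_le_compat; auto using Rabs_pos. }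
  assert (Ex : Rabs (exp x) <= 6).
  { replace (exp x) with (1 + x + x ^ 2 / 2 + r1) by (unfold r1; ring).
    assert (B1 : Rabs x <= 1) by lra. apply Rabs_le_between in B1.
    assert (B2 : Rabs r1 <= 3).
    { eapply Rle_trans; [exact T1|]. assert (m ^ 3 <= 1 ^ 3) by (apply pow_incr; lra). lra. }
    apply Rabs_le_between in B2. apply Rabs_le. nra. }
  assert (B1 : Rabs x <= 1) by lra. assert (B2 : Rabs y <= 1) by lra.
  assert (B2' := proj1 (Rabs_le_between y 1) B2).
  eapply Rle_trans; [apply Cmod_le_re_im|].
  assert (Er : Re (Cexp (x, y) - 1 - (x, y) - (x, y) ^ 2 / 2)%C =
    exp x * r2 + r1 * (1 - y ^ 2 / 2) - x * (y * y) / 2 - (x * x) * (y * y) / 4).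
  { unfold r1, r2, Cexp, Cminus, Cplus, Copp, Cdiv, Cmult, Cinv, RtoC; simpl. field. }
  assert (Ei : Im (Cexp (x, y) - 1 - (x, y) - (x, y) ^ 2 / 2)%C =
    exp x * r3 + r1 * y + (x * x) * y / 2).
  { unfold r1, r3, Cexp, Cminus, Cplus, Copp, Cdiv, Cmult, Cinv, RtoC; simpl. field. }
  rewrite Er, Ei.
  assert (Q1 : Rabs (exp x * r2) <= 6 * m ^ 3) by (apply Mx; lra).
  assert (Q2 : Rabs (r1 * (1 - y ^ 2 / 2)) <= 3 * m ^ 3 * 1).
  { apply Mx. lra. apply Rabs_le. nra. }
  assert (Q3 : Rabs (x * (y * y)) <= m * (m * m)) by (repeat apply Mx; auto).
  assert (Q4 : Rabs (x * x * (y * y)) <= m * m * (m * m)) by (repeat apply Mx; auto).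
  assert (Q5 : Rabs (exp x * r3) <= 6 * m ^ 3) by (apply Mx; lra).
  assert (Q6 : Rabs (r1 * y) <= 3 * m ^ 3 * 1) by (apply Mx; lra).
  assert (Q7 : Rabs (x * x * y) <= m * m * m) by (repeat apply Mx; auto).
  replace (m * (m * m)) with (m ^ 3) in Q3 by ring.
  replace (m * m * (m * m)) with (m ^ 4) in Q4 by ring.
  replace (m * m * m) with (m ^ 3) in Q7 by ring.
  apply Rabs_le_between in Q1, Q2, Q3, Q4, Q5, Q6, Q7.
  assert (R1 : Rabs (exp x * r2 + r1 * (1 - y ^ 2 / 2) - x * (y * y) / 2 - x * x * (y * y) / 4) <= 10 * m ^ 3)
    by (apply Rabs_le; lra).
  assert (R2 : Rabs (exp x * r3 + r1 * y + x * x * y / 2) <= 10 * m ^ 3) by (apply Rabs_le; lra).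
  lra.
Qed.

Lemma Cexp_taylor1 : bigO 2 (fun w => Cexp w - 1 - w)%C.
Proof.
  apply (bigO_ext 2 (fun w => (Cexp w - 1 - w - w ^ 2 / 2) + (/ 2) * w ^ 2)%C).
  intros z. field.
  apply bigO_plus. apply (bigO_weaken 2 3); auto. apply Cexp_taylor2. apply bigO_monomial.
Qed.

Lemma qdiff_Cexp z : qdiff Cexp z (Cexp z).
Proof.
  destruct Cexp_taylor1 as (K & e & HK & He & H).
  exists (Cmod (Cexp z) * K), e. split. apply Rmult_le_pos; auto. apply Cmod_ge_0.
  split; auto. intros w Hw. specialize (H _ Hw).
  replace (Cexp w) with (Cexp z * Cexp (w - z))%C.
  2:{ rewrite <- Cexp_plus. f_equal. ring. }
  replace (Cexp z * Cexp (w - z) - Cexp z - Cexp z * (w - z))%C with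
    (Cexp z * (Cexp (w - z) - 1 - (w - z)))%C by ring.
  rewrite Cmod_mult, Rmult_assoc. apply Rmult_le_compat_l; auto. apply Cmod_ge_0.
Qed.

Lemma cis_Cexp t : cis t = Cexp (Ci * t).
Proof.
  unfold Cexp, cis. replace (Re (Ci * t)) with 0 by (simpl; ring).
  replace (Im (Ci * t)) with t by (simpl; ring). rewrite exp_0. f_equal; ring.
Qed.

(** * Means over circles *)

Lemma is_derive_quadratic (phi : R -> R) (t l K delta : R) : 0 <= K -> 0 < delta ->
  (forall s, Rabs (s - t) < delta -> Rabs (phi s - phi t - l * (s - t)) <= K * (s - t) ^ 2) ->
  is_derive phi t l.
Proof.
  intros HK Hd H. apply is_derive_Reals. intros eps Heps.
  destruct (small_factor (eps / 2) K) as (r & Hr & Hr'); try lra.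
  assert (Hm : 0 < Rmin delta r) by (apply Rmin_pos; auto).
  exists (mkposreal _ Hm). intros h Hh0 Hh. simpl in Hh.
  specialize (H (t + h)). replace (t + h - t) with h in H by ring.
  specialize (H (Rlt_le_trans _ _ _ Hh (Rmin_l _ _))).
  replace ((phi (t + h) - phi t) / h - l) with ((phi (t + h) - phi t - l * h) / h) by (field; auto).
  assert (Hp : 0 < Rabs h) by (apply Rabs_pos_lt; auto).
  unfold Rdiv. rewrite Rabs_mult, Rabs_inv.
  apply Rmult_lt_reg_r with (Rabs h); auto. rewrite Rmult_assoc, Rinv_l, Rmult_1_r by lra.
  eapply Rle_lt_trans; [exact H|].
  replace (h ^ 2) with (Rabs h * Rabs h) by (rewrite <- Rabs_mult, Rabs_pos_eq; [ring|nra]).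
  rewrite <- Rmult_assoc. apply Rmult_lt_compat_r; auto.
  apply Rle_lt_trans with (K * r). apply Rmult_le_compat_l; auto.
  left. exact (Rlt_le_trans _ _ _ Hh (Rmin_r _ _)). lra.
Qed.

Lemma re_minus (a b : C) : Re (a - b) = Re a - Re b.
Proof. unfold Cminus. rewrite re_plus, re_opp. ring. Qed.

Lemma im_minus (a b : C) : Im (a - b) = Im a - Im b.
Proof. unfold Cminus. rewrite im_plus, im_opp. ring. Qed.

Lemma qdiff_real (H : C -> C) (t : R) (d : C) : qdiff H (RtoC t) d ->
  is_derive (fun s : R => Re (H (RtoC s))) t (Re d) /\
  is_derive (fun s : R => Im (H (RtoC s))) t (Im d).
Proof.
  intros (K & e & HK & He & HT).
  assert (B : forall s : R, Rabs (s - t) < e ->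
     Cmod (H (RtoC s) - H (RtoC t) - d * RtoC (s - t)) <= K * (s - t) ^ 2).
  { intros s Hs. specialize (HT (RtoC s)). rewrite <- RtoC_minus, Cmod_R in HT.
    rewrite pow2_abs in HT. auto. }
  split.
  - apply (is_derive_quadratic _ t (Re d) K e HK He). intros s Hs.
    apply Rle_trans with (2 := B s Hs).
    eapply Rle_trans; [|apply re_le_Cmod]. rewrite !re_minus, re_scal_r. right; reflexivity.
  - apply (is_derive_quadratic _ t (Im d) K e HK He). intros s Hs.
    apply Rle_trans with (2 := B s Hs).
    eapply Rle_trans; [|apply im_le_Cmod]. rewrite !im_minus, im_scal_r. right; reflexivity.
Qed.

Lemma qdiff_cis t : qdiff (fun w => Cexp (Ci * w)) (RtoC t) (Ci * cis t)%C.
Proof.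
  replace (Ci * cis t)%C with (cis t * (0 * RtoC t + Ci * 1))%C by ring.
  rewrite cis_Cexp.
  apply (qdiff_comp Cexp (fun w => Ci * w)%C).
  apply qdiff_mult. apply qdiff_const. apply qdiff_id. apply qdiff_Cexp.
Qed.

Definition circle_int (h : C -> C) (r : R) : R :=
  RInt (fun t => Re (h (r * cis t)%C)) 0 (2 * PI).

Lemma qdiff_angular h z d r t : z = (RtoC r * cis t)%C -> qdiff h z d ->
  is_derive (fun t => Re (h (r * cis t)%C)) t (Re (d * (Ci * z))) /\
  is_derive (fun t => Im (h (r * cis t)%C)) t (Im (d * (Ci * z))).
Proof.
  intros Ez Q.
  assert (Q2 : qdiff (fun w => h (RtoC r * Cexp (Ci * w))%C) (RtoC t) (d * (Ci * z))%C).
  { assert (Qp := qdiff_mult _ _ _ _ _ (qdiff_const (RtoC r) (RtoC t)) (qdiff_cis t)).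
    cbv beta in Qp. rewrite <- cis_Cexp in Qp.
    replace (0 * cis t + RtoC r * (Ci * cis t))%C with (Ci * z)%C in Qp by (rewrite Ez; ring).
    refine (qdiff_comp h (fun w => RtoC r * Cexp (Ci * w))%C _ _ _ Qp _).
    rewrite <- cis_Cexp, <- Ez. exact Q. }
  destruct (qdiff_real _ _ _ Q2) as [D1 D2].
  split; [revert D1|revert D2]; apply is_derive_ext; intros s; rewrite <- cis_Cexp; reflexivity.
Qed.

Lemma qdiff_radial h z d r t : z = (RtoC r * cis t)%C -> qdiff h z d ->
  is_derive (fun r => Re (h (RtoC r * cis t)%C)) r (Re (d * cis t)).
Proof.
  intros Ez Q.
  assert (Q2 : qdiff (fun w => h (w * cis t)%C) (RtoC r) (d * cis t)%C).
  { assert (Qp := qdiff_mult _ _ _ _ _ (qdiff_id (RtoC r)) (qdiff_const (cis t) (RtoC r))).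
    cbv beta in Qp. replace (1 * cis t + RtoC r * 0)%C with (cis t) in Qp by ring.
    refine (qdiff_comp h (fun w => w * cis t)%C _ _ _ Qp _).
    rewrite <- Ez. exact Q. }
  exact (proj1 (qdiff_real _ _ _ Q2)).
Qed.

(** The joint continuity under which the circle means can be differentiated in the
    radius under the integral sign. *)
Lemma continuity_2d_polar k (r0 t0 : R) d : qdiff k (RtoC r0 * cis t0)%C d ->
  continuity_2d_pt (fun r t => Re (k (RtoC r * cis t)%C)) r0 t0.
Proof.
  intros Q eps. destruct (qdiff_lipschitz _ _ _ Q) as (L & e & HL & He & H).
  destruct (qdiff_lipschitz _ _ _ (qdiff_cis t0)) as (L2 & e2 & HL2 & He2 & H2).
  set (eta := Rmin (e / 2) (eps / (L + 1) / 2)).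
  assert (Heps := cond_pos eps).
  assert (Heta : 0 < eta) by (apply Rmin_pos; repeat apply Rdiv_lt_0_compat; lra).
  destruct (small_factor (eta / 2) (Rabs r0 * L2)) as (s & Hs & Hs'). lra.
  apply Rmult_le_pos; auto. apply Rabs_pos.
  assert (Hd : 0 < Rmin (eta / 2) (Rmin s e2)) by (repeat apply Rmin_pos; lra).
  exists (mkposreal _ Hd). intros r t Hr Ht. simpl in Hr, Ht.
  assert (R1 := Rlt_le_trans _ _ _ Hr (Rmin_l _ _)).
  assert (T1 := Rlt_le_trans _ _ _ (Rlt_le_trans _ _ _ Ht (Rmin_r _ _)) (Rmin_l _ _)).
  assert (T2 := Rlt_le_trans _ _ _ (Rlt_le_trans _ _ _ Ht (Rmin_r _ _)) (Rmin_r _ _)).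
  specialize (H2 (RtoC t)). rewrite <- RtoC_minus, Cmod_R, <- !cis_Cexp in H2. specialize (H2 T2).
  assert (W : Cmod (RtoC r * cis t - RtoC r0 * cis t0) < eta).
  { replace (RtoC r * cis t - RtoC r0 * cis t0)%C with
      (RtoC (r - r0) * cis t + RtoC r0 * (cis t - cis t0))%C by (rewrite RtoC_minus; ring).
    eapply Rle_lt_trans; [apply Cmod_triangle|]. rewrite !Cmod_mult, !Cmod_R, Cmod_cis.
    assert (Rabs r0 * Cmod (cis t - cis t0) <= eta / 2).
    { eapply Rle_trans. apply Rmult_le_compat_l. apply Rabs_pos. exact H2.
      rewrite <- Rmult_assoc. apply Rle_trans with (2 := Hs').
      apply Rmult_le_compat_l. apply Rmult_le_pos; auto. apply Rabs_pos. lra. }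
    lra. }
  assert (W1 := Rlt_le_trans _ _ _ W (Rmin_l _ _)). assert (W2 := Rlt_le_trans _ _ _ W (Rmin_r _ _)).
  rewrite <- re_minus. eapply Rle_lt_trans; [apply re_le_Cmod|].
  eapply Rle_lt_trans; [apply H; lra|].
  apply Rle_lt_trans with ((L + 1) * (eps / (L + 1) / 2)).
  apply Rmult_le_compat; try lra. apply Cmod_ge_0.
  replace ((L + 1) * (eps / (L + 1) / 2)) with (eps / 2) by (field; lra). lra.
Qed.

Definition in_punctured (z : C) : Prop := 0 < Cmod z < 1.

(** The second derivative guarantees that [h'] is continuous. *)
Definition holo2 (h h' : C -> C) : Prop :=
  forall z, in_punctured z -> qdiff h z (h' z) /\ exists d, qdiff h' z d.

Lemma in_punctured_polar r t : 0 < r < 1 -> in_punctured (RtoC r * cis t)%C.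
Proof.
  intros Hr. unfold in_punctured. rewrite Cmod_mult, Cmod_R, Cmod_cis, Rabs_pos_eq; lra.
Qed.

Lemma continuous_polar_qdiff h h' r : holo2 h h' -> 0 < r < 1 ->
  forall t, continuous (fun t => Re (h (RtoC r * cis t)%C)) t.
Proof.
  intros Hh Hr t. apply (ex_derive_continuous (fun t => Re (h (RtoC r * cis t)%C))).
  destruct (Hh _ (in_punctured_polar r t Hr)) as [Q _].
  eexists. exact (proj1 (qdiff_angular _ _ _ r t eq_refl Q)).
Qed.

(** With [z = r e^{it}], [d/dr h = h'(z) e^{it}] and [d/dt h = i z h'(z)] differ by the
    factor [i r], so that the radial derivative of the mean is the integral over a
    period of a derivative in [t]. *)
Lemma circle_int_const h h' : holo2 h h' -> forall r1 r2, 0 < r1 -> r1 < r2 -> r2 < 1 ->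
  circle_int h r1 = circle_int h r2.
Proof.
  intros Hh r1 r2 H1 H12 H2.
  apply (eq_is_derive (circle_int h)); auto. intros r Hr.
  assert (Hr1 : 0 < r < 1) by lra.
  assert (LR : locally r (fun r => 0 < r < 1)).
  { assert (Hd : 0 < Rmin r (1 - r)) by (apply Rmin_pos; lra).
    exists (mkposreal _ Hd). intros y Hy. apply (Rabs_def2 (y - r)) in Hy. simpl in Hy.
    generalize (Rmin_l r (1 - r)) (Rmin_r r (1 - r)). lra. }
  assert (D : forall r t, 0 < r < 1 ->
    is_derive (fun r => Re (h (RtoC r * cis t)%C)) r (Re (h' (RtoC r * cis t)%C * cis t))).
  { intros s t Hs. apply (qdiff_radial h _ _ s t eq_refl). apply Hh, in_punctured_polar, Hs. }
  set (k := fun z => (h' z * z)%C).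
  assert (Dk : forall r t, 0 < r < 1 ->
    Derive (fun r => Re (h (RtoC r * cis t)%C)) r = / r * Re (k (RtoC r * cis t)%C)).
  { intros s t Hs. transitivity (Re (h' (RtoC s * cis t) * cis t)%C).
    apply is_derive_unique, D; auto. unfold k.
    replace (h' (RtoC s * cis t) * (RtoC s * cis t))%C with (RtoC s * (h' (RtoC s * cis t) * cis t))%C by ring.
    rewrite re_scal_l. field. lra. }
  assert (Qk : forall r t, 0 < r < 1 -> exists d, qdiff k (RtoC r * cis t)%C d).
  { intros s t Hs. destruct (Hh _ (in_punctured_polar s t Hs)) as [_ [d Q]].
    eexists. apply (qdiff_mult h' (fun z => z)). exact Q. apply qdiff_id. }
  assert (Z : RInt (fun t => Derive (fun r => Re (h (RtoC r * cis t)%C)) r) 0 (2 * PI) = 0).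
  { rewrite (RInt_ext _ (fun t => / r * Re (k (RtoC r * cis t)%C))).
    2:{ intros t _. apply Dk; auto. }
    transitivity (/ r * RInt (fun t => Re (k (RtoC r * cis t)%C)) 0 (2 * PI)).
    { apply (RInt_scal (fun t => Re (k (RtoC r * cis t)%C)) 0 (2 * PI) (/ r)). apply (ex_RInt_continuous (fun t => Re (k (RtoC r * cis t)%C))). intros t _.
      destruct (Qk r t Hr1) as [d Q].
      apply (ex_derive_continuous (fun t => Re (k (RtoC r * cis t)%C))).
      eexists. exact (proj1 (qdiff_angular _ _ _ r t eq_refl Q)). }
    rewrite (is_RInt_unique _ _ _ (Im (h (RtoC r * cis (2 * PI))%C) - Im (h (RtoC r * cis 0)%C))).
    { unfold cis. rewrite cos_2PI, sin_2PI, cos_0, sin_0.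
      change (/ r * (Im (h (RtoC r * (1, 0))%C) - Im (h (RtoC r * (1, 0))%C)) = 0). ring. }
      apply (is_RInt_derive (fun t => Im (h (RtoC r * cis t)%C)) (fun t => Re (k (RtoC r * cis t)%C))).
      + intros t _. destruct (Hh _ (in_punctured_polar r t Hr1)) as [Q _].
        destruct (qdiff_angular _ _ _ r t eq_refl Q) as [_ D2].
        replace (Re (k (RtoC r * cis t)%C)) with (Im (h' (r * cis t) * (Ci * (r * cis t)))%C).
        exact D2. unfold k.
        replace (h' (r * cis t) * (Ci * (r * cis t)))%C with (h' (r * cis t) * (r * cis t) * Ci)%C by ring.
        generalize (h' (RtoC r * cis t) * (RtoC r * cis t))%C. intros [x y]. simpl. ring.
      + intros t _. destruct (Qk r t Hr1) as [d Q].
        apply (ex_derive_continuous (fun t => Re (k (RtoC r * cis t)%C))).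
        eexists. exact (proj1 (qdiff_angular _ _ _ r t eq_refl Q)). }
  replace (@zero R_NormedModule) with (RInt (fun t => Derive (fun r => Re (h (RtoC r * cis t)%C)) r) 0 (2 * PI)).
  apply (is_derive_RInt_param (fun r t => Re (h (RtoC r * cis t)%C))).
  - revert LR. apply filter_imp. intros s Hs t _. eexists. apply D; auto.
  - intros t _.
    apply (continuity_2d_pt_ext_loc (fun s t => / s * Re (k (RtoC s * cis t)%C))).
    { destruct LR as [d Hd]. exists d. intros u v Hu _. symmetry. apply Dk. apply Hd. exact Hu. }
    apply continuity_2d_pt_mult.
    + apply (continuity_1d_2d_pt_comp Rinv (fun u _ => u)). apply continuity_pt_inv.
      apply continuity_pt_id. lra. apply continuity_2d_pt_id1.
    + destruct (Qk r t Hr1) as [d Q]. apply (continuity_2d_polar k r t d Q).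
  - revert LR. apply filter_imp. intros s Hs. apply (ex_RInt_continuous (fun t => Re (h (RtoC s * cis t)%C))).
    intros t _. apply (continuous_polar_qdiff h h'); auto.
Qed.

(** The integral does not depend on the radius, and it tends to 0 with it. *)
Lemma circle_int_zero h h' : holo2 h h' ->
  (exists K delta, 0 < delta /\ forall z, 0 < Cmod z < delta -> Cmod (h z) <= K * Cmod z) ->
  forall r, 0 < r < 1 -> circle_int h r = 0.
Proof.
  intros Hh (K & del & Hd & HK) r Hr.
  assert (HK' : forall z, 0 < Cmod z < del -> Cmod (h z) <= Rabs K * Cmod z).
  { intros z Hz. eapply Rle_trans; [apply HK; auto|]. apply Rmult_le_compat_r. lra. apply Rle_abs. }
  assert (HPI := PI_RGT_0).
  assert (S : forall eps, 0 < eps -> Rabs (circle_int h r) <= eps).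
  { intros eps Heps.
    destruct (small_factor eps (2 * PI * Rabs K) Heps) as (s1 & S1 & S1').
    apply Rmult_le_pos; [lra|apply Rabs_pos].
    destruct (small3 s1 (r / 2) (del / 2)) as (s & Sp & Sa & Sb & Sc); try lra.
    rewrite <- (circle_int_const h h' Hh s r) by lra.
    unfold circle_int.
    eapply Rle_trans.
    apply (abs_RInt_le_const (fun t => Re (h (RtoC s * cis t)%C)) 0 (2 * PI) (Rabs K * s)). lra.
    - apply (ex_RInt_continuous (fun t => Re (h (RtoC s * cis t)%C))).
      intros t _. apply (continuous_polar_qdiff h h'); auto. lra.
    - intros t _. eapply Rle_trans; [apply re_le_Cmod|].
      assert (E : Cmod (RtoC s * cis t) = s) by (rewrite Cmod_mult, Cmod_R, Cmod_cis, Rabs_pos_eq; lra).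
      rewrite <- E at 2. apply HK'. rewrite E. lra.
    - apply Rle_trans with (2 := S1'). rewrite Rminus_0_r, <- Rmult_assoc.
      apply Rmult_le_compat_l; auto. apply Rmult_le_pos; [lra|apply Rabs_pos]. }
  destruct (Req_dec (circle_int h r) 0) as [E|E]; auto.
  assert (P := Rabs_pos_lt _ E). specialize (S (Rabs (circle_int h r) / 2) ltac:(lra)). lra.
Qed.

Lemma cis_int (kappa : C) (nu : R) : nu <> 0 -> cis (nu * (2 * PI)) = 1 ->
  is_RInt (fun t => Re (kappa * cis (nu * t))%C) 0 (2 * PI) 0.
Proof.
  intros Hnu E.
  assert (Q : forall t, is_derive (fun t => Im (kappa * cis (nu * t)%R)%C / nu) t (Re (kappa * cis (nu * t)%R)%C)).
  { intros t. destruct kappa as [x y]. unfold cis, Cmult; simpl. auto_derive; auto. field; auto. }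
  replace 0 with (minus (Im (kappa * cis (nu * (2 * PI))%R)%C / nu) (Im (kappa * cis (nu * 0)%R)%C / nu)) at 2.
  - apply (is_RInt_derive (fun t => Im (kappa * cis (nu * t)%R)%C / nu)).
    + intros t _. apply Q.
    + intros t _. apply (ex_derive_continuous (fun t => Re (kappa * cis (nu * t)%R)%C)).
      destruct kappa as [x y]. unfold cis, Cmult; simpl. auto_derive; auto.
  - rewrite E, Rmult_0_r. unfold cis. rewrite cos_0, sin_0.
    change (Im (kappa * RtoC 1)%C / nu - Im (kappa * RtoC 1)%C / nu = 0). ring.
Qed.

(** * The coefficients of a bounded function *)

Definition holo (h : C -> C) : Prop := exists h', holo2 h h'.

Lemma holo_const c : holo (fun _ => c).
Proof.
  exists (fun _ => RtoC 0). intros z _. split. apply qdiff_const. exists (RtoC 0). apply qdiff_const.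
Qed.

Lemma holo_id : holo (fun z => z).
Proof.
  exists (fun _ => RtoC 1). intros z _. split. apply qdiff_id. exists (RtoC 0). apply qdiff_const.
Qed.

Lemma holo_plus h1 h2 : holo h1 -> holo h2 -> holo (fun z => h1 z + h2 z)%C.
Proof.
  intros [h1' H1] [h2' H2]. exists (fun z => h1' z + h2' z)%C. intros z Hz.
  destruct (H1 z Hz) as [Q1 [d1 D1]]. destruct (H2 z Hz) as [Q2 [d2 D2]].
  split. apply qdiff_plus; auto. eexists. apply qdiff_plus; eauto.
Qed.

Lemma holo_mult h1 h2 : holo h1 -> holo h2 -> holo (fun z => h1 z * h2 z)%C.
Proof.
  intros [h1' H1] [h2' H2]. exists (fun z => h1' z * h2 z + h1 z * h2' z)%C. intros z Hz.
  destruct (H1 z Hz) as [Q1 [d1 D1]]. destruct (H2 z Hz) as [Q2 [d2 D2]].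
  split. apply qdiff_mult; auto.
  eexists. apply qdiff_plus; eapply qdiff_mult; eauto.
Qed.

Lemma holo_inv : holo (fun z => / z)%C.
Proof.
  exists (fun z => - (1) * (/ z * / z))%C. intros z [Hz _].
  assert (Hz0 : z <> 0) by (apply Cmod_gt_0; auto).
  split.
  - replace (- (1) * (/ z * / z))%C with (- / (z * z))%C by (field; auto). apply qdiff_inv; auto.
  - eexists. apply (qdiff_mult (fun _ => - (1))%C). apply qdiff_const.
    apply qdiff_mult; apply qdiff_inv; auto.
Qed.

Lemma holo_pow h n : holo h -> holo (fun z => h z ^ n)%C.
Proof.
  intros H. induction n as [|n IH]. apply (holo_const 1). exact (holo_mult _ _ H IH).
Qed.

Lemma holo_scal c h : holo h -> holo (fun z => c * h z)%C.
Proof. intros H. apply (holo_mult (fun _ => c)); auto. apply holo_const. Qed.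

Lemma holo_ext h1 h2 : (forall z, h1 z = h2 z) -> holo h1 -> holo h2.
Proof.
  intros E [h' H]. exists h'. intros z Hz. destruct (H z Hz) as [Q D]. split; auto.
  apply (qdiff_ext_loc h1); auto. exists 1. split. lra. auto.
Qed.

Lemma cis_neg t : cis (- t) = (/ cis t)%C.
Proof.
  assert (E : (cis (- t) * cis t)%C = 1).
  { rewrite <- cis_plus. replace (- t + t) with 0 by ring. unfold cis. rewrite cos_0, sin_0. reflexivity. }
  assert (cis t <> 0). { apply Cmod_gt_0. rewrite Cmod_cis. lra. }
  replace (cis (- t)) with ((cis (- t) * cis t) / cis t)%C by (field; auto).
  rewrite E. field. auto.
Qed.

Lemma cis_conj t : Cconj (cis t) = (/ cis t)%C.
Proof. rewrite <- cis_neg. unfold cis, Cconj; simpl. rewrite cos_neg, sin_neg. reflexivity. Qed.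

Lemma cis_period (n : nat) : cis (INR n * (2 * PI)) = 1.
Proof. rewrite <- cis_pow. unfold cis. rewrite cos_2PI, sin_2PI. apply Cpow_1_l. Qed.

Lemma cis_pow_int (kappa : C) n : (0 < n)%nat ->
  is_RInt (fun t => Re (kappa * cis t ^ n)%C) 0 (2 * PI) 0.
Proof.
  intros Hn. apply (is_RInt_ext (fun t => Re (kappa * cis (INR n * t))%C)).
  - intros t _. rewrite cis_pow. reflexivity.
  - apply cis_int. apply not_0_INR; lia. apply cis_period.
Qed.

Lemma cis_inv_pow_int (kappa : C) n : (0 < n)%nat ->
  is_RInt (fun t => Re (kappa * (/ cis t) ^ n)%C) 0 (2 * PI) 0.
Proof.
  intros Hn. apply (is_RInt_ext (fun t => Re (kappa * cis (- INR n * t))%C)).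
  - intros t _. rewrite <- cis_neg, cis_pow. do 3 f_equal. ring.
  - apply cis_int. assert (INR n <> 0) by (apply not_0_INR; lia). lra.
    rewrite Ropp_mult_distr_l_reverse, cis_neg, cis_period. field.
Qed.

Lemma is_RInt_plus_zero (f g : R -> R) (a b I : R) :
  is_RInt f a b I -> is_RInt g a b 0 -> is_RInt (fun t => f t + g t) a b I.
Proof.
  intros Hf Hg. rewrite <- (Rplus_0_r I). exact (is_RInt_plus f g a b I 0 Hf Hg).
Qed.

(** Let [p e = p0 + p1 e + p2 e^2]. Since [Cmod (omega (r e)) <= 1], on the unit circle
    [Re (omega (r e) * conj e) * Cmod (p e) ^ 2 <= Cmod (p e) ^ 2]; this is the
    inequality between the means of both sides. On [Cmod z = r] the weight
    [conj e * Cmod (p e) ^ 2] is the Laurent polynomial [Q z / z^3] with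
    [z = r e]. Its product with the part of [omega] beyond the third order is
    holomorphic and small at 0, hence has mean zero by [circle_int_zero], and what
    remains is an explicit trigonometric polynomial.
    The conjugates are separate variables so that the identities can be decided by
    [field]. *)
Lemma bounded_coefficients_scaled omega (w1 w2 w3 : C) (r : R) (p0 p1 p2 q0 q1 q2 : C) :
  0 < r < 1 -> holo omega -> (forall z, Cmod z < 1 -> Cmod (omega z) <= 1) ->
  bigO 4 (fun z => omega z - (w1 * z + w2 * z ^ 2 + w3 * z ^ 3))%C ->
  q0 = Cconj p0 -> q1 = Cconj p1 -> q2 = Cconj p2 ->
  Re (w1 * r * (p0 * q0 + p1 * q1 + p2 * q2) + w2 * r ^ 2 * (p0 * q1 + p1 * q2)
      + w3 * r ^ 3 * (p0 * q2)) <= Re (p0 * q0 + p1 * q1 + p2 * q2).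
Proof.
  intros Hr Hom Hb Hexp Eq0 Eq1 Eq2.
  set (N := (p0 * q0 + p1 * q1 + p2 * q2)%C). set (S := (p0 * q1 + p1 * q2)%C).
  set (S' := (p1 * q0 + p2 * q1)%C). set (B := (p0 * q2)%C). set (B' := (p2 * q0)%C).
  set (rho := RtoC r).
  assert (Hrho : rho <> 0). { unfold rho. intros X. apply RtoC_inj in X. lra. }
  set (P := fun z => (w1 * z + w2 * z ^ 2 + w3 * z ^ 3)%C).
  set (Q := fun z => (B * rho ^ 3 + S * rho ^ 2 * z + N * rho * z ^ 2 + S' * z ^ 3 + B' / rho * z ^ 4)%C).
  set (h := fun z => ((omega z - P z) * (Q z * (/ z) ^ 3))%C).
  assert (Hh : holo h).
  { unfold h. apply holo_mult.
    - apply (holo_ext (fun z => omega z + (- (1)) * P z)%C). intros; ring.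
      apply holo_plus; auto. apply holo_scal. unfold P.
      repeat apply holo_plus; repeat apply holo_scal; try apply holo_id;
        apply holo_pow; apply holo_id.
    - apply holo_mult; [|apply holo_pow; apply holo_inv]. unfold Q.
      repeat apply holo_plus; try apply holo_const; repeat apply holo_scal; try apply holo_id;
        apply holo_pow; apply holo_id. }
  assert (HQ : bigO 0 Q).
  { unfold Q. repeat apply bigO_plus. apply bigO_const.
    apply (bigO_ext 0 (fun z => S * rho ^ 2 * z ^ 1)%C). intros; ring.
    all: eapply bigO_weaken; [|apply bigO_monomial]; lia. }
  assert (Hsmall : exists K delta, 0 < delta /\ forall z, 0 < Cmod z < delta -> Cmod (h z) <= K * Cmod z).
  { destruct (bigO_mult 4 0 _ _ Hexp HQ) as (K & del & HK & Hd & H).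
    exists K, del. split; auto. intros z [Hz1 Hz2]. specialize (H z Hz2).
    assert (Hz0 : z <> 0) by (apply Cmod_gt_0; auto).
    replace (h z) with ((omega z - (w1 * z + w2 * z ^ 2 + w3 * z ^ 3)) * Q z * (/ z) ^ 3)%C
      by (unfold h, P; ring).
    rewrite Cmod_mult, Cmod_pow, Cmod_inv by auto.
    apply Rmult_le_reg_r with (Cmod z ^ 3). apply pow_lt; auto.
    rewrite Rmult_assoc, <- Rpow_mult_distr, Rinv_l, pow1, Rmult_1_r by lra.
    eapply Rle_trans; [exact H|]. right; simpl; ring. }
  destruct Hh as [h' Hh].
  assert (Z := circle_int_zero h h' Hh Hsmall r Hr).
  set (c1 := (w1 * rho)%C). set (c2 := (w2 * rho ^ 2)%C). set (c3 := (w3 * rho ^ 3)%C).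
  set (cst := (N - (c1 * N + c2 * S + c3 * B))%C).
  (* the real part of |p e|^2 - P z * Q z / z^3 for z = r e, sorted by powers of e *)
  set (Theta := fun t => Re cst + Re ((B - c1 * B) * (/ cis t) ^ 2)%C + Re ((S - c1 * S - c2 * B) * (/ cis t) ^ 1)%C
     + Re ((S' - c1 * S' - c2 * N - c3 * S) * cis t ^ 1)%C
     + Re ((B' - c1 * B' - c2 * S' - c3 * N) * cis t ^ 2)%C
     + Re ((- (c2 * B' + c3 * S')) * cis t ^ 3)%C + Re ((- (c3 * B')) * cis t ^ 4)%C).
  assert (HPI := PI_RGT_0).
  assert (IT : is_RInt Theta 0 (2 * PI) (2 * PI * Re cst)).
  { unfold Theta.
    refine (is_RInt_plus_zero _ _ _ _ _ _ (cis_pow_int (- (c3 * B'))%C 4 ltac:(lia))).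
    refine (is_RInt_plus_zero _ _ _ _ _ _ (cis_pow_int (- (c2 * B' + c3 * S'))%C 3 ltac:(lia))).
    refine (is_RInt_plus_zero _ _ _ _ _ _ (cis_pow_int (B' - c1 * B' - c2 * S' - c3 * N)%C 2 ltac:(lia))).
    refine (is_RInt_plus_zero _ _ _ _ _ _ (cis_pow_int (S' - c1 * S' - c2 * N - c3 * S)%C 1 ltac:(lia))).
    refine (is_RInt_plus_zero _ _ _ _ _ _ (cis_inv_pow_int (S - c1 * S - c2 * B)%C 1 ltac:(lia))).
    refine (is_RInt_plus_zero _ _ _ _ _ _ (cis_inv_pow_int (B - c1 * B)%C 2 ltac:(lia))).
    replace (2 * PI * Re cst) with ((2 * PI - 0) * Re cst) by ring.
    apply (@is_RInt_const R_NormedModule). }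
  assert (LE : 0 <= 2 * PI * Re cst).
  { rewrite <- Z, <- (is_RInt_unique _ _ _ _ IT).
    apply RInt_le. lra.
    - apply (ex_RInt_continuous (fun t => Re (h (RtoC r * cis t)%C))).
      intros t _. apply (continuous_polar_qdiff h h'); auto.
    - eexists; exact IT.
    - intros t _. set (e := cis t). assert (He : Cmod e = 1) by apply Cmod_cis.
      assert (He0 : e <> 0). { apply Cmod_gt_0. lra. }
      set (PP := (p0 + p1 * e + p2 * e ^ 2)%C).
      assert (EPP : (PP * (q0 + q1 * / e + q2 * (/ e) ^ 2))%C = RtoC (Cmod PP ^ 2)).
      { rewrite Cmod2_conj. f_equal. unfold PP.
        rewrite !Cplus_conj, !Cmult_conj, Cpow_conj, <- Eq0, <- Eq1, <- Eq2. unfold e. rewrite cis_conj. reflexivity. }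
      set (T := (/ e * (PP * (q0 + q1 * / e + q2 * (/ e) ^ 2)))%C).
      assert (Eh : h (RtoC r * e)%C = (omega (RtoC r * e) * T - P (RtoC r * e) * T)%C).
      { unfold h, T, PP, Q, N, S, S', B, B'. fold rho. field. repeat split; auto. }
      assert (ETh : Theta t = Re (PP * (q0 + q1 * / e + q2 * (/ e) ^ 2) - P (RtoC r * e) * T)%C).
      { unfold Theta. rewrite <- !re_plus. f_equal. fold e.
        unfold cst, T, PP, P, c1, c2, c3, N, S, S', B, B'. fold rho. field. auto. }
      rewrite ETh, Eh, !re_minus. apply Rplus_le_compat_r.
      unfold T. rewrite EPP, re_RtoC.
      eapply Rle_trans; [apply Rle_abs|]. eapply Rle_trans; [apply re_le_Cmod|].
      rewrite !Cmod_mult, Cmod_inv, He, Cmod_R by auto.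
      rewrite (Rabs_pos_eq (Cmod PP ^ 2)) by apply pow2_ge_0.
      assert (Cmod (omega (RtoC r * e)%C) <= 1).
      { apply Hb. rewrite Cmod_mult, He, Cmod_R, Rabs_pos_eq; lra. }
      rewrite Rinv_1, Rmult_1_l. rewrite <- (Rmult_1_l (Cmod PP ^ 2)) at 2.
      apply Rmult_le_compat_r; auto. apply pow2_ge_0. }
  assert (Re cst >= 0).
  { apply Rle_ge. apply Rmult_le_reg_l with (2 * PI). lra. rewrite Rmult_0_r. exact LE. }
  unfold cst in H. rewrite re_minus in H.
  change (Re (c1 * N + c2 * S + c3 * B)%C <= Re N). lra.
Qed.

(** The limit [r -> 1] of the preceding inequality. *)
Lemma bounded_coefficients omega (w1 w2 w3 p0 p1 p2 : C) :
  holo omega -> (forall z, Cmod z < 1 -> Cmod (omega z) <= 1) ->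
  bigO 4 (fun z => omega z - (w1 * z + w2 * z ^ 2 + w3 * z ^ 3))%C ->
  Re (w1 * (p0 * Cconj p0 + p1 * Cconj p1 + p2 * Cconj p2) + w2 * (p0 * Cconj p1 + p1 * Cconj p2)
      + w3 * (p0 * Cconj p2)) <= Re (p0 * Cconj p0 + p1 * Cconj p1 + p2 * Cconj p2).
Proof.
  intros Hom Hb Hexp.
  set (N := (p0 * Cconj p0 + p1 * Cconj p1 + p2 * Cconj p2)%C).
  set (A1 := Re (w1 * N)%C). set (A2 := Re (w2 * (p0 * Cconj p1 + p1 * Cconj p2))%C).
  set (A3 := Re (w3 * (p0 * Cconj p2))%C).
  assert (H : forall r, 0 < r < 1 -> r * A1 + r ^ 2 * A2 + r ^ 3 * A3 <= Re N).
  { intros r Hr.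
    apply Rle_trans with (2 := bounded_coefficients_scaled omega w1 w2 w3 r p0 p1 p2 _ _ _ Hr Hom Hb Hexp eq_refl eq_refl eq_refl).
    right. unfold A1, A2, A3. rewrite <- !re_scal_l, <- !re_plus. f_equal. rewrite !RtoC_pow. fold N. ring. }
  rewrite !re_plus. fold A1 A2 A3. apply le_epsilon. intros eps Heps.
  assert (M0 := Rabs_pos A1). assert (M1 := Rabs_pos A2). assert (M2 := Rabs_pos A3).
  destruct (small_factor eps (Rabs A1 + 2 * Rabs A2 + 3 * Rabs A3)) as (s & Hs & Hs'); try lra.
  destruct (small3 s (/ 2) 1) as (e & Ep & Ea & Eb & _); try lra.
  specialize (H (1 - e) ltac:(lra)).
  assert (X : forall a k, 0 <= k <= 3 -> e * k * a <= e * k * Rabs a).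
  { intros a k Hk. apply Rmult_le_compat_l. apply Rmult_le_pos; lra. apply Rle_abs. }
  assert (Y : (Rabs A1 + 2 * Rabs A2 + 3 * Rabs A3) * e <= eps).
  { apply Rle_trans with (2 := Hs'). apply Rmult_le_compat_l; lra. }
  assert (X1 := X A1 1 ltac:(lra)).
  assert (X2 := X A2 (2 - e) ltac:(lra)).
  assert (X3 := X A3 (3 - 3 * e + e ^ 2) ltac:(nra)).
  assert (Y2 : e * (2 - e) * Rabs A2 <= e * 2 * Rabs A2).
  { apply Rmult_le_compat_r; auto. apply Rmult_le_compat_l; lra. }
  assert (Y3 : e * (3 - 3 * e + e ^ 2) * Rabs A3 <= e * 3 * Rabs A3).
  { apply Rmult_le_compat_r; auto. apply Rmult_le_compat_l; nra. }
  lra.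
Qed.

(** * Convex functions *)

(** The coefficients of the mean of [f (e^{it} z)] and [f (e^{-it} z)]. *)
Definition rotmean (a : nat -> C) (t : R) (n : nat) : C := (RtoC (cos (INR n * t)) * a n)%C.

Lemma disk_coeffs_rotmean a t : disk_coeffs a -> disk_coeffs (rotmean a t).
Proof.
  intros Ha r Hr. destruct (Ha r Hr) as [M HM]. exists M. intros n.
  apply Rle_trans with (2 := HM n). apply Rmult_le_compat_r. apply pow_le; lra.
  unfold rotmean. rewrite Cmod_mult, Cmod_R. rewrite <- (Rmult_1_l (Cmod (a n))) at 2.
  apply Rmult_le_compat_r. apply Cmod_ge_0. apply Rabs_le, COS_bound.
Qed.

Lemma Psum_rotmean a t z : disk_coeffs a -> Cmod z < 1 ->
  Psum (rotmean a t) z = (RtoC (1 - 1 / 2) * Psum a (cis t * z) + RtoC (1 / 2) * Psum a (cis (- t) * z))%C.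
Proof.
  intros Ha Hz. apply Psum_unique.
  assert (H1 : Cmod (cis t * z) < 1) by (rewrite Cmod_mult, Cmod_cis; lra).
  assert (H2 : Cmod (cis (- t) * z) < 1) by (rewrite Cmod_mult, Cmod_cis; lra).
  assert (S := Cser_plus _ _ _ _ (Cser_scal (RtoC (1 - 1 / 2)) _ _ (Psum_pser a _ Ha H1))
            (Cser_scal (RtoC (1 / 2)) _ _ (Psum_pser a _ Ha H2))).
  revert S. apply Cser_ext. intros n. rewrite !Cpow_mult_l, !cis_pow. unfold rotmean.
  replace (INR n * - t) with (- (INR n * t)) by ring.
  set (x := INR n * t).
  replace (RtoC (cos x)) with (RtoC (1 - 1 / 2) * cis x + RtoC (1 / 2) * cis (- x))%C. ring.
  unfold cis. rewrite cos_neg, sin_neg. unfold RtoC, Cplus, Cmult; simpl. f_equal; field.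
Qed.

Lemma Psum_at_0 a : disk_coeffs a -> Psum a 0 = a 0%nat.
Proof.
  intros Ha. rewrite Psum_shift; auto. ring. rewrite Cmod_0. lra.
Qed.

(** The equation [f (omega z) = c z + b2 z^2 + b3 z^3 + ...] is solved for [omega] by
    successive substitution: each expansion of [omega], put into [a2 omega^2 + a3 omega^3],
    gives the next one. *)
Lemma schwarz_expansion (f omega : C -> C) (a2 a3 c b2 b3 : C) :
  bigO 4 (fun w => f w - (w + a2 * w ^ 2 + a3 * w ^ 3))%C ->
  bigO 1 omega ->
  bigO 4 (fun z => f (omega z) - (c * z + b2 * z ^ 2 + b3 * z ^ 3))%C ->
  bigO 4 (fun z => omega z - (c * z + (b2 - a2 * c ^ 2) * z ^ 2
            + (b3 - 2 * a2 * c * (b2 - a2 * c ^ 2) - a3 * c ^ 3) * z ^ 3))%C.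
Proof.
  intros Hf Hom Hg.
  set (w2 := (b2 - a2 * c ^ 2)%C).
  assert (O0 : bigO 4 (fun z => omega z + a2 * omega z ^ 2 + a3 * omega z ^ 3
                - (c * z + b2 * z ^ 2 + b3 * z ^ 3))%C).
  { apply (bigO_ext 4 (fun z => (f (omega z) - (c * z + b2 * z ^ 2 + b3 * z ^ 3)) -
      (f (omega z) - (omega z + a2 * omega z ^ 2 + a3 * omega z ^ 3)))%C). intros; ring.
    apply bigO_minus; auto. exact (bigO_comp 4 _ _ Hf Hom). }
  assert (Om2 : bigO 2 (fun z => omega z * omega z)%C) by (apply (bigO_mult 1 1); auto).
  assert (Om3 : bigO 3 (fun z => omega z * (omega z * omega z))%C) by (apply (bigO_mult 1 2); auto).
  assert (Mz : forall d k j, (j <= k)%nat -> bigO j (fun z => d * z ^ k)%C).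
  { intros d k j Hj. apply (bigO_weaken j k); auto. apply bigO_monomial. }
  assert (O1 : bigO 2 (fun z => omega z - c * z)%C).
  { apply (bigO_ext 2 (fun z => (omega z + a2 * omega z ^ 2 + a3 * omega z ^ 3
                - (c * z + b2 * z ^ 2 + b3 * z ^ 3)) - (a2 * (omega z * omega z)
      + a3 * (omega z * (omega z * omega z)) - (b2 * z ^ 2 + b3 * z ^ 3)))%C). intros; ring.
    apply bigO_minus. apply (bigO_weaken 2 4); auto.
    apply bigO_minus; apply bigO_plus; try (apply Mz; lia); apply bigO_scal; auto.
    apply (bigO_weaken 2 3); auto. }
  assert (Sum1 : bigO 1 (fun z => omega z + c * z)%C).
  { apply bigO_plus; auto. apply (bigO_ext 1 (fun z => c * z ^ 1)%C). intros; ring. apply Mz; lia. }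
  assert (O2 : bigO 3 (fun z => omega z - c * z - w2 * z ^ 2)%C).
  { apply (bigO_ext 3 (fun z => (omega z + a2 * omega z ^ 2 + a3 * omega z ^ 3
                - (c * z + b2 * z ^ 2 + b3 * z ^ 3)) - (a2 * ((omega z - c * z) * (omega z + c * z))
      + a3 * (omega z * (omega z * omega z)) - b3 * z ^ 3))%C). intros; unfold w2; ring.
    apply bigO_minus. apply (bigO_weaken 3 4); auto.
    apply bigO_minus; [|apply Mz; lia]. apply bigO_plus; apply bigO_scal; auto.
    apply (bigO_mult 2 1); auto. }
  assert (O3 : bigO 4 (fun z => (omega z - c * z - w2 * z ^ 2) * (omega z + c * z)
       + w2 * (z ^ 2 * (omega z - c * z)))%C).
  { apply bigO_plus. apply (bigO_mult 3 1); auto. apply bigO_scal.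
    apply (bigO_mult 2 2); auto. apply (bigO_ext 2 (fun z => 1 * z ^ 2)%C). intros; ring. apply Mz; lia. }
  assert (O4 : bigO 4 (fun z => (omega z - c * z) * (omega z * omega z + c * z * (omega z + c * z)))%C).
  { apply (bigO_mult 2 2); auto. apply bigO_plus; auto. apply (bigO_mult 1 1); auto.
    apply (bigO_ext 1 (fun z => c * z ^ 1)%C). intros; ring. apply Mz; lia. }
  apply (bigO_ext 4 (fun z => (omega z + a2 * omega z ^ 2 + a3 * omega z ^ 3
                - (c * z + b2 * z ^ 2 + b3 * z ^ 3))
      - (a2 * ((omega z - c * z - w2 * z ^ 2) * (omega z + c * z) + w2 * (z ^ 2 * (omega z - c * z)))
      + a3 * ((omega z - c * z) * (omega z * omega z + c * z * (omega z + c * z)))))%C).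
  - intros. unfold w2. ring.
  - apply bigO_minus; auto. apply bigO_plus; apply bigO_scal; auto.
Qed.

(** Class K in terms of Taylor coefficients, with convexity of the image recorded for
    midpoints. *)
Definition convex_series (a : nat -> C) : Prop :=
  disk_coeffs a /\ a 0%nat = 0 /\ a 1%nat = 1 /\ injective_in_disk (Psum a) /\
  forall z1 z2, Cmod z1 < 1 -> Cmod z2 < 1 -> exists w, Cmod w < 1 /\
    Psum a w = (RtoC (1 - 1 / 2) * Psum a z1 + RtoC (1 / 2) * Psum a z2)%C.

(** The midpoint of [f (e^{it} z)] and [f (e^{-it} z)] lies in the convex image, so it is
    [f (omega z)] for a map [omega] of the disk into itself. It is holomorphic because
    [f] is injective, and its expansion follows from those of [f] and of the midpoint. *)
Lemma rotmean_subordinate a t : convex_series a ->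
  exists omega, holo omega /\ (forall z, Cmod z < 1 -> Cmod (omega z) <= 1) /\
    bigO 4 (fun z => omega z - (RtoC (cos t) * z + (- RtoC (1 - cos t ^ 2) * a 2%nat) * z ^ 2
      + (RtoC (cos t * (1 - cos t ^ 2)) * (2 * a 2%nat ^ 2 - 3 * a 3%nat)) * z ^ 3))%C.
Proof.
  intros (Ha & A0 & A1 & Hinj & Hcv).
  assert (Hd : forall w, Cmod w < 1 -> Psum (dcoef a) w <> 0).
  { intros w Hw. apply injective_derivative_nonzero; auto. rewrite A1.
    intros E; apply RtoC_inj in E; lra. }
  set (b := rotmean a t). assert (Db : disk_coeffs b) by (apply disk_coeffs_rotmean; auto).
  assert (Ex : forall z, exists w, Cmod z < 1 -> Cmod w < 1 /\ Psum a w = Psum b z).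
  { intros z. destruct (Rlt_dec (Cmod z) 1) as [Hz|Hz].
    - destruct (Hcv (cis t * z)%C (cis (- t) * z)%C) as (w & Hw & E);
        try (rewrite Cmod_mult, Cmod_cis; lra).
      exists w. intros _. split; auto. rewrite E. symmetry. apply Psum_rotmean; auto.
    - exists 0. intros X. contradiction. }
  set (omega := fun z => proj1_sig (constructive_indefinite_description _ (Ex z))).
  assert (Hom : forall z, Cmod z < 1 -> Cmod (omega z) < 1 /\ Psum a (omega z) = Psum b z).
  { intros z Hz. unfold omega. destruct (constructive_indefinite_description _ (Ex z)) as [w Hw].
    simpl. auto. }
  assert (Q : forall z, Cmod z < 1 ->
     qdiff omega z (Psum (dcoef b) z / Psum (dcoef a) (omega z))%C).
  { intros z Hz. apply (qdiff_inverse_comp a (Psum b)); auto. apply qdiff_Psum; auto. }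
  assert (C0 : Cmod 0 < 1) by (rewrite Cmod_0; lra).
  assert (H0 : omega 0 = 0).
  { destruct (Hom 0 C0) as [O1 O2]. apply Hinj; auto.
    rewrite O2, !Psum_at_0 by auto. unfold b, rotmean. rewrite A0. ring. }
  exists omega. split; [|split].
  - exists (fun z => Psum (dcoef b) z * / Psum (dcoef a) (omega z))%C. intros z [_ Hz].
    split. apply Q; auto.
    eexists. apply qdiff_mult. apply qdiff_Psum; auto. apply disk_coeffs_dcoef; auto.
    apply (qdiff_comp (fun w => / w)%C (fun z => Psum (dcoef a) (omega z))).
    apply (qdiff_comp (Psum (dcoef a)) omega). apply Q; auto.
    apply qdiff_Psum. apply disk_coeffs_dcoef; auto. apply Hom; auto.
    apply qdiff_inv. apply Hd. apply Hom; auto.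
  - intros z Hz. left. apply Hom; auto.
  - assert (Hf : bigO 4 (fun w => Psum a w - (w + a 2%nat * w ^ 2 + a 3%nat * w ^ 3))%C).
    { generalize (Psum_cubic a Ha). apply bigO_ext. intros z. rewrite A0, A1. ring. }
    assert (Hg : bigO 4 (fun z => Psum a (omega z) - (RtoC (cos t) * z + b 2%nat * z ^ 2 + b 3%nat * z ^ 3))%C).
    { apply (bigO_ext_loc 4 (fun z => Psum b z - (b 0%nat + b 1%nat * z + b 2%nat * z ^ 2 + b 3%nat * z ^ 3))%C _ 1).
      lra. intros z Hz. rewrite (proj2 (Hom z Hz)). unfold b, rotmean. rewrite A0, A1.
      replace (INR 1 * t) with t by (simpl; ring). ring.
      apply Psum_cubic; auto. }
    assert (R := schwarz_expansion _ omega _ _ _ _ _ Hf (bigO_of_qdiff omega _ H0 (Q 0 C0)) Hg).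
    revert R. apply bigO_ext. intros z. unfold b, rotmean.
    set (c := cos t).
    replace (cos (INR 2 * t)) with (2 * c ^ 2 - 1).
    2:{ replace (INR 2 * t) with (2 * t) by (simpl; ring). rewrite cos_2a_cos. unfold c; ring. }
    replace (cos (INR 3 * t)) with (4 * c ^ 3 - 3 * c).
    2:{ replace (INR 3 * t) with (2 * t + t) by (simpl; ring). rewrite cos_plus, cos_2a_cos, sin_2a.
        generalize (sin2_cos2 t). unfold Rsqr. intros X. unfold c.
        replace (2 * sin t * cos t * sin t) with (2 * cos t * (sin t * sin t)) by ring.
        replace (sin t * sin t) with (1 - cos t * cos t) by lra. ring. }
    rewrite !RtoC_minus, !RtoC_mult, !RtoC_minus, !RtoC_pow. ring.
Qed.

(** As [t -> 0] the maps [omega] of [rotmean_subordinate] tend to the identity, where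
    [bounded_coefficients] is an equality. The terms of first order in [1 - cos t]
    give the Caratheodory-Toeplitz inequality for [1 + z f'' / f']. *)
Lemma convex_form_nonneg a (p0 p1 p2 : C) : convex_series a ->
  0 <= Re (p0 * Cconj p0 + p1 * Cconj p1 + p2 * Cconj p2)
     + 2 * Re (a 2%nat * (p0 * Cconj p1 + p1 * Cconj p2))
     + 2 * Re ((3 * a 3%nat - 2 * a 2%nat ^ 2) * (p0 * Cconj p2)).
Proof.
  intros Ha.
  set (N := (p0 * Cconj p0 + p1 * Cconj p1 + p2 * Cconj p2)%C).
  set (X := Re (a 2%nat * (p0 * Cconj p1 + p1 * Cconj p2))%C).
  set (Y := Re ((3 * a 3%nat - 2 * a 2%nat ^ 2) * (p0 * Cconj p2))%C).
  (* the inequality of the means, divided by 1 - cos t *)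
  assert (H : forall c, 0 < c < 1 -> 0 <= Re N + (1 + c) * X + c * (1 + c) * Y).
  { intros c Hc. destruct (rotmean_subordinate a (acos c) Ha) as (omega & H1 & H2 & H3).
    assert (B := bounded_coefficients omega _ _ _ p0 p1 p2 H1 H2 H3).
    rewrite cos_acos in B by lra. fold N in B.
    rewrite re_plus, re_plus in B.
    replace (Re (RtoC c * N)) with (c * Re N) in B by (rewrite re_scal_l; reflexivity).
    replace (Re (- RtoC (1 - c ^ 2) * a 2%nat * (p0 * Cconj p1 + p1 * Cconj p2))%C)
      with (- (1 - c ^ 2) * X) in B.
    2:{ unfold X. rewrite <- re_scal_l. f_equal. rewrite RtoC_opp. ring. }
    replace (Re (RtoC (c * (1 - c ^ 2)) * (2 * a 2%nat ^ 2 - 3 * a 3%nat) * (p0 * Cconj p2))%C)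
      with (- (c * (1 - c ^ 2)) * Y) in B.
    2:{ unfold Y. rewrite <- re_scal_l. f_equal. rewrite RtoC_opp. ring. }
    apply Rmult_le_reg_l with (1 - c). lra. rewrite Rmult_0_r.
    replace ((1 - c) * (Re N + (1 + c) * X + c * (1 + c) * Y)) with
      (Re N - (c * Re N + - (1 - c ^ 2) * X + - (c * (1 - c ^ 2)) * Y)) by ring.
    lra. }
  apply le_epsilon. intros eps Heps.
  assert (M1 := Rabs_pos X). assert (M2 := Rabs_pos Y).
  destruct (small_factor eps (Rabs X + 3 * Rabs Y)) as (s & Hs & Hs'); try lra.
  destruct (small3 s (/ 2) 1) as (e & Ep & Ea & Eb & _); try lra.
  specialize (H (1 - e) ltac:(lra)).
  assert (E1 : (Rabs X + 3 * Rabs Y) * e <= eps).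
  { apply Rle_trans with (2 := Hs'). apply Rmult_le_compat_l; lra. }
  assert (E2 : e * - X <= e * Rabs X).
  { apply Rmult_le_compat_l. lra. rewrite <- Rabs_Ropp. apply Rle_abs. }
  assert (E3 : e * (3 - e) * - Y <= e * (3 - e) * Rabs Y).
  { apply Rmult_le_compat_l. apply Rmult_le_pos; lra. rewrite <- Rabs_Ropp. apply Rle_abs. }
  assert (E4 : e * (3 - e) * Rabs Y <= e * 3 * Rabs Y).
  { apply Rmult_le_compat_r; auto. apply Rmult_le_compat_l; lra. }
  lra.
Qed.

Lemma unimodular_opposite (d : C) : exists u, Re u ^ 2 + Im u ^ 2 = 1 /\ Re (d * u) = - Cmod d.
Proof.
  destruct (Ceq_dec d 0) as [E|E].
  - exists (RtoC 1). subst d. rewrite Cmod_0. split. simpl; ring.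
    replace (0 * 1)%C with (RtoC 0) by ring. simpl. ring.
  - assert (P := proj1 (Cmod_gt_0 d) E).
    exists (- Cconj d / RtoC (Cmod d))%C.
    assert (R0 : RtoC (Cmod d) <> 0) by (intros X; apply RtoC_inj in X; lra).
    split.
    + rewrite <- Cmod2_alt, Cmod_div, Cmod_opp, Cmod_conj, Cmod_R, Rabs_pos_eq by (auto; lra).
      field. lra.
    + replace (d * (- Cconj d / Cmod d))%C with (- (d * Cconj d) / Cmod d)%C by (field; auto).
      rewrite <- Cmod2_conj.
      replace (- RtoC (Cmod d ^ 2) / RtoC (Cmod d))%C with (RtoC (- Cmod d)). apply re_RtoC.
      rewrite RtoC_opp, RtoC_pow. field. auto.
Qed.

(** For [p2 = 1], a unimodular [p0 = u] and the minimising [p1], the form equals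
    [2 (1 - |a2|^2 + 3 Re ((a3 - a2^2) u))]; the worst [u] gives the inequality. *)
Lemma convex_third_coefficient a : convex_series a ->
  3 * Cmod (a 3%nat - a 2%nat ^ 2) <= 1 - Cmod (a 2%nat) ^ 2.
Proof.
  intros Ha. set (d := (a 3%nat - a 2%nat ^ 2)%C).
  destruct (unimodular_opposite d) as (u & Hu & Hd).
  (* p1 minimises the quadratic form for the given p0 and p2 *)
  assert (H := convex_form_nonneg a u (- (a 2%nat * u + Cconj (a 2%nat)))%C 1 Ha).
  replace (a 3%nat) with (d + a 2%nat ^ 2)%C in H by (unfold d; ring).
  rewrite Cmod2_alt. rewrite re_mult in Hd. clearbody d.
  destruct (a 2%nat) as [x y]. destruct u as [p q]. destruct d as [v w].
  simpl Re in Hu, Hd |- *. simpl Im in Hu, Hd |- *.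
  match type of H with 0 <= ?e => assert (Eq : e =
    2 * (1 - (x ^ 2 + y ^ 2) + 3 * (v * p - w * q)) + (p ^ 2 + q ^ 2 - 1) * (1 - (x ^ 2 + y ^ 2))) end.
  { simpl. ring. }
  rewrite Eq, Hu, Hd in H. lra.
Qed.

(** * Logarithmic coefficients *)

(** Compare the coefficients of [z exp (L z) = z (1 + L z + (L z)^2 / 2 + ...)] and of
    [f]. *)
Lemma log_coefficients_expansion (f L : C -> C) (a2 a3 g1 g2 : C) :
  bigO 4 (fun z => f z - (z + a2 * z ^ 2 + a3 * z ^ 3))%C ->
  bigO 4 (fun z => f z - z * Cexp (L z))%C ->
  bigO 3 (fun z => L z - (2 * g1 * z + 2 * g2 * z ^ 2))%C ->
  a2 = (2 * g1)%C /\ a3 = (2 * g2 + 2 * g1 ^ 2)%C.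
Proof.
  intros Hf HE HL.
  assert (Mz : forall d k j, (j <= k)%nat -> bigO j (fun z => d * z ^ k)%C).
  { intros d k j Hj. apply (bigO_weaken j k); auto. apply bigO_monomial. }
  assert (Id : bigO 1 (fun z => z)).
  { apply (bigO_ext 1 (fun z => 1 * z ^ 1)%C). intros; ring. apply Mz; lia. }
  assert (L2 : bigO 2 (fun z => L z - 2 * g1 * z)%C).
  { apply (bigO_ext 2 (fun z => (L z - (2 * g1 * z + 2 * g2 * z ^ 2)) + 2 * g2 * z ^ 2)%C). intros; ring.
    apply bigO_plus. apply (bigO_weaken 2 3); auto. apply Mz; lia. }
  assert (L1 : bigO 1 L).
  { apply (bigO_ext 1 (fun z => (L z - 2 * g1 * z) + 2 * g1 * z)%C). intros; ring.
    apply bigO_plus. apply (bigO_weaken 1 2); auto. apply bigO_scal; auto. }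
  assert (E3 := bigO_comp 3 _ _ Cexp_taylor2 L1). cbv beta in E3.
  assert (Sq : bigO 3 (fun z => (L z - 2 * g1 * z) * (L z + 2 * g1 * z))%C).
  { apply (bigO_mult 2 1); auto. apply bigO_plus; auto. apply bigO_scal; auto. }
  assert (T : bigO 4 (fun z => (a2 - 2 * g1) * z ^ 2 + (a3 - (2 * g2 + 2 * g1 ^ 2)) * z ^ 3)%C).
  { apply (bigO_ext 4 (fun z => (f z - z * Cexp (L z)) - (f z - (z + a2 * z ^ 2 + a3 * z ^ 3))
      + (z * ((Cexp (L z) - 1 - L z - L z ^ 2 / 2) + ((L z - (2 * g1 * z + 2 * g2 * z ^ 2))
        + / 2 * ((L z - 2 * g1 * z) * (L z + 2 * g1 * z))))))%C).
    - intros z. field.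
    - apply bigO_plus. apply bigO_minus; auto. apply (bigO_mult 1 3); auto.
      apply bigO_plus; auto. apply bigO_plus; auto. apply bigO_scal; auto. }
  assert (A2 : (a2 - 2 * g1)%C = 0).
  { apply (bigO_coef_0 _ 2).
    apply (bigO_ext 3 (fun z => ((a2 - 2 * g1) * z ^ 2 + (a3 - (2 * g2 + 2 * g1 ^ 2)) * z ^ 3)
       - (a3 - (2 * g2 + 2 * g1 ^ 2)) * z ^ 3)%C). intros; ring.
    apply bigO_minus. apply (bigO_weaken 3 4); auto. apply Mz; lia. }
  assert (A3 : (a3 - (2 * g2 + 2 * g1 ^ 2))%C = 0).
  { apply (bigO_coef_0 _ 3).
    apply (bigO_ext 4 (fun z => ((a2 - 2 * g1) * z ^ 2 + (a3 - (2 * g2 + 2 * g1 ^ 2)) * z ^ 3))%C); auto.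
    intros; rewrite A2; ring. }
  split; apply Ceq_minus; auto.
Qed.

Lemma class_K_convex_series f : class_K f ->
  exists a, convex_series a /\ forall z, Cmod z < 1 -> f z = Psum a z.
Proof.
  intros ((_ & a & A0 & A1 & HP) & Hu & (_ & _ & Hc)).
  destruct (disk_coeffs_of_pser_disk a f) as [Da Ef].
  { intros z Hz. exact (proj1 (is_pseries_pser a z (f z)) (HP z Hz)). }
  exists a. split; auto. split; auto. split; auto. split; auto. split.
  - intros z w Hz Hw E. apply Hu; auto. rewrite !Ef; auto.
  - intros z1 z2 H1 H2.
    destruct (Hc (f z1) (f z2) (1 / 2)) as (w & Hw & E).
    exists z1; split; auto. exists z2; split; auto. lra.
    exists w. split; auto. rewrite <- !Ef; auto.
Qed.

Lemma log_coefficients_of_class_K f gamma : class_K f -> log_coefficients f gamma ->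
  exists a, convex_series a /\ a 2%nat = (2 * gamma 1%nat)%C /\
    a 3%nat = (2 * gamma 2%nat + 2 * gamma 1%nat ^ 2)%C.
Proof.
  intros Hf (L & (L0 & _ & LE) & LS).
  destruct (class_K_convex_series f Hf) as (a & Ha & Ef). exists a. split; auto.
  assert (Ha' := Ha). destruct Ha as (Da & A0 & A1 & _ & _).
  set (g := fun n => match n with O => RtoC 0 | S k => gamma (S k) end).
  assert (Hg : forall z, Cmod z < 1 -> pser g z (L z / 2)%C).
  { intros z Hz. destruct (LS z Hz) as (s & Hs & ->).
    replace (2 * s / 2)%C with (g 0%nat * z ^ 0 + s)%C by (simpl; field).
    apply (Cser_unshift (fun n => g n * z ^ n)%C). exact Hs. }
  destruct (disk_coeffs_of_pser_disk g _ Hg) as [Dg Eg].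
  apply (log_coefficients_expansion f L).
  - apply (bigO_ext_loc 4 (fun z => Psum a z - (a 0%nat + a 1%nat * z + a 2%nat * z ^ 2 + a 3%nat * z ^ 3))%C _ 1).
    lra. intros z Hz. rewrite Ef, A0, A1; auto. ring. apply Psum_cubic; auto.
  - apply (bigO_ext_loc 4 (fun z => 0 * z ^ 4)%C _ 1); [lra| |apply bigO_monomial].
    intros z Hz. destruct (Ceq_dec z 0) as [->|Hz0].
    + rewrite Ef, Psum_at_0, A0; auto. ring.
    + rewrite LE; auto. field. auto.
  - apply (bigO_ext_loc 3 (fun z => 2 * (Psum g z - (g 0%nat + g 1%nat * z + g 2%nat * z ^ 2 + g 3%nat * z ^ 3))
        + 2 * g 3%nat * z ^ 3)%C _ 1). lra.
    + intros z Hz. rewrite <- Eg by auto. simpl g. field.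
    + apply bigO_plus. apply bigO_scal. apply (bigO_weaken 3 4); auto. apply Psum_cubic; auto.
      apply bigO_monomial.
Qed.

(** With [x = |gamma 1|] and [y = |gamma 2|], [convex_third_coefficient] says
    [|gamma 2 - gamma 1 ^ 2| <= (1 - 4 x^2) / 6]. Hence [y - x <= 1/6 + x^2/3 - x], at
    most 1/6 as [x <= 1/2], and [y] is at least [(10 x^2 - 1) / 6], which vanishes at
    [x = 1 / sqrt 10]: before this point [y - x >= - x], after it the bound
    [(10 x^2 - 1) / 6 - x] increases. *)
Lemma log_coefficients_bounds f gamma : class_K f -> log_coefficients f gamma ->
  - (1 / sqrt 10) <= Cmod (gamma 2%nat) - Cmod (gamma 1%nat) <= 1 / 6.
Proof.
  intros Hf Hg. destruct (log_coefficients_of_class_K f gamma Hf Hg) as (a & Ha & E2 & E3).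
  assert (H := convex_third_coefficient a Ha). rewrite E2, E3 in H.
  replace (2 * gamma 2%nat + 2 * gamma 1%nat ^ 2 - (2 * gamma 1%nat) ^ 2)%C with
    (2 * (gamma 2%nat - gamma 1%nat ^ 2))%C in H by ring.
  rewrite !Cmod_mult, Cmod_R, (Rabs_pos_eq 2) in H by lra.
  assert (T1 := Cmod_sub_ge (gamma 2%nat) (gamma 1%nat ^ 2)%C).
  assert (T2 := Cmod_sub_ge (gamma 1%nat ^ 2)%C (gamma 2%nat)). rewrite Cmod_minus_comm in T2.
  rewrite Cmod_pow in T1, T2.
  assert (D0 := Cmod_ge_0 (gamma 2%nat - gamma 1%nat ^ 2)%C).
  set (D := Cmod (gamma 2%nat - gamma 1%nat ^ 2)%C) in *.
  assert (X0 := Cmod_ge_0 (gamma 1%nat)). assert (Y0 := Cmod_ge_0 (gamma 2%nat)).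
  set (x := Cmod (gamma 1%nat)) in *. set (y := Cmod (gamma 2%nat)) in *.
  assert (Hx : x <= / 2) by nra.
  split; [|nra].
  assert (S10 : 0 < sqrt 10) by (apply sqrt_lt_R0; lra).
  assert (S2 : sqrt 10 * sqrt 10 = 10) by (apply sqrt_sqrt; lra).
  set (k := 1 / sqrt 10). assert (Hk : k * k = / 10).
  { unfold k. replace (1 / sqrt 10 * (1 / sqrt 10)) with (/ (sqrt 10 * sqrt 10)) by (field; lra).
    rewrite S2. reflexivity. }
  assert (Kp : 3 / 10 <= k).
  { assert (0 < k) by (unfold k; apply Rdiv_lt_0_compat; lra). nra. }
  destruct (Rle_dec x k) as [Hxk|Hxk]. lra.
  assert (0 <= (x - k) * (10 * (x + k) - 6)) by (apply Rmult_le_pos; lra). nra.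
Qed.

(** * Products and substitutions in power series *)

Lemma Re_csum u n : Re (csum u n) = sum_f_R0 (fun k => Re (u k)) n.
Proof. induction n as [|n IH]. rewrite csum_0. reflexivity. rewrite csum_S, re_plus, IH. reflexivity. Qed.

Lemma Im_csum u n : Im (csum u n) = sum_f_R0 (fun k => Im (u k)) n.
Proof. induction n as [|n IH]. rewrite csum_0. reflexivity. rewrite csum_S, im_plus, IH. reflexivity. Qed.

Lemma Cser_parts u l :
  Cser u l <-> is_series (fun n => Re (u n)) (Re l) /\ is_series (fun n => Im (u n)) (Im l).
Proof.
  rewrite !is_series_Reals, Cser_eps. unfold infinite_sum, Rdist. split.
  - intros H. split; intros eps Heps; destruct (H eps Heps) as [N HN]; exists N; intros n Hn.
    + rewrite <- Re_csum, <- re_minus. eapply Rle_lt_trans; [apply re_le_Cmod|]. apply HN; auto.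
    + rewrite <- Im_csum, <- im_minus. eapply Rle_lt_trans; [apply im_le_Cmod|]. apply HN; auto.
  - intros [H1 H2] eps Heps.
    destruct (H1 (eps / 2)) as [N1 HN1]. lra. destruct (H2 (eps / 2)) as [N2 HN2]. lra.
    exists (Nat.max N1 N2). intros n Hn. specialize (HN1 n ltac:(lia)). specialize (HN2 n ltac:(lia)).
    rewrite <- Re_csum, <- re_minus in HN1. rewrite <- Im_csum, <- im_minus in HN2.
    eapply Rle_lt_trans; [apply Cmod_le_re_im|]. lra.
Qed.

Lemma csum_ext u v n : (forall k, (k <= n)%nat -> u k = v k) -> csum u n = csum v n.
Proof. intros H. apply sum_n_ext_loc. exact H. Qed.

Lemma csum_scal c u n : csum (fun k => c * u k)%C n = (c * csum u n)%C.
Proof. induction n as [|n IH]. rewrite !csum_0. reflexivity. rewrite !csum_S, IH. ring. Qed.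

Lemma ex_series_le_abs (u v : nat -> R) : (forall n, Rabs (u n) <= v n) -> ex_series v ->
  ex_series (fun n => Rabs (u n)).
Proof.
  intros H Hv. apply (@ex_series_le R_AbsRing R_CompleteNormedModule _ v); auto.
  intros n. change (Rabs (Rabs (u n)) <= v n). rewrite Rabs_Rabsolu. auto.
Qed.

(** Reduces to Mertens' theorem for real series by splitting into real and imaginary
    parts. *)
Lemma Cser_mult (u v : nat -> C) (l m : C) : Cser u l -> Cser v m ->
  ex_series (fun n => Cmod (u n)) -> ex_series (fun n => Cmod (v n)) ->
  Cser (fun n => csum (fun k => u k * v (n - k)%nat)%C n) (l * m)%C.
Proof.
  intros Hu Hv Au Av.
  destruct (proj1 (Cser_parts _ _) Hu) as [Ru Iu]. destruct (proj1 (Cser_parts _ _) Hv) as [Rv Iv].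
  assert (ARu := ex_series_le_abs _ _ (fun n => re_le_Cmod (u n)) Au).
  assert (AIu := ex_series_le_abs _ _ (fun n => im_le_Cmod (u n)) Au).
  assert (ARv := ex_series_le_abs _ _ (fun n => re_le_Cmod (v n)) Av).
  assert (AIv := ex_series_le_abs _ _ (fun n => im_le_Cmod (v n)) Av).
  apply Cser_parts. split.
  - rewrite re_mult.
    assert (H := is_series_minus _ _ _ _ (is_series_mult _ _ _ _ Ru Rv ARu ARv)
                   (is_series_mult _ _ _ _ Iu Iv AIu AIv)).
    revert H. apply is_series_ext. intros n. rewrite Re_csum.
    symmetry. etransitivity; [apply sum_eq; intros k _; apply re_mult|].
    rewrite minus_sum. reflexivity.
  - rewrite im_mult.
    assert (H := is_series_plus _ _ _ _ (is_series_mult _ _ _ _ Ru Iv ARu AIv)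
                   (is_series_mult _ _ _ _ Iu Rv AIu ARv)).
    revert H. apply is_series_ext. intros n. rewrite Im_csum.
    symmetry. etransitivity; [apply sum_eq; intros k _; apply im_mult|].
    rewrite plus_sum. reflexivity.
Qed.

Lemma Psum_mult a b z : disk_coeffs a -> disk_coeffs b -> Cmod z < 1 ->
  Psum (fun n => csum (fun k => a k * b (n - k)%nat)%C n) z = (Psum a z * Psum b z)%C.
Proof.
  intros Ha Hb Hz. apply Psum_unique.
  assert (A : forall a, disk_coeffs a -> ex_series (fun n => Cmod (a n * z ^ n))).
  { intros c Hc. apply (ex_series_ext (fun n => Cmod (c n) * Cmod z ^ n)).
    intros n. rewrite Cmod_mult, Cmod_pow. reflexivity.
    apply disk_coeffs_abs; auto. split; auto. apply Cmod_ge_0. }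
  assert (H := Cser_mult _ _ _ _ (Psum_pser a z Ha Hz) (Psum_pser b z Hb Hz) (A a Ha) (A b Hb)).
  revert H. apply Cser_ext. intros n. rewrite Cmult_comm, <- csum_scal. apply csum_ext. intros k Hk.
  replace (z ^ n)%C with (z ^ k * z ^ (n - k))%C. ring.
  rewrite <- Cpow_add_r. f_equal. lia.
Qed.

Lemma Psum_ext a b z : disk_coeffs b -> Cmod z < 1 -> (forall n, a n = b n) -> Psum a z = Psum b z.
Proof.
  intros Hb Hz E. apply Psum_unique.
  generalize (Psum_pser b z Hb Hz). apply Cser_ext. intros n. rewrite E. reflexivity.
Qed.

Lemma disk_coeffs_bounded a M : (forall n, Cmod (a n) <= M) -> disk_coeffs a.
Proof.
  intros H r Hr. exists M. intros n. rewrite <- (Rmult_1_r M).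
  apply Rmult_le_compat; auto using Cmod_ge_0. apply pow_le; lra.
  rewrite <- (pow1 n). apply pow_incr. lra.
Qed.

Definition evencoef (a : nat -> C) (n : nat) : C :=
  if Nat.even n then a (Nat.div2 n) else 0.

Lemma evencoef_even a k : evencoef a (2 * k) = a k.
Proof. unfold evencoef. rewrite Nat.even_even, Nat.div2_double. reflexivity. Qed.

Lemma evencoef_odd a k : evencoef a (S (2 * k)) = 0.
Proof. unfold evencoef. replace (S (2 * k)) with (2 * k + 1)%nat by lia. rewrite Nat.even_odd. reflexivity. Qed.

Lemma pser_evencoef a z l : pser a (z ^ 2) l -> pser (evencoef a) z l.
Proof.
  unfold pser. rewrite !Cser_eps. intros H.
  set (u := fun n => (evencoef a n * z ^ n)%C).
  assert (E : forall k, csum u (2 * k) = csum (fun n => a n * (z ^ 2) ^ n)%C k).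
  { induction k as [|k IH].
    - rewrite Nat.mul_0_r, !csum_0. reflexivity.
    - replace (2 * S k)%nat with (S (S (2 * k))) by lia. rewrite !csum_S, IH. unfold u.
      rewrite evencoef_odd. replace (S (S (2 * k))) with (2 * S k)%nat by lia.
      rewrite evencoef_even, Cpow_mult_r. ring. }
  intros eps Heps. destruct (H eps Heps) as [N HN]. exists (2 * N)%nat. intros n Hn.
  destruct (Nat.Even_or_Odd n) as [[k ->]|[k ->]].
  - rewrite E. apply HN. lia.
  - replace (2 * k + 1)%nat with (S (2 * k)) by lia. rewrite csum_S, E. unfold u at 1.
    rewrite evencoef_odd.
    replace (csum (fun n => a n * (z ^ 2) ^ n)%C k + 0 * z ^ S (2 * k))%C with
     (csum (fun n => a n * (z ^ 2) ^ n)%C k) by ring. apply HN. lia.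
Qed.

Lemma sq_in_disk (z : C) : Cmod z < 1 -> Cmod (z ^ 2) < 1.
Proof.
  intros Hz. rewrite Cmod_pow. assert (H := Cmod_ge_0 z). nra.
Qed.

Lemma Psum_evencoef a z : disk_coeffs a -> Cmod z < 1 -> Psum (evencoef a) z = Psum a (z ^ 2).
Proof.
  intros Ha Hz. apply Psum_unique, pser_evencoef, Psum_pser; auto. apply sq_in_disk; auto.
Qed.

Lemma disk_coeffs_evencoef a : disk_coeffs a -> disk_coeffs (evencoef a).
Proof.
  intros Ha. apply (disk_coeffs_of_pser_disk _ (fun z => Psum a (z ^ 2))). intros z Hz.
  apply pser_evencoef, Psum_pser; auto. apply sq_in_disk; auto.
Qed.

(** Along each ray the real and imaginary parts have derivative zero. *)
Lemma constant_on_disk h : (forall z, Cmod z < 1 -> qdiff h z 0) ->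
  forall z, Cmod z < 1 -> h z = h 0.
Proof.
  intros H z Hz.
  assert (Q : forall t : R, 0 <= t <= 1 -> qdiff (fun w => h (w * z)%C) (RtoC t) 0).
  { intros t Ht. replace (RtoC 0) with (0 * (1 * z + RtoC t * 0))%C by ring.
    apply (qdiff_comp h (fun w => w * z)%C).
    apply (qdiff_mult (fun w => w)). apply qdiff_id. apply qdiff_const.
    apply H. rewrite Cmod_mult, Cmod_R, Rabs_pos_eq by lra. assert (P := Cmod_ge_0 z). nra. }
  assert (E1 : Re (h (0 * z)%C) = Re (h (1 * z)%C)).
  { apply (eq_is_derive (fun t => Re (h (RtoC t * z)%C))); [|lra].
    intros t Ht. apply (qdiff_real _ t _ (Q t Ht)). }
  assert (E2 : Im (h (0 * z)%C) = Im (h (1 * z)%C)).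
  { apply (eq_is_derive (fun t => Im (h (RtoC t * z)%C))); [|lra].
    intros t Ht. apply (qdiff_real _ t _ (Q t Ht)). }
  replace (0 * z)%C with (RtoC 0) in E1, E2 by ring. replace (1 * z)%C with z in E1, E2 by ring.
  destruct (h z) as [a b], (h 0) as [c d]. simpl in E1, E2. subst. reflexivity.
Qed.

(** * Quotients of power series *)

(** Course-of-values recursion for the coefficients of the quotient [c / f] of two power
    series with [f 0 = 1]: [quot_table c f n] is correct up to the index [n]. *)
Fixpoint quot_table (c f : nat -> R) (n : nat) : nat -> R :=
  match n with
  | O => fun _ => c 0%nat
  | S p => fun k => if Nat.leb k p then quot_table c f p k
             else c (S p) - sum_f_R0 (fun j => quot_table c f p j * f (S p - j)%nat) p
  end.

Definition quot_coef (c f : nat -> R) (n : nat) : R := quot_table c f n n.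

Lemma quot_table_stable c f n k : (k <= n)%nat -> quot_table c f n k = quot_coef c f k.
Proof.
  intros H. induction H as [|n H IH]. reflexivity.
  simpl. rewrite (proj2 (Nat.leb_le k n) H). exact IH.
Qed.

Lemma quot_coef_S c f n :
  quot_coef c f (S n) = c (S n) - sum_f_R0 (fun j => quot_coef c f j * f (S n - j)%nat) n.
Proof.
  unfold quot_coef at 1. cbn [quot_table]. rewrite (proj2 (Nat.leb_gt (S n) n)) by lia.
  f_equal. apply sum_eq. intros j Hj. rewrite quot_table_stable by auto. reflexivity.
Qed.

Lemma quot_coef_conv c f n : f 0%nat = 1 ->
  sum_f_R0 (fun j => quot_coef c f j * f (n - j)%nat) n = c n.
Proof.
  intros F0. destruct n as [|n].
  - simpl. rewrite F0. unfold quot_coef; simpl. ring.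
  - rewrite tech5, Nat.sub_diag, F0, quot_coef_S. ring.
Qed.

Lemma sum_nonneg (u : nat -> R) n : (forall k, (k <= n)%nat -> 0 <= u k) -> 0 <= sum_f_R0 u n.
Proof.
  induction n as [|n IH]; intros H. apply H; auto.
  rewrite tech5. apply Rplus_le_le_0_compat; auto.
Qed.

Lemma quot_coef_upper (c f : nat -> R) n : (forall k, (k < n)%nat -> 0 <= quot_coef c f k) ->
  (forall k, 0 <= f k) -> quot_coef c f n <= c n.
Proof.
  intros H Hf. destruct n as [|n]. right; reflexivity.
  rewrite quot_coef_S.
  assert (0 <= sum_f_R0 (fun j => quot_coef c f j * f (S n - j)%nat) n).
  { apply sum_nonneg. intros k Hk. apply Rmult_le_pos; auto. apply H. lia. }
  lra.
Qed.

(** * The inverse hyperbolic tangent *)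

Definition odd_inv (n : nat) : R := / INR (2 * n + 1).

(** [z + z^3/3 + z^5/5 + ...]: equality in the upper bound forces [a2 = 0] and
    [|a3| = 1/3], which holds for this map of the disk onto a strip. *)
Definition artanh_coef (n : nat) : C :=
  match n with O => 0 | S k => evencoef (fun k => RtoC (odd_inv k)) k end.

Definition artanh : C -> C := Psum artanh_coef.

Lemma odd_inv_eq n : odd_inv n = / (2 * INR n + 1).
Proof. unfold odd_inv. rewrite plus_INR, mult_INR. reflexivity. Qed.

Lemma odd_inv_bounds n : 0 < odd_inv n <= 1.
Proof.
  rewrite odd_inv_eq. assert (H := pos_INR n). split. apply Rinv_0_lt_compat; lra.
  rewrite <- Rinv_1. apply Rinv_le_contravar; lra.
Qed.

Lemma disk_coeffs_odd_inv : disk_coeffs (fun n => RtoC (odd_inv n)).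
Proof.
  apply (disk_coeffs_bounded _ 1). intros n. generalize (odd_inv_bounds n). intros H.
  rewrite Cmod_R, Rabs_pos_eq; lra.
Qed.

Lemma disk_coeffs_artanh : disk_coeffs artanh_coef.
Proof.
  apply (disk_coeffs_bounded _ 1). intros n. destruct n as [|n]; simpl. rewrite Cmod_0; lra.
  unfold evencoef. destruct (Nat.even n).
  generalize (odd_inv_bounds (Nat.div2 n)). intros H. rewrite Cmod_R, Rabs_pos_eq; lra.
  rewrite Cmod_0; lra.
Qed.

Lemma artanh_quotient z : Cmod z < 1 ->
  artanh z = (z * Psum (fun n => RtoC (odd_inv n)) (z ^ 2))%C.
Proof.
  intros Hz. unfold artanh. rewrite Psum_shift; auto using disk_coeffs_artanh.
  simpl artanh_coef at 1. rewrite Cplus_0_l. f_equal.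
  apply (Psum_evencoef (fun n => RtoC (odd_inv n))); auto. apply disk_coeffs_odd_inv.
Qed.

Lemma artanh_0 : artanh 0 = 0.
Proof. rewrite artanh_quotient. ring. rewrite Cmod_0; lra. Qed.

Lemma one_minus_neq_0 z : Cmod z < 1 -> (1 - z)%C <> 0.
Proof.
  intros Hz E. replace z with (1 - (1 - z))%C in Hz by ring. rewrite E in Hz.
  replace (1 - 0)%C with (RtoC 1) in Hz by ring. rewrite Cmod_1 in Hz. lra.
Qed.

Lemma one_plus_neq_0 z : Cmod z < 1 -> (1 + z)%C <> 0.
Proof.
  intros Hz. replace (1 + z)%C with (1 - (- z))%C by ring. apply one_minus_neq_0.
  rewrite Cmod_opp; auto.
Qed.

Lemma artanh_derivative z : Cmod z < 1 -> qdiff artanh z (/ ((1 - z) * (1 + z)))%C.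
Proof.
  intros Hz. assert (D1 : disk_coeffs (fun _ => RtoC 1)).
  { apply (disk_coeffs_bounded _ 1). intros. rewrite Cmod_1. lra. }
  replace (/ ((1 - z) * (1 + z)))%C with (Psum (dcoef artanh_coef) z).
  apply qdiff_Psum; auto using disk_coeffs_artanh.
  rewrite (Psum_ext _ (evencoef (fun _ => RtoC 1)) z); auto using disk_coeffs_evencoef.
  - rewrite Psum_evencoef by auto. assert (Hz2 := sq_in_disk z Hz).
    assert (E := Psum_shift (fun _ => RtoC 1) (z ^ 2)%C D1 Hz2). cbv beta in E.
    set (S := Psum (fun _ => RtoC 1) (z ^ 2)%C) in *.
    assert (N1 := one_minus_neq_0 z Hz). assert (N2 := one_plus_neq_0 z Hz).
    replace S with (((S - z ^ 2 * S)) / ((1 - z) * (1 + z)))%C by (field; auto).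
    replace (S - z ^ 2 * S)%C with (RtoC 1). field; auto.
    rewrite E at 1. ring.
  - intros n. unfold dcoef. simpl artanh_coef. unfold evencoef.
    destruct (Nat.even n) eqn:En; [|ring].
    apply Nat.even_spec in En. destruct En as [k ->]. rewrite Nat.div2_double.
    unfold odd_inv. replace (S (2 * k)) with (2 * k + 1)%nat by lia.
    rewrite <- RtoC_mult. f_equal. field. apply not_0_INR. lia.
Qed.

(** The derivative of [exp (- 2 artanh w) (1 + w) / (1 - w)] is zero. *)
Lemma Cexp_artanh z : Cmod z < 1 -> Cexp (2 * artanh z) = ((1 + z) / (1 - z))%C.
Proof.
  intros Hz. assert (N1 := one_minus_neq_0 z Hz).
  set (h := fun w => (Cexp (- (2) * artanh w) * ((1 + w) * / (1 + - (1) * w)))%C).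
  assert (E : h z = h 0).
  { apply constant_on_disk; auto. intros w Hw.
    assert (M1 := one_minus_neq_0 w Hw). assert (M2 := one_plus_neq_0 w Hw).
    assert (M3 : (1 + - (1) * w)%C <> 0) by (replace (1 + - (1) * w)%C with (1 - w)%C by ring; auto).
    assert (Q1 : qdiff (fun w => Cexp (- (2) * artanh w)) w
       (Cexp (- (2) * artanh w) * (0 * artanh w + - (2) * / ((1 - w) * (1 + w))))%C).
    { apply (qdiff_comp Cexp (fun w => - (2) * artanh w)%C).
      apply (qdiff_mult (fun _ => - (2))%C). apply qdiff_const. apply artanh_derivative; auto.
      apply qdiff_Cexp. }
    assert (Q2 : qdiff (fun w => / (1 + - (1) * w))%C w
       (- / ((1 + - (1) * w) * (1 + - (1) * w)) * (0 + (0 * w + - (1) * 1)))%C).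
    { apply (qdiff_comp (fun w => / w)%C (fun w => 1 + - (1) * w)%C).
      apply qdiff_plus. apply qdiff_const. apply (qdiff_mult (fun _ => - (1))%C).
      apply qdiff_const. apply qdiff_id. apply qdiff_inv; auto. }
    assert (Q := qdiff_mult _ _ _ _ _ Q1 (qdiff_mult _ _ _ _ _
       (qdiff_plus _ _ _ _ _ (qdiff_const 1 w) (qdiff_id w)) Q2)). cbv beta in Q.
    match type of Q with qdiff _ _ ?d => replace (RtoC 0) with d end. exact Q.
    field. split; [|exact M2]. cbv beta. replace (1 + (-1) * w)%C with (1 - w)%C by ring. exact M1. }
  unfold h in E. rewrite artanh_0 in E.
  replace (- (2) * 0)%C with (RtoC 0) in E by ring. rewrite Cexp_0 in E.
  replace (1 + - (1) * z)%C with (1 - z)%C in E by ring.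
  assert (X : (Cexp (2 * artanh z) * Cexp (- (2) * artanh z))%C = 1).
  { rewrite <- Cexp_plus. replace (2 * artanh z + - (2) * artanh z)%C with (RtoC 0) by ring. apply Cexp_0. }
  assert (Y : (Cexp (- (2) * artanh z) * ((1 + z) * / (1 - z)))%C = 1).
  { rewrite E. replace (1 + - (1) * 0)%C with (RtoC 1) by ring. field. }
  set (A := Cexp (2 * artanh z)) in *. set (B := Cexp (- (2) * artanh z)) in *.
  transitivity ((B * ((1 + z) * / (1 - z))) * A)%C. rewrite Y; ring.
  transitivity ((A * B) * ((1 + z) / (1 - z)))%C. unfold Cdiv; ring. rewrite X; ring.
Qed.

Lemma Cmod_Cexp w : Cmod (Cexp w) = exp (Re w).
Proof.
  replace (Cexp w) with (RtoC (exp (Re w)) * cis (Im w))%C.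
  rewrite Cmod_mult, Cmod_cis, Cmod_R, Rabs_pos_eq. ring. left; apply exp_pos.
  unfold Cexp, cis, Cmult, RtoC; simpl. f_equal; ring.
Qed.

Lemma Cexp_inj_strip u v : Rabs (Im u) < PI / 2 -> Rabs (Im v) < PI / 2 ->
  Cexp u = Cexp v -> u = v.
Proof.
  intros Hu Hv E. apply Rabs_def2 in Hu. apply Rabs_def2 in Hv.
  assert (ER : Re u = Re v).
  { apply exp_inv. rewrite <- !Cmod_Cexp, E. reflexivity. }
  assert (EI : Im u = Im v).
  { apply sin_inj; try lra.
    assert (E2 := f_equal Im E). unfold Cexp in E2. simpl in E2. rewrite ER in E2.
    apply Rmult_eq_reg_l with (exp (Re v)); auto. generalize (exp_pos (Re v)). lra. }
  destruct u, v. simpl in ER, EI. subst. reflexivity.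
Qed.

Lemma mobius_re_pos z : Cmod z < 1 -> 0 < Re ((1 + z) / (1 - z)).
Proof.
  intros Hz. assert (N1 := one_minus_neq_0 z Hz).
  assert (P := proj1 (Cmod_gt_0 _) N1).
  assert (E : ((1 + z) / (1 - z))%C = (RtoC (/ Cmod (1 - z) ^ 2) * ((1 + z) * Cconj (1 - z)))%C).
  { rewrite RtoC_inv by (apply pow_nonzero; lra). rewrite Cmod2_conj. field.
    split; auto. intros X. apply N1. rewrite <- (Cconj_conj (1 - z)), X.
    unfold Cconj, RtoC; simpl. f_equal; ring. }
  rewrite E, re_scal_l. apply Rmult_lt_0_compat. apply Rinv_0_lt_compat, pow_lt; auto.
  assert (Z2 : Cmod z ^ 2 < 1) by (assert (H := Cmod_ge_0 z); nra). rewrite Cmod2_alt in Z2.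
  destruct z as [x y]. simpl in *. nra.
Qed.

Lemma cos_im_artanh_pos z : Cmod z < 1 -> 0 < cos (2 * Im (artanh z)).
Proof.
  intros Hz. assert (H := mobius_re_pos z Hz). rewrite <- Cexp_artanh in H by auto.
  set (w := (2 * artanh z)%C) in H.
  change (0 < exp (Re w) * cos (Im w)) in H.
  replace (2 * Im (artanh z)) with (Im w) by (unfold w; rewrite im_scal_l; reflexivity).
  apply Rmult_lt_reg_l with (exp (Re w)). apply exp_pos. rewrite Rmult_0_r. exact H.
Qed.

(** The strip is found by connectedness: along a ray from the origin
    [2 * Im (artanh z)] starts at 0 and cannot cross a zero of the cosine. *)
Lemma im_artanh_bound z : Cmod z < 1 -> Rabs (Im (artanh z)) < PI / 4.
Proof.
  intros Hz. assert (HPI := PI_RGT_0).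
  assert (In : forall t : R, 0 <= t <= 1 -> Cmod (RtoC t * z) < 1).
  { intros t Ht. rewrite Cmod_mult, Cmod_R, Rabs_pos_eq by lra. assert (P := Cmod_ge_0 z). nra. }
  assert (Hc : forall t, 0 <= t <= 1 -> continuity_pt (fun t => Im (artanh (RtoC t * z)%C)) t).
  { intros t Ht. apply continuity_pt_filterlim.
    apply (ex_derive_continuous (fun t => Im (artanh (RtoC t * z)%C))).
    assert (Q : qdiff (fun w => artanh (w * z)%C) (RtoC t)
       (/ ((1 - RtoC t * z) * (1 + RtoC t * z)) * (1 * z + RtoC t * 0))%C).
    { apply (qdiff_comp artanh (fun w => w * z)%C).
      apply (qdiff_mult (fun w => w)). apply qdiff_id. apply qdiff_const.
      apply artanh_derivative. apply In; auto. }
    eexists. apply (qdiff_real _ t _ Q). }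
  assert (K : forall s, (s = 1 \/ s = -1) -> s * Im (artanh z) < PI / 4).
  { intros s Hs. apply Rnot_le_lt. intros Hle.
    assert (C1' : forall t, 0 <= t <= 1 -> 0 < cos (2 * Im (artanh (RtoC t * z)%C))).
    { intros t Ht. apply cos_im_artanh_pos. apply In; auto. }
    assert (Z0 : Im (artanh (0 * z)%C) = 0).
    { replace (0 * z)%C with (RtoC 0) by ring. rewrite artanh_0. reflexivity. }
    assert (E1 : (1 * z)%C = z) by ring.
    assert (Hex : exists t, 0 <= t <= 1 /\ s * Im (artanh (RtoC t * z)%C) = PI / 4).
    { destruct (Rle_lt_or_eq_dec _ _ Hle) as [Hlt|Heq].
      - destruct (IVT_interv (fun t => s * Im (artanh (RtoC t * z)%C) - PI / 4) 0 1) as (t & Ht & Et).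
        + intros t Ht. apply continuity_pt_minus. apply continuity_pt_scal. apply Hc; auto.
          apply continuity_pt_const. intros x y; reflexivity.
        + lra.
        + rewrite Z0. lra.
        + rewrite E1. lra.
        + exists t. split; auto. lra.
      - exists 1. split. lra. rewrite E1. lra. }
    destruct Hex as (t & Ht & Et). specialize (C1' t Ht).
    assert (E2 : 2 * Im (artanh (RtoC t * z)%C) = PI / 2 \/ 2 * Im (artanh (RtoC t * z)%C) = - (PI / 2)).
    { destruct Hs as [-> | ->]; [left|right]; lra. }
    destruct E2 as [E2|E2]; rewrite E2 in C1'; [|rewrite cos_neg in C1']; rewrite cos_PI2 in C1'; lra. }
  apply Rabs_def1. generalize (K 1 (or_introl eq_refl)). lra.
  generalize (K (-1) (or_intror eq_refl)). lra.
Qed.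

Lemma artanh_injective z w : Cmod z < 1 -> Cmod w < 1 -> artanh z = artanh w -> z = w.
Proof.
  intros Hz Hw E. assert (E1 := Cexp_artanh z Hz). rewrite E, Cexp_artanh in E1 by auto.
  assert (N1 := one_minus_neq_0 z Hz). assert (N2 := one_minus_neq_0 w Hw).
  apply Ceq_minus.
  replace (z - w)%C with (((1 + z) / (1 - z) - (1 + w) / (1 - w)) * ((1 - z) * (1 - w)) / 2)%C
    by (field; auto).
  rewrite E1. field. auto.
Qed.

Lemma artanh_image w : disk_image artanh w <-> Rabs (Im w) < PI / 4.
Proof.
  assert (HPI := PI_RGT_0). split.
  - intros (z & Hz & <-). apply im_artanh_bound; auto.
  - intros Hw. set (e := Cexp (2 * w)).
    assert (I2 : Im (2 * w)%C = 2 * Im w) by (rewrite im_scal_l; reflexivity).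
    assert (He : 0 < Re e).
    { unfold e. change (0 < exp (Re (2 * w)%C) * cos (Im (2 * w)%C)). rewrite I2. apply Rmult_lt_0_compat. apply exp_pos.
      apply Rabs_def2 in Hw. apply cos_gt_0; lra. }
    assert (Hle : Cmod (e - 1) < Cmod (e + 1)).
    { assert (X : Cmod (e - 1) ^ 2 < Cmod (e + 1) ^ 2).
      { rewrite !Cmod2_alt. destruct e as [x y]. simpl in *. nra. }
      apply Rnot_le_lt. intros Hge. assert (Y := Cmod_ge_0 (e + 1)).
      assert (Cmod (e + 1) ^ 2 <= Cmod (e - 1) ^ 2) by (apply pow_incr; auto). lra. }
    assert (Hp : 0 < Cmod (e + 1)) by (generalize (Cmod_ge_0 (e - 1)); lra).
    assert (Hn : (e + 1)%C <> 0) by (apply Cmod_gt_0; auto).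
    set (z := ((e - 1) / (e + 1))%C).
    assert (Hz : Cmod z < 1).
    { unfold z. rewrite Cmod_div by auto. apply Rmult_lt_reg_r with (Cmod (e + 1)); auto.
      unfold Rdiv. rewrite Rmult_assoc, Rinv_l; lra. }
    exists z. split; auto.
    assert (E2 : (2 * artanh z)%C = (2 * w)%C).
    { apply Cexp_inj_strip.
      - rewrite im_scal_l, Rabs_mult, Rabs_pos_eq by lra. generalize (im_artanh_bound z Hz). lra.
      - rewrite I2, Rabs_mult, Rabs_pos_eq by lra. lra.
      - rewrite Cexp_artanh by auto. fold e.
        assert (N1 := one_minus_neq_0 z Hz).
        replace (1 + z)%C with (2 * e / (e + 1))%C by (unfold z; field; auto).
        replace (1 - z)%C with (2 / (e + 1))%C by (unfold z; field; auto).
        field. auto. }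
    replace (artanh z) with ((2 * artanh z) / 2)%C by field. rewrite E2. field.
Qed.

Lemma qdiff_is_derive h z d : qdiff h z d -> @is_derive C_AbsRing C_NormedModule h z d.
Proof.
  intros (K & del & HK & Hd & H). split.
  - apply (@is_linear_scal_l C_AbsRing C_NormedModule).
  - intros x Hx. apply (@is_filter_lim_locally_unique C_AbsRing (AbsRing_NormedModule C_AbsRing)) in Hx.
    subst x. intros eps. assert (He := cond_pos eps).
    destruct (small_factor eps K He HK) as (s & Hs & Hs').
    assert (Hm : 0 < Rmin del s) by (apply Rmin_pos; auto).
    exists (mkposreal _ Hm). intros w Hw.
    change (Cmod (w - z) < Rmin del s) in Hw.
    change (Cmod (h w - h z - (w - z) * d) <= eps * Cmod (w - z)).
    assert (W1 := Rlt_le_trans _ _ _ Hw (Rmin_l _ _)). assert (W2 := Rlt_le_trans _ _ _ Hw (Rmin_r _ _)).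
    rewrite (Cmult_comm (w - z)). eapply Rle_trans; [apply H; auto|].
    assert (P := Cmod_ge_0 (w - z)). simpl. rewrite Rmult_1_r, <- Rmult_assoc.
    apply Rmult_le_compat_r; auto. apply Rle_trans with (2 := Hs'). apply Rmult_le_compat_l; lra.
Qed.

Lemma qdiff_continuous h z d : qdiff h z d -> @continuous C_UniformSpace C_UniformSpace h z.
Proof.
  intros Q. apply (filterlim_locally (U := C_UniformSpace)). intros eps.
  destruct (qdiff_lipschitz _ _ _ Q) as (L & del & HL & Hd & H).
  destruct (small_factor (eps / 2) L) as (s & Hs & Hs'); auto. generalize (cond_pos eps); lra.
  assert (Hm : 0 < Rmin del s / 2) by (assert (0 < Rmin del s) by (apply Rmin_pos; auto); lra).
  exists (mkposreal _ Hm). intros w Hw. apply C_NormedModule_mixin_compat1.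
  apply C_NormedModule_mixin_compat2 in Hw.
  change (Cmod (w - z) < sqrt 2 * (Rmin del s / 2)) in Hw. change (Cmod (h w - h z) < eps).
  assert (S2 : sqrt 2 <= 2).
  { rewrite <- (sqrt_square 2) at 2 by lra. apply sqrt_le_1_alt. lra. }
  assert (sqrt 2 * (Rmin del s / 2) <= 2 * (Rmin del s / 2)) by (apply Rmult_le_compat_r; lra).
  assert (M1 := Rmin_l del s). assert (M2 := Rmin_r del s).
  assert (L * Cmod (w - z) <= L * s) by (apply Rmult_le_compat_l; lra).
  specialize (H w ltac:(lra)). generalize (cond_pos eps). lra.
Qed.

Lemma class_K_artanh : class_K artanh.
Proof.
  assert (HPI := PI_RGT_0). split; [|split].
  - split.
    + intros z Hz. eexists. apply qdiff_is_derive. apply artanh_derivative; auto.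
    + exists artanh_coef. split; auto. split.
      * simpl. unfold evencoef, odd_inv. simpl. rewrite Rinv_1. reflexivity.
      * intros z Hz. apply is_pseries_pser. apply Psum_pser; auto. apply disk_coeffs_artanh.
  - intros z w Hz Hw. apply artanh_injective; auto.
  - split; [|split].
    + exists (RtoC 0). apply artanh_image. simpl. rewrite Rabs_R0. lra.
    + apply (open_ext (fun w : C_UniformSpace => Rabs (Im w) < PI / 4)).
      { intros w. symmetry. apply artanh_image. }
      intros w Hw. assert (Hd : 0 < PI / 4 - Rabs (Im w)) by lra.
      exists (mkposreal _ Hd). intros v [_ Hv].
      change (Rabs (Im v - Im w) < PI / 4 - Rabs (Im w)) in Hv.
      replace (Im v) with ((Im v - Im w) + Im w) by ring.
      eapply Rle_lt_trans; [apply Rabs_triang|]. lra.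
    + intros p q t Hp Hq Ht. rewrite artanh_image in Hp, Hq |- *.
      rewrite im_plus, !im_scal_l. apply Rabs_def2 in Hp. apply Rabs_def2 in Hq.
      assert (X : forall a b M, a < M -> b < M -> (1 - t) * a + t * b < M).
      { intros a b M Ha Hb. apply Rle_lt_trans with (Rmax a b); [|apply Rmax_lub_lt; auto].
        replace (Rmax a b) with ((1 - t) * Rmax a b + t * Rmax a b) by ring.
        apply Rplus_le_compat; apply Rmult_le_compat_l; try lra; [apply Rmax_l|apply Rmax_r]. }
      assert (U := X (Im p) (Im q) (PI / 4)). assert (L := X (- Im p) (- Im q) (PI / 4)).
      apply Rabs_def1; lra.
Qed.

(** * The logarithm of artanh z / z *)

(** With [x = z^2], [artanh z / z = Phi x] where [Phi x] has the coefficients [1/(2n+1)];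
    these are the coefficients of [Phi' / Phi], the derivative of [log Phi]. *)
Definition log_quot_dcoef : nat -> R := quot_coef (fun n => INR (S n) * odd_inv (S n)) odd_inv.

(** The bound makes the logarithm converge in the whole disk. Positivity is Kaluza's
    argument: the ratios [f (n+1) / f n] of the coefficients [f n = 1/(2n+1)] increase
    with [n], so the convolution equation at [n] bounds the sum that is subtracted in
    the equation at [n+1]. Positive terms then give the upper bound. *)
Lemma log_quot_dcoef_bounds n : 0 <= log_quot_dcoef n <= 1.
Proof.
  assert (F : forall k, 0 <= odd_inv k) by (intros k; generalize (odd_inv_bounds k); lra).
  assert (F0 : odd_inv 0 = 1) by (unfold odd_inv; simpl; apply Rinv_1).
  set (c := fun n => INR (S n) * odd_inv (S n)).
  assert (Hc : forall k, 0 <= c k <= 1).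
  { intros k. unfold c. rewrite odd_inv_eq, S_INR. assert (P := pos_INR k). split.
    apply Rmult_le_pos. lra. left; apply Rinv_0_lt_compat; lra.
    apply Rmult_le_reg_r with (2 * (INR k + 1) + 1). lra.
    rewrite Rmult_assoc, Rinv_l; lra. }
  assert (L : forall n k, (k <= n)%nat -> 0 <= log_quot_dcoef k).
  { clear n. induction n as [|n IH]; intros k Hk.
    - replace k with 0%nat by lia. apply (Hc 0%nat).
    - destruct (Nat.eq_dec k (S n)) as [->|Hk2]; [|apply IH; lia].
      unfold log_quot_dcoef. rewrite quot_coef_S. fold log_quot_dcoef.
      assert (P := pos_INR n).
      set (rho := (2 * INR n + 3) / (2 * INR n + 5)).
      assert (Hr : 0 <= rho) by (apply Rdiv_le_0_compat; lra).
      assert (B : sum_f_R0 (fun j => log_quot_dcoef j * odd_inv (S n - j)%nat) n <= rho * c n).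
      { rewrite <- (quot_coef_conv c odd_inv n F0). rewrite scal_sum. apply sum_Rle. intros j Hj.
        change (quot_coef c odd_inv j) with (log_quot_dcoef j).
        rewrite Rmult_assoc. apply Rmult_le_compat_l. apply IH; auto.
        replace (S n - j)%nat with (S (n - j)) by lia.
        assert (Hjn : INR (n - j) <= INR n) by (apply le_INR; lia).
        assert (Q := pos_INR (n - j)). set (x := INR (n - j)) in *.
        rewrite !odd_inv_eq, S_INR. fold x. unfold rho.
        apply Rmult_le_reg_r with ((2 * (x + 1) + 1) * ((2 * x + 1) * (2 * INR n + 5))).
        repeat apply Rmult_lt_0_compat; lra.
        replace (/ (2 * (x + 1) + 1) * ((2 * (x + 1) + 1) * ((2 * x + 1) * (2 * INR n + 5))))
          with ((2 * x + 1) * (2 * INR n + 5)) by (field; lra).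
        replace (/ (2 * x + 1) * ((2 * INR n + 3) / (2 * INR n + 5)) *
           ((2 * (x + 1) + 1) * ((2 * x + 1) * (2 * INR n + 5)))) with
          ((2 * x + 3) * (2 * INR n + 3)) by (field; lra).
        nra. }
      assert (E : rho * c n <= INR (S (S n)) * odd_inv (S (S n))).
      { unfold c, rho. rewrite !odd_inv_eq, !S_INR.
        replace ((2 * INR n + 3) / (2 * INR n + 5) * ((INR n + 1) * / (2 * (INR n + 1) + 1))) with
          ((INR n + 1) * / (2 * INR n + 5)) by (field; lra).
        replace (2 * (INR n + 1 + 1) + 1) with (2 * INR n + 5) by ring.
        apply Rmult_le_compat_r. left; apply Rinv_0_lt_compat; lra. lra. }
      lra. }
  split. apply (L n); auto.
  apply Rle_trans with (c n); [|apply Hc].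
  apply (quot_coef_upper c odd_inv n); auto. intros k Hk. apply (L n). lia.
Qed.

Definition log_quot_coef (n : nat) : C :=
  match n with O => 0 | S k => RtoC (log_quot_dcoef k / INR (S k)) end.

Lemma dcoef_log_quot n : dcoef log_quot_coef n = RtoC (log_quot_dcoef n).
Proof.
  unfold dcoef. cbn [log_quot_coef]. rewrite <- RtoC_mult. f_equal. field. apply not_0_INR; lia.
Qed.

Lemma disk_coeffs_log_quot : disk_coeffs log_quot_coef.
Proof.
  apply (disk_coeffs_bounded _ 1). intros [|n]. simpl; rewrite Cmod_0; lra. generalize (log_quot_dcoef_bounds n). intros H.
  assert (P := pos_INR n).
  assert (Q : 1 <= INR (S n)) by (rewrite S_INR; lra).
  assert (D : 0 <= log_quot_dcoef n / INR (S n) <= 1).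
  { split. apply Rdiv_le_0_compat; lra.
    apply Rmult_le_reg_r with (INR (S n)). lra. unfold Rdiv. rewrite Rmult_assoc, Rinv_l; lra. }
  change (Cmod (RtoC (log_quot_dcoef n / INR (S n))) <= 1).
  rewrite Cmod_R, Rabs_pos_eq; lra.
Qed.

Lemma RtoC_sum (u : nat -> R) n : RtoC (sum_f_R0 u n) = csum (fun k => RtoC (u k)) n.
Proof.
  induction n as [|n IH]. rewrite csum_0. reflexivity.
  rewrite tech5, RtoC_plus, csum_S, IH. reflexivity.
Qed.

(** Since [Phi' = (log Phi)' Phi] as a convolution of coefficients, [exp (- log Phi) Phi]
    has derivative zero. *)
Lemma Cexp_log_quot x : Cmod x < 1 ->
  Cexp (Psum log_quot_coef x) = Psum (fun n => RtoC (odd_inv n)) x.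
Proof.
  intros Hx. set (phi := fun n => RtoC (odd_inv n)).
  assert (Dp : disk_coeffs phi) by apply disk_coeffs_odd_inv.
  assert (Dl := disk_coeffs_log_quot).
  assert (ODE : forall w, Cmod w < 1 ->
    Psum (dcoef phi) w = (Psum (dcoef log_quot_coef) w * Psum phi w)%C).
  { intros w Hw. rewrite <- Psum_mult by (auto using disk_coeffs_dcoef).
    symmetry. apply Psum_ext; auto using disk_coeffs_dcoef. intros n.
    unfold dcoef at 2, phi. rewrite <- RtoC_mult.
    rewrite <- (quot_coef_conv (fun n => INR (S n) * odd_inv (S n)) odd_inv n).
    - rewrite RtoC_sum. apply csum_ext. intros k Hk. rewrite dcoef_log_quot, <- RtoC_mult. reflexivity.
    - unfold odd_inv; simpl; apply Rinv_1. }
  set (h := fun w => (Cexp (- (1) * Psum log_quot_coef w) * Psum phi w)%C).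
  assert (E : h x = h 0).
  { apply constant_on_disk; auto. intros w Hw.
    assert (Q1 : qdiff (fun w => Cexp (- (1) * Psum log_quot_coef w)) w
      (Cexp (- (1) * Psum log_quot_coef w) *
         (0 * Psum log_quot_coef w + - (1) * Psum (dcoef log_quot_coef) w))%C).
    { apply (qdiff_comp Cexp (fun w => - (1) * Psum log_quot_coef w)%C).
      apply (qdiff_mult (fun _ => - (1))%C). apply qdiff_const. apply qdiff_Psum; auto.
      apply qdiff_Cexp. }
    assert (Q := qdiff_mult _ _ _ _ _ Q1 (qdiff_Psum phi w Dp Hw)). cbv beta in Q.
    rewrite (ODE w Hw) in Q.
    match type of Q with qdiff _ _ ?d => replace (RtoC 0) with d end. exact Q. ring. }
  unfold h in E. rewrite !Psum_at_0 in E by auto.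
  replace (- (1) * log_quot_coef 0)%C with (RtoC 0) in E by (simpl; ring). rewrite Cexp_0 in E.
  assert (P0 : phi 0%nat = 1) by (unfold phi, odd_inv; simpl; rewrite Rinv_1; reflexivity).
  rewrite P0 in E.
  assert (X : (Cexp (Psum log_quot_coef x) * Cexp (- (1) * Psum log_quot_coef x))%C = 1).
  { rewrite <- Cexp_plus.
    replace (Psum log_quot_coef x + - (1) * Psum log_quot_coef x)%C with (RtoC 0) by ring. apply Cexp_0. }
  set (A := Cexp (Psum log_quot_coef x)) in *. set (B := Cexp (- (1) * Psum log_quot_coef x)) in *.
  transitivity (A * (B * Psum phi x))%C. rewrite E; ring.
  rewrite Cmult_assoc, X. ring.
Qed.

Definition artanh_gamma (n : nat) : C := (evencoef log_quot_coef n / 2)%C.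

Lemma log_coefficients_artanh : log_coefficients artanh artanh_gamma.
Proof.
  assert (Dl := disk_coeffs_log_quot). assert (De := disk_coeffs_evencoef _ Dl).
  assert (C0 : Cmod 0 < 1) by (rewrite Cmod_0; lra).
  exists (Psum (evencoef log_quot_coef)). split; [split; [|split]|].
  - rewrite Psum_at_0; auto.
  - intros z Hz. eapply qdiff_continuous. apply qdiff_Psum; auto.
  - intros z Hz Hz0. rewrite Psum_evencoef, Cexp_log_quot, artanh_quotient by (auto using sq_in_disk).
    field. auto.
  - intros z Hz. exists (Psum (evencoef log_quot_coef) z / 2)%C. split; [|field].
    assert (S := Cser_shift _ _ (Cser_scal (/ 2)%C _ _ (Psum_pser _ z De Hz))). cbv beta in S.
    replace (Psum (evencoef log_quot_coef) z / 2)%C with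
      (/ 2 * Psum (evencoef log_quot_coef) z - / 2 * (evencoef log_quot_coef 0 * z ^ 0))%C
      by (unfold evencoef; simpl; field).
    revert S. apply Cser_ext. intros n. unfold artanh_gamma. field.
Qed.

Theorem theorem2 :
  (forall (f : C -> C) (gamma : nat -> C),
     class_K f -> log_coefficients f gamma ->
     - (1 / sqrt 10) <= Cmod (gamma 2%nat) - Cmod (gamma 1%nat) <= 1 / 6)
  /\
  (exists (f : C -> C) (gamma : nat -> C),
     class_K f /\ log_coefficients f gamma /\
     Cmod (gamma 2%nat) - Cmod (gamma 1%nat) = 1 / 6).
Proof.
  split.
  - exact log_coefficients_bounds.
  - exists artanh, artanh_gamma. split. apply class_K_artanh. split. apply log_coefficients_artanh.
    assert (E1 : artanh_gamma 1 = 0) by (unfold artanh_gamma, evencoef; simpl; field).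
    assert (E2 : artanh_gamma 2 = RtoC (1 / 6)).
    { unfold artanh_gamma, evencoef. simpl. unfold log_quot_dcoef, quot_coef. simpl.
      unfold odd_inv. simpl. rewrite <- RtoC_div by lra. f_equal. field. }
    rewrite E1, E2, Cmod_0, Cmod_R, Rabs_pos_eq; lra.
Qed.
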